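(* Let $0<\alpha<1$, $0<k<1$, $c^{*}>2\sqrt{\alpha}$, and let $U^{*}$ be the traveling wave solution with speed $c^*$. Let $\sigma_1,\sigma_2$ satisfy $$0\leq\sigma_{1}<\frac{-c^{*}+\sqrt{c^{*2}+4\alpha}}{2},\qquad \frac{c^{*}-\sqrt{c^{*2}-4\alpha}}{2}<\sigma_{2}<\frac{c^{*}+\sqrt{c^{*2}-4\alpha}}{2}.$$ Then $U^{*}$ is asymptotically stable according to the norm $\|\cdot\|:=\|\cdot\|_{C_{\sigma_1,\sigma_2}}$. That is, if the initial condition $U(\xi,0)=\bar U(\xi)$ is continuous on $\mathbb{R}$ with $\bar U-U^{*}\in C_{\sigma_1,\sigma_2}$ and $\|\bar U-U^{*}\|$ sufficiently small, then the solution $U(\xi,t)$ of $$U_t=U_{\xi\xi}-c^{*}U_\xi+F(U),\qquad U(\xi,0)=\bar U(\xi)$$ exists uniquely for all $t>0$ and satisfies $$\|U(\cdot,t)-U^{*}\|\leq Me^{-bt},$$ where the constants $M>0$, $b>0$ are independent of $t$ and $\bar U$.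
   Context: $K^{*}=\frac{1-\alpha}{1-k+\alpha k}$, $U=(u,v)^T$, and $$F(U)=\left(-(K^{*}-u)\Big(1-\alpha-\frac{K^{*}-u+v}{1+k(K^{*}-u)}\Big),\ v\Big(1-\frac{K^{*}-u+v}{1+k(K^{*}-u)}\Big)\right)^{T}.$$ The traveling wave solution $U^{*}=(u^*,v^* )^T$ with speed $c^*>2\sqrt\alpha$ is the (unique up to translation) solution on $\mathbb{R}$ of $U''-c^{*}U'+F(U)=0$ with $U(-\infty)=(0,0)^T$, $U(+\infty)=(K^{*},1)^T$; it is strictly increasing in both components, with $U^*(\xi)=(A_1,A_2)^Te^{\frac{c^*-\sqrt{c^{*2}-4\alpha}}{2}\xi}(1+o(1))$ as $\xi\to-\infty$ and $U^*(\xi)=(K^*,1)^T-(\bar A_1,\bar A_2)^Te^{\frac{c^*-\sqrt{c^{*2}+4\alpha}}{2}\xi}(1+o(1))$ as $\xi\to+\infty$, for positive constants $A_i,\bar A_i$. Spaces: $C_0=\{U\in C(\mathbb{R})\times C(\mathbb{R}) : \lim_{|\xi|\to\infty}\|U(\xi)\|=0\}$ with the sup norm, and $C_{\sigma_1,\sigma_2}=\{U : (e^{\sigma_1\xi}+e^{-\sigma_2\xi})U(\xi)\in C_0\}$ with norm $\|U\|_{C_{\sigma_1,\sigma_2}}=\sup_{\xi\in\mathbb{R}}\|(e^{\sigma_1\xi}+e^{-\sigma_2\xi})U(\xi)\|$. *)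

(* Defs.v *)
(* Vectors (u, v)^T are elements of [R * R], whose library norm is the maximum
   norm. *)
From HB Require Import structures.
From mathcomp Require Export all_boot all_order all_algebra.
From mathcomp Require Export all_classical all_reals all_analysis.

Set Implicit Arguments.
Unset Strict Implicit.
Unset Printing Implicit Defensive.

Export Order.TTheory GRing.Theory Num.Theory.
Export numFieldNormedType.Exports.

#[global] Open Scope ring_scope.
#[global] Open Scope classical_set_scope.

Definition Kstar {R : realType} (alpha k : R) : R :=
  (1 - alpha) / (1 - k + alpha * k).

(* F is meaningful only where [denom] does not vanish. *)
Definition denom {R : realType} (alpha k : R) (U : R * R) : R :=
  1 + k * (Kstar alpha k - U.1).

Definition F {R : realType} (alpha k : R) (U : R * R) : R * R :=
  let w := Kstar alpha k - U.1 in
  let q := (w + U.2) / denom alpha k U in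
  (- (w * (1 - alpha - q)), U.2 * (1 - q)).

(* No nonvanishing condition on [denom] is needed here: monotonicity and the
   limits force 0 < u < Kstar, hence denom > 1. The asymptotic relations
   f = A g (1 + o(1)) are written f / (A g) --> 1. *)
Record traveling_wave {R : realType} (alpha k c : R)
    (U : R -> R * R) : Prop := {
  tw_derivable : forall xi : R, derivable U xi 1 ;
  tw_derivable2 : forall xi : R, derivable (derive1 U) xi 1 ;
  tw_ode : forall xi : R,
    derive1 (derive1 U) xi - c *: derive1 U xi + F alpha k (U xi) = 0 ;
  tw_left : U xi @[xi --> -oo] --> ((0, 0) : R * R) ;
  tw_right : U xi @[xi --> +oo] --> ((Kstar alpha k, 1) : R * R) ;
  tw_incr1 : {homo (fun xi => (U xi).1) : x y / x < y} ;
  tw_incr2 : {homo (fun xi => (U xi).2) : x y / x < y} ;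
  tw_asympt_left :
    let lambda := (c - Num.sqrt (c ^+ 2 - 4 * alpha)) / 2 in
    exists A1 A2 : R, [/\ 0 < A1, 0 < A2,
      (U xi).1 / (A1 * expR (lambda * xi)) @[xi --> -oo] --> (1 : R) &
      (U xi).2 / (A2 * expR (lambda * xi)) @[xi --> -oo] --> (1 : R)] ;
  tw_asympt_right :
    let mu := (c - Num.sqrt (c ^+ 2 + 4 * alpha)) / 2 in
    exists A1 A2 : R, [/\ 0 < A1, 0 < A2,
      (Kstar alpha k - (U xi).1) / (A1 * expR (mu * xi)) @[xi --> +oo]
        --> (1 : R) &
      (1 - (U xi).2) / (A2 * expR (mu * xi)) @[xi --> +oo] --> (1 : R)]
}.

Definition C0_space {R : realType} (U : R -> R * R) : Prop :=
  [/\ continuous U,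
      `|U xi| @[xi --> -oo] --> (0 : R) &
      `|U xi| @[xi --> +oo] --> (0 : R)].

Definition weight {R : realType} (sigma1 sigma2 xi : R) : R :=
  expR (sigma1 * xi) + expR (- (sigma2 * xi)).

Definition Csigma {R : realType} (sigma1 sigma2 : R) (U : R -> R * R) : Prop :=
  C0_space (fun xi => weight sigma1 sigma2 xi *: U xi).

(* A real-valued supremum: only meaningful on members of [Csigma], where the
   set is nonempty and bounded. *)
Definition Cnorm {R : realType} (sigma1 sigma2 : R) (U : R -> R * R) : R :=
  sup (range (fun xi : R => `|weight sigma1 sigma2 xi *: U xi|)).

Definition d_xi {R : realType} (U : R -> R -> R * R) : R -> R -> R * R :=
  fun xi t => derive1 (U^~ t) xi.

Definition d_t {R : realType} (U : R -> R -> R * R) : R -> R -> R * R :=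
  fun xi t => derive1 (U xi) t.

Definition jointly_continuous {R : realType} (T : \bar R)
    (f : R -> R -> R * R) : Prop :=
  forall xi t : R, 0 < t -> (t%:E < T)%E ->
    {for (xi, t), continuous (fun p : R * R => f p.1 p.2)}.

(* Classical solutions U(xi, t) on R x [0, T[, T possibly +oo, whose deviation
   from the wave is a continuous curve in the phase space [Csigma]. The phase
   space is part of the notion: without a restriction at |xi| = oo the Cauchy
   problem has no uniqueness. *)
Record solution {R : realType} (alpha k c sigma1 sigma2 : R)
    (Ustar : R -> R * R) (T : \bar R) (Ubar : R -> R * R)
    (U : R -> R -> R * R) : Prop := {
  sol_init : forall xi : R, U xi 0 = Ubar xi ;
  sol_space : forall t : R, 0 <= t -> (t%:E < T)%E ->
    Csigma sigma1 sigma2 (U^~ t \- Ustar) ;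
  sol_continuous : forall t0 : R, 0 <= t0 -> (t0%:E < T)%E ->
    Cnorm sigma1 sigma2 (U^~ t \- U^~ t0)
      @[t --> within [set t | 0 <= t /\ (t%:E < T)%E] (nbhs t0)] --> (0 : R) ;
  sol_domain : forall xi t : R, 0 <= t -> (t%:E < T)%E ->
    denom alpha k (U xi t) != 0 ;
  sol_derivable_t : forall xi t : R, 0 < t -> (t%:E < T)%E ->
    derivable (U xi) t 1 ;
  sol_derivable_xi : forall xi t : R, 0 < t -> (t%:E < T)%E ->
    derivable (U^~ t) xi 1 ;
  sol_derivable_xixi : forall xi t : R, 0 < t -> (t%:E < T)%E ->
    derivable ((d_xi U)^~ t) xi 1 ;
  sol_C1_t : jointly_continuous T (d_t U) ;
  sol_C1_xi : jointly_continuous T (d_xi U) ;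
  sol_C2_xi : jointly_continuous T (d_xi (d_xi U)) ;
  sol_pde : forall xi t : R, 0 < t -> (t%:E < T)%E ->
    d_t U xi t = d_xi (d_xi U) xi t - c *: d_xi U xi t + F alpha k (U xi t)
}.

(* Main.v *)
Require Import Defs.
From mathcomp Require Import ring lra measurable_realfun gauss_integral ftc.

(** Write U = Ustar + W.  Along the wave the off-diagonal entries of F'(Ustar) are
    nonnegative, so the linearised system is cooperative and admits a maximum
    principle, and the derivative of the wave is a positive solution of it.
    At -oo this derivative decays like e^(lambda xi) with lambda < sigma2, at
    +oo faster than e^(-sigma1 xi), by a Harnack inequality and the asymptotics
    of Ustar.  Multiplying it by 1 - e^(-m (xi - y)) / 2, adding a small multiple of
    r e^(-sigma1 xi), and taking the minimum with l e^(sigma2 xi) on the left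
    produces a positive vector Phi, comparable to the inverse of the weight, with
    Phi'' - c Phi' + F'(Ustar) Phi <= - b Phi in the sense of touching functions.
    As long as |W_i| <= eta e^(- b t / 2) Phi_i the quadratic remainder of F is
    absorbed by b Phi, so this bound can never be reached for the first time and
    persists; it is the asserted decay.  Existence comes from a Picard iteration on
    the Duhamel formula for a truncated, globally Lipschitz nonlinearity: the
    decay shows that the truncation is never active.  Uniqueness is the same
    comparison argument for the difference of two solutions, with a growing
    factor e^(kappa t). *)

Set Implicit Arguments.
Unset Strict Implicit.
Unset Printing Implicit Defensive.

(** * Limits, one-sided derivatives and maxima *)

Section calculus.
Context {R : realType}.
Implicit Types (f g : R -> R).

(** Every translate of the wave is again a steady state, so decay without a phase shift can hold
    only if translates are not admissible perturbations. The condition lambda < sigma2 ensures this: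
    the difference of two translates is of order e^(lambda xi) at -oo, too large for the weight
    e^(-sigma2 xi). For the same reason the wave derivative, a neutral mode, can be cut off on the
    left and turned into a strict supersolution. The Jacobians of F at the two end states are
    triangular; the bounds on sigma1 and sigma2 say that e^(sigma2 xi) and e^(-sigma1 xi) are strict
    supersolutions of the critical scalar equation at the corresponding end, and a large constant in
    the other component absorbs the coupling. Two obstacles shape the analysis. The line is not
    compact, so a strict pointwise inequality becomes uniform only because the weighted deviation
    vanishes at infinity, and this must be carried through the existence proof. The datum is merely
    continuous, so the first space derivative may blow up like t^(-1/2); every Duhamel estimate has
    to tolerate this singularity. *)

Lemma cvg_within_seq (T : pseudoMetricType R) (D : set T) (p : T) (f : T -> R)
    (l : R) :
  (forall u : nat -> T, (forall n, D (u n)) -> u n @[n --> \oo] --> p ->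
     f (u n) @[n --> \oo] --> l) ->
  f x @[x --> within D (nbhs p)] --> l.
Proof.
move=> H; apply/cvgrPdist_lt => e e0.
apply: contrapT => Hn.
have Hu n : exists u, [/\ ball p (n.+1%:R^-1) u, D u & ~ `|l - f u| < e].
  apply: contrapT => Hu; apply: Hn.
  rewrite /prop_near1 /fmap /within /=.
  apply/nbhs_ballP; exists n.+1%:R^-1 => /=; first by rewrite invr_gt0.
  move=> x px Dx; apply: contrapT => Hx.
  by apply: Hu; exists x.
have [u Hu'] := choice Hu.
have up : u n @[n --> \oo] --> p.
  apply/cvg_ballP => d d0.
  near=> n.
  have [B _ _] := Hu' n.
  apply: le_ball B.
  near: n; have := near_infty_natSinv_lt (PosNum d0).
  by apply: filterS => m /=; exact: ltW.
have uD n : D (u n) by have [_ ? _] := Hu' n.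
have /cvgrPdist_lt/(_ e e0)[N _ HN] := H u uD up.
have [_ _] := Hu' N; apply.
exact: (HN N (leqnn N)).
Unshelve. all: end_near. Qed.

(** Neighbourhood filters of a metric space have countable bases, so the limit is tested on
    sequences and dominated convergence applies. The restriction to [D] covers one-sided limits such
    as h -> 0+. *)
Lemma cvg_dominated_within (T : pseudoMetricType R) (D : set T) (p : T)
    (B : set R) (f : T -> R -> R) (l G : R -> R) :
  measurable B ->
  lebesgue_measure.-integrable B (EFin \o G) ->
  (\forall x \near within D (nbhs p), measurable_fun B (f x)) ->
  (\forall x \near within D (nbhs p), forall y, B y -> `|f x y| <= G y) ->
  (forall y, B y -> f x y @[x --> within D (nbhs p)] --> l y) ->
  \int[lebesgue_measure]_(y in B) f x y @[x --> within D (nbhs p)] -->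
  \int[lebesgue_measure]_(y in B) l y.
Proof.
move=> mB iG mf fG fl.
apply: cvg_within_seq => u uD up.
have uW : u n @[n --> \oo] --> within D (nbhs p).
  move=> A /= /up /=; rewrite /fmap /nbhs /=.
  by apply: filterS => n /(_ (uD n)).
have [N _ HN] : \forall n \near \oo, measurable_fun B (f (u n)) /\
    forall y, B y -> `|f (u n) y| <= G y.
  exact: (uW _ (filterI mf fG)).
(* Measurability and domination are known only near [p], hence only from rank [N] on; the sequence
   is shifted so that they hold for all indices. *)
rewrite -(cvg_shiftn N) /=.
have intf n : lebesgue_measure.-integrable B (EFin \o f (u (n + N)%N)).
  have [m1 m2] := HN (n + N)%N (leq_addl _ _).
  apply: le_integrable iG => //; first exact/measurable_EFinP.
  move=> y By /=; rewrite lee_fin (le_trans (m2 y By))//.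
  exact: ler_norm.
have lG y : B y -> `|l y| <= G y.
  move=> By.
  have C : `|f (u n) y| @[n --> \oo] --> `|l y|.
    by apply: cvg_norm; apply: cvg_comp uW (fl y By).
  apply: (cvgr_to_le C).
  by exists N => // n /= Nn; have [_ ->] := HN n Nn.
have ml : measurable_fun B (fun y => (l y)%:E).
  apply: (@emeasurable_fun_cvg _ _ _ _ (fun n y => (f (u (n + N)%N) y)%:E)).
  - by move=> n; have /integrableP[] := intf n.
  - move=> y By; apply/fine_cvgP; split; first exact: nearW.
    rewrite /comp /= (cvg_shiftn N (fun n => f (u n) y)).
    by apply: cvg_comp uW (fl y By).
have intl : lebesgue_measure.-integrable B (EFin \o l).
  apply: le_integrable iG => //.
  move=> y By /=; rewrite lee_fin (le_trans (lG y By))//.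
  exact: ler_norm.
apply: fine_cvg.
rewrite /Rintegral fineK; last first.
  by apply: integrable_fin_num.
apply: (@dominated_cvg _ _ _ lebesgue_measure _ mB
    (fun n y => (f (u (n + N)%N) y)%:E) _ (EFin \o G)) => //=.
- by move=> n; have /integrableP[] := intf n.
- move=> y By; apply: cvg_EFin; first exact: nearW.
  rewrite (cvg_shiftn N (fun n => f (u n) y)).
  by apply: cvg_comp uW (fl y By).
- by move=> n y By; rewrite lee_fin; have [_ ->] := HN (n + N)%N (leq_addl _ _).
Qed.

Lemma cvg_dominated (T : pseudoMetricType R) (p : T)
    (B : set R) (f : T -> R -> R) (l G : R -> R) :
  measurable B ->
  lebesgue_measure.-integrable B (EFin \o G) ->
  (\forall x \near p, measurable_fun B (f x)) ->
  (\forall x \near p, forall y, B y -> `|f x y| <= G y) ->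
  (forall y, B y -> f x y @[x --> p] --> l y) ->
  \int[lebesgue_measure]_(y in B) f x y @[x --> p] -->
  \int[lebesgue_measure]_(y in B) l y.
Proof.
move=> mB iG mf fG fl.
have E : nbhs p = within setT (nbhs p).
  apply/seteqP; split => A; rewrite /within /=; apply: filterS => x; last exact.
  by [].
by rewrite E; apply: (@cvg_dominated_within _ _ _ _ _ _ G) => //; rewrite -?E// => y By; rewrite -E; exact: fl.
Qed.

Lemma is_derive_near (f : R -> R) (x l : R) :
  (forall e, 0 < e -> \forall h \near (0:R)^', `|(f (h + x) - f x) / h - l| <= e) ->
  is_derive x 1 f l.
Proof.
move=> H.
have C : h^-1 *: (f (h *: 1 + x) - f x) @[h --> (0:R)^'] --> l.
  apply/cvgrPdist_le => e /H; apply: filterS => h.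
  by rewrite distrC /= scaler1 [_ *: _]mulrC.
apply: DeriveDef; first by apply/cvg_ex; exists l.
exact/cvg_lim.
Qed.

(** Take the supremum [s] of the points where f is at least f a. By continuity [s] is such a point,
    and if s < b the positive right derivative there produces another one to its right. *)
Lemma nondecreasing_right_cvg (f psi : R -> R) (a b : R) : a <= b ->
  (forall t, a <= t <= b -> {for t, continuous f}) ->
  (forall t, a <= t < b ->
     (f (t + h) - f t) / h @[h --> 0^'+] --> psi t) ->
  (forall t, a <= t < b -> 0 < psi t) ->
  f a <= f b.
Proof.
move=> ab fc fr p0.
pose S := [set t | a <= t <= b /\ f a <= f t].
have Sa : S a by rewrite /S /= lexx ab.
have hS : has_sup S by split; [exists a | exists b => x [/andP[]]].
set s := sup S.
have as_ : a <= s by apply: sup_upper_bound.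
have sb : s <= b by apply: sup_le_ub; [exists a| move=> x [/andP[]]].
have asb : a <= s <= b by rewrite as_ sb.
have fs : f a <= f s.
  rewrite leNgt; apply/negP => fsa.
  have /cvgrPdist_lt/(_ (f a - f s)) := fc s asb.
  rewrite subr_gt0 => /(_ fsa) /nbhs_ballP[d /= d0 Hd].
  have [x Sx sx] := sup_adherent d0 hS.
  have xs : x <= s by apply: sup_upper_bound.
  have : `|f s - f x| < f a - f s.
    apply: Hd; rewrite /ball /= ger0_norm ?subr_ge0//.
    by rewrite ltrBlDr -ltrBlDl addrC //; move: sx; rewrite -/s; lra.
  case: Sx => _ fx; rewrite ler0_norm; lra.
have [<-//|sb'] := eqVneq s b.
have {}sb' : s < b by rewrite lt_neqAle sb' sb.
have asb' : a <= s < b by rewrite as_ sb'.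
have /cvgrPdist_lt/(_ (psi s) (p0 _ asb')) := fr s asb'.
rewrite /prop_near1 /= => /nbhs_ballP[d /= d0 Hd].
pose h := Num.min (d / 2) (b - s).
have h0 : 0 < h by rewrite lt_min divr_gt0//= subr_gt0.
have hd : h < d by rewrite (@le_lt_trans _ _ (d / 2)) ?ge_min ?lexx//; lra.
have hb : s + h <= b by rewrite -lerBrDl ge_min lexx orbT.
have : `|psi s - (f (s + h) - f s) / h| < psi s.
  by apply: (Hd h) => //; rewrite /ball /= sub0r normrN gtr0_norm.
rewrite ltr_norml => /andP[_ Hq].
have {}Hq : 0 < (f (s + h) - f s) / h by lra.
rewrite pmulr_lgt0 ?invr_gt0// in Hq.
have : s + h <= s.
  apply: sup_upper_bound => //; split; last lra.
  by rewrite hb andbT; lra.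
lra.
Qed.

(** Needed for the Duhamel integral, whose difference quotients are controlled from the right only.
    A continuous right derivative of a continuous function is a genuine derivative, because
    one-sided information already yields a mean value inequality. *)
Lemma is_derive_right_cvg (f psi : R -> R) (t0 : R) (d : R) :
  0 < d ->
  (forall t, `|t - t0| < d -> {for t, continuous f}) ->
  (forall t, `|t - t0| < d ->
     (f (t + h) - f t) / h @[h --> 0^'+] --> psi t) ->
  {for t0, continuous psi} ->
  is_derive t0 1 f (psi t0).
Proof.
move=> d0 fc fr pc.
apply: is_derive_near => e e0.
have /cvgrPdist_lt/(_ e e0) /nbhs_ballP[d1 /= d10 Hd1] := pc.
pose r := Num.min d d1.
have r0 : 0 < r by rewrite lt_min d0 d10.
have rd : r <= d by rewrite ge_min lexx.
have rd1 : r <= d1 by rewrite ge_min lexx orbT.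
(* For k = e this bounds the increment of f above by (psi t0 + e)(b - a), for k = -e below by (psi
   t0 - e)(b - a). Both follow from monotonicity of t |-> -k (f t - (psi t0 + k) t), whose right
   derivative k^2 - k (psi t - psi t0) is positive near t0. *)
have key k a b : a <= b -> (forall t, a <= t <= b -> `|t - t0| < r) ->
  k = e \/ k = - e ->
  k * (f b - f a - (psi t0 + k) * (b - a)) <= 0.
  move=> ab Hr Hk.
  suff : - k * (f a - (psi t0 + k) * a) <= - k * (f b - (psi t0 + k) * b) by lra.
  apply: (@nondecreasing_right_cvg (fun t => - k * (f t - (psi t0 + k) * t))
           (fun t => - k * (psi t - (psi t0 + k)))) => //.
  - move=> t /Hr tr.
    apply: cvgM; first exact: cvg_cst.
    apply: cvgB; first by apply: fc; apply: lt_le_trans rd.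
    by apply: cvgM; [exact: cvg_cst|exact: cvg_id].
  - move=> t /andP[t1 t2].
    have tr : `|t - t0| < r by apply: Hr; rewrite t1 ltW.
    have := fr t (lt_le_trans tr rd) => C.
    have : - k * ((f (t + h) - f t) / h - (psi t0 + k)) @[h --> 0^'+] -->
       - k * (psi t - (psi t0 + k)).
      by apply: cvgM; [exact: cvg_cst | apply: cvgB C _; exact: cvg_cst].
    apply: cvg_trans; apply: near_eq_cvg.
    near=> h.
    have h0 : h != 0 by apply: lt0r_neq0; near: h; exact: nbhs_right_gt.
    by field.
  - move=> t /andP[t1 t2].
    have tr : `|t - t0| < r by apply: Hr; rewrite t1 ltW.
    have : `|psi t0 - psi t| < e.
      by apply: Hd1; rewrite /ball /= distrC; apply: lt_le_trans rd1.
    rewrite ltr_norml => /andP[p1 p2].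
    by case: Hk => ->; nra.
exists r => //= h; rewrite /ball /= sub0r normrN => hr h0.
have aux y : - e <= y <= e -> `|y| <= e by rewrite ler_norml.
apply: aux.
have [hp|hn|hz] := ltgtP 0 h; last by rewrite -hz eqxx in h0.
- have Hr t : t0 <= t <= h + t0 -> `|t - t0| < r.
    move=> /andP[t1 t2]; rewrite ger0_norm ?subr_ge0//.
    by rewrite gtr0_norm in hr => //; lra.
  have t0h : t0 <= h + t0 by lra.
  have k1 := key e t0 (h + t0) t0h Hr (or_introl erefl).
  have k2 := key (- e) t0 (h + t0) t0h Hr (or_intror erefl).
  have E : (f (h + t0) - f t0) / h * h = f (h + t0) - f t0 by field; rewrite gt_eqF.
  apply/andP; split.
    rewrite -(ler_pM2r hp) mulrBl E; nra.
  rewrite -(ler_pM2r hp) mulrBl E; nra.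
- have Hr t : h + t0 <= t <= t0 -> `|t - t0| < r.
    move=> /andP[t1 t2]; rewrite ler0_norm ?subr_le0//.
    by rewrite ltr0_norm in hr => //; lra.
  have t0h : h + t0 <= t0 by lra.
  have k1 := key e (h + t0) t0 t0h Hr (or_introl erefl).
  have k2 := key (- e) (h + t0) t0 t0h Hr (or_intror erefl).
  have E : (f (h + t0) - f t0) / h * h = f (h + t0) - f t0 by field; rewrite lt_eqF.
  apply/andP; split.
    rewrite -(ler_nM2r hn) mulrBl E; nra.
  rewrite -(ler_nM2r hn) mulrBl E; nra.
Unshelve. all: end_near. Qed.

(** The second derivative is assumed at [x0] alone. Were it positive, the slope of [df] would make
    [df] positive just to the right of [x0], and the mean value theorem would lift f above its
    maximum. *)
Lemma second_derivative_local_max f df (x0 d ddf : R) : 0 < d ->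
  (forall x, `|x - x0| < d -> is_derive x 1 f (df x)) ->
  is_derive x0 1 df ddf ->
  (forall x, `|x - x0| < d -> f x <= f x0) ->
  df x0 = 0 /\ ddf <= 0.
Proof.
move=> d0 fd dfd fm.
have inb x : x \in `]x0 - d, x0 + d[%R -> `|x - x0| < d.
  by rewrite in_itv /= ltr_norml => /andP[]; lra.
have D0 : df x0 = 0.
  have [] : is_derive x0 1 f 0.
    apply: (@derive1_at_max _ f (x0 - d) (x0 + d)); first lra.
    - by move=> t /inb/fd[].
    - by rewrite in_itv /=; lra.
    - by move=> t /inb/fm.
  move=> _ <-.
  by have [_ <-] : is_derive x0 1 f (df x0) by apply: fd; rewrite subrr normr0.
split => //.
rewrite leNgt; apply/negP => dd0.
have /is_derive1_caratheodory [g [g1 g2 g3]] := dfd.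
have /cvgrPdist_lt/(_ ddf dd0) /nbhs_ballP[d1 /= d10 Hd1] := g2.
rewrite g3 in Hd1.
pose r := Num.min d d1 / 2.
have m0 : 0 < Num.min d d1 by rewrite lt_min d0 d10.
have r0 : 0 < r by rewrite divr_gt0.
have rd : r < d by apply: (@lt_le_trans _ _ (Num.min d d1)); [rewrite /r; lra|rewrite ge_min lexx].
have rd1 : r < d1 by apply: (@lt_le_trans _ _ (Num.min d d1)); [rewrite /r; lra|rewrite ge_min lexx orbT].
have [y] : exists2 y, y \in `]x0, x0 + r[%R & f (x0 + r) - f x0 = df y * (x0 + r - x0).
  apply: MVT; first lra.
  - by move=> x; rewrite in_itv /= => /andP[x1 x2]; apply: fd; rewrite ger0_norm; lra.
  - apply: derivable_within_continuous => x; rewrite in_itv /= => /andP[x1 x2].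
    by have [] : is_derive x 1 f (df x) by apply: fd; rewrite ger0_norm; lra.
rewrite in_itv /= => /andP[y1 y2] E.
have fr : f (x0 + r) <= f x0 by apply: fm; rewrite addrC addKr ger0_norm; lra.
have : 0 < df y.
  have := g1 y; rewrite D0 subr0 => ->.
  apply: mulr_gt0; last lra.
  have : `|ddf - g y| < ddf by apply: Hd1; rewrite /ball /= ler0_norm; lra.
  by rewrite ltr_norml => /andP[]; lra.
nra.
Qed.

End calculus.

(** * Gaussian averaging operators *)

Section gaussian.
Context {R : realType}.
Notation mu := (@lebesgue_measure R).

Lemma continuous_antiderivative (f : R -> R) : continuous f ->
  exists F : R -> R, forall x : R, is_derive x 1 F (f x).
Proof.
move=> cf.
have intf a b : mu.-integrable `[a, b] (EFin \o f).
  by apply: continuous_compact_integrable; [exact: segment_compact|apply: continuous_subspaceT].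
pose G a x := \int[mu]_(t in `[a, x]) f t.
(* The base point must lie to the left of both x and 0, so it moves with x; subtracting [G (n_ x) 0]
   makes the result independent of this choice. *)
pose n_ x : R := Num.min x 0 - 1.
have nx x : n_ x < x /\ n_ x < 0.
  by rewrite /n_; case: (lerP x 0) => h; lra.
pose F x := G (n_ x) x - G (n_ x) 0.
have GB a b c : a <= b -> b <= c -> G a c = G a b + G b c.
  move=> ab bc; rewrite /G.
  have := @Rintegral_itvB _ f (BLeft a) (BRight c) b (intf a c).
  rewrite !bnd_simp => /(_ ab bc).
  rewrite Rintegral_itv_obnd_cbnd; last by apply: integrableS (intf b c) => //; apply: subset_itvr; rewrite bnd_simp.
  by move=> /eqP; rewrite subr_eq addrC => /eqP.
have FE a x : a < x -> a < 0 -> F x = G a x - G a 0.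
  move=> ax a0; have [n1 n2] := nx x.
  rewrite /F; have [na|an] := lerP (n_ x) a.
    rewrite (GB (n_ x) a x)// ?ltW// (GB (n_ x) a 0)// ?ltW//; lra.
  rewrite (GB a (n_ x) x)// ?ltW// (GB a (n_ x) 0)// ?ltW//; lra.
exists F => x.
pose a := n_ x; have [ax a0] := nx x.
have [] := @continuous_FTC1 R f (BLeft a) x (x + 1) _ (intf a (x + 1)).
- by rewrite ltrDl.
- by rewrite lte_fin; exact: ax.
- exact: cf.
move=> D1 D2.
have E : \forall y \near x, G a y - G a 0 = F y.
  near=> y; rewrite (FE a)//; near: y; exact: lt_nbhsr.
apply: (near_eq_is_derive E).
rewrite -[f x]subr0; apply: is_deriveB.
by apply: DeriveDef D1 _; rewrite -derive1E.
Unshelve. all: end_near. Qed.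

Definition gw (z : R) : R := expR (- (z ^+ 2 / 2)).
(** Hermite functions: [gh1] is minus the first derivative of the normalised Gaussian [gh0], and
    [gh2] is its second derivative. *)
Definition gh0 (z : R) : R := expR (- z ^+ 2) / Num.sqrt pi.
Definition gh1 (z : R) : R := 2 * z * gh0 z.
Definition gh2 (z : R) : R := (4 * z ^+ 2 - 2) * gh0 z.

(* gw decays more slowly than gh0, which leaves room for the polynomial factors
   gained by differentiating under the integral. *)
Definition gker (h : R -> R) : Prop :=
  continuous h /\ exists C : R, forall z, `|h z| * (1 + `|z|) <= C * gw z.

(* With h = gh0 and a = 2 sqrt t this is the heat semigroup at time t; gh1 and
   gh2 yield its first and second space derivatives. *)
Definition gop (h f : R -> R) (x a : R) : R :=
  \int[mu]_z (h z * f (x + a * z)).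

Lemma gw_ge0 z : 0 <= gw z. Proof. exact: expR_ge0. Qed.

Lemma integrable_gw : mu.-integrable setT (EFin \o gw).
Proof.
have := @integrable_normal_pdf R 0 1.
move=> /(@integrableZl _ _ _ _ _ measurableT (normal_peak 1)^-1).
apply: eq_integrable => // x _ /=.
have p0 : normal_peak (1 : R) != 0 by rewrite gt_eqF// normal_peak_gt0// oner_neq0.
rewrite -EFinM normal_pdfE ?oner_neq0// mulrA mulVf// mul1r.
by rewrite /normal_fun /gw subr0 expr1n; congr (expR _)%:E; field.
Qed.

Lemma integrable_gdom (f : R -> R) C : continuous f ->
  (forall z, `|f z| <= C * gw z) -> mu.-integrable setT (EFin \o f).
Proof.
move=> cf fC.
have iC : mu.-integrable setT (EFin \o (fun z => C * gw z)).
  exact: integrableZl integrable_gw.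
apply: le_integrable iC => //.
  apply/measurable_EFinP; exact: continuous_measurable_fun.
by move=> z _ /=; rewrite lee_fin (le_trans (fC z))// ler_norm.
Qed.

Definition gmass : R := \int[mu]_z gw z.

Lemma gmass_ge0 : 0 <= gmass.
Proof. by apply: Rintegral_ge0 => z _; exact: gw_ge0. Qed.

Lemma Rintegral_gdom_le (f : R -> R) C : continuous f ->
  (forall z, `|f z| <= C * gw z) -> `|\int[mu]_z f z| <= C * gmass.
Proof.
move=> cf fC.
have iff := integrable_gdom cf fC.
apply: (le_trans (le_normr_Rintegral _ iff)) => //.
rewrite /gmass -RintegralZl//; last exact: integrable_gw.
apply: le_Rintegral => //.
  exact: integrable_norm.
exact: integrableZl integrable_gw.
Qed.

Lemma sqrtpi_gt0 : 0 < Num.sqrt (pi : R).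
Proof. by rewrite sqrtr_gt0 pi_gt0. Qed.

Lemma continuous_gh0 : continuous gh0.
Proof. by move=> x; apply: cvgMl; exact: continuous_gauss_fun. Qed.

(** Of the gap between e^(-z^2) and e^(-z^2/2), one factor e^(z^2/4) pays for the polynomial and
    another for 1 + |z|, which is at most 2 (1 + z^2/4); this is the origin of the constant 2 C. *)
Lemma gpoly_bound (P : R -> R) C : 0 <= C ->
  (forall z, `|P z| <= C * (1 + z ^+ 2 / 4)) ->
  forall z, `|P z * gh0 z| * (1 + `|z|) <= (2 * C / Num.sqrt pi) * gw z.
Proof.
move=> C0 PC z.
have s0 := sqrtpi_gt0.
have q1 : 1 + z ^+ 2 / 4 <= expR (z ^+ 2 / 4) by apply: expR_ge1Dx.
have q0 : 0 <= 1 + z ^+ 2 / 4 by rewrite addr_ge0// divr_ge0// sqr_ge0.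
have q2 : 1 + `|z| <= 2 * (1 + z ^+ 2 / 4).
  rewrite -(real_normK (num_real z)); have := sqr_ge0 (`|z| - 1); nra.
have e2 : gw z = expR (- z ^+ 2) * expR (z ^+ 2 / 4) * expR (z ^+ 2 / 4).
  by rewrite -!expRD; congr expR; field.
rewrite normrM /gh0 normrM (ger0_norm (expR_ge0 _)) (ger0_norm (_ : 0 <= (Num.sqrt pi)^-1)) ?invr_ge0 ?(ltW s0)//.
rewrite e2.
set E := expR (- z ^+ 2); set X := expR (z ^+ 2 / 4) in q1 *.
have E0 : 0 < E by apply: expR_gt0.
have := PC z; set p := `|P z| => pC.
have p0 : 0 <= p by exact: normr_ge0.
have w : p * (1 + `|z|) <= 2 * C * X * X.
  apply: (@le_trans _ _ ((C * X) * (2 * X))); last by lra.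
  apply: ler_pM => //; last by apply: (le_trans q2); apply: ler_wpM2l.
  by apply: (le_trans pC); apply: ler_wpM2l.
set i := (Num.sqrt pi)^-1.
have i0 : 0 < i by rewrite invr_gt0.
have -> : p * (E * i) * (1 + `|z|) = (E * i) * (p * (1 + `|z|)) by ring.
have -> : 2 * C * i * (E * X * X) = (E * i) * (2 * C * X * X) by ring.
by apply: ler_wpM2l => //; rewrite mulr_ge0// ltW.
Qed.

Lemma gker0 : gker gh0.
Proof.
split; first exact: continuous_gh0.
exists (2 * 1 / Num.sqrt pi) => z.
have := @gpoly_bound (fun _ => 1) 1 ler01 _ z; rewrite mul1r; apply => y.
by rewrite normr1 mul1r lerDl divr_ge0// sqr_ge0.
Qed.

Lemma gker1 : gker gh1.
Proof.
split.
  move=> x; apply: cvgM; last exact: continuous_gh0.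
  by apply: cvgMr; exact: cvg_id.
exists (2 * 2 / Num.sqrt pi) => z.
apply: (@gpoly_bound (fun z => 2 * z)) => // y.
rewrite normrM ger0_norm// -(real_normK (num_real y)).
by have := sqr_ge0 (`|y| - 2); nra.
Qed.

Lemma gker2 : gker gh2.
Proof.
split.
  move=> x; apply: cvgM; last exact: continuous_gh0.
  by apply: cvgB; [apply: cvgMr; exact: exprn_continuous|exact: cvg_cst].
exists (2 * 16 / Num.sqrt pi) => z.
apply: (@gpoly_bound (fun z => 4 * z ^+ 2 - 2)) => // y.
have y0 := sqr_ge0 y.
by rewrite ler_norml; apply/andP; split; lra.
Qed.

Lemma is_derive_gh0 (z : R) : is_derive z 1 gh0 (- gh1 z).
Proof.
rewrite /gh0 /gh1.
apply: is_derive_eq.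
rewrite /GRing.scale /= /gh0; ring.
Qed.

Lemma is_derive_gh1 (z : R) : is_derive z 1 gh1 (- gh2 z).
Proof.
have D := is_derive_gh0 z.
rewrite /gh1 /gh2.
apply: is_derive_eq.
rewrite /GRing.scale /= /gh1; ring.
Qed.

Lemma Rintegral_gh0 : \int[mu]_z gh0 z = 1.
Proof.
rewrite /gh0.
have -> : (fun z => expR (- z ^+ 2) / Num.sqrt pi) = (fun z : R => (Num.sqrt pi)^-1 * gauss_fun z).
  by apply/funext => z; rewrite mulrC.
rewrite RintegralZl//; last exact: integrableT_gauss.
rewrite /Rintegral integralT_gauss /= mulVf// gt_eqF//; exact: sqrtpi_gt0.
Qed.

End gaussian.

Section gaussian_operators.
Context {R : realType}.
Notation mu := (@lebesgue_measure R).

Lemma gker_bound (h : R -> R) : gker h ->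
  exists C, [/\ 0 <= C, forall z, `|h z| <= C * gw z &
                forall z, `|z * h z| <= C * gw z].
Proof.
move=> [_ [C HC]]; exists C.
have C0 : 0 <= C.
  have := HC 0; rewrite normr0 addr0 mulr1 /gw expr0n /= mul0r oppr0 expR0 mulr1.
  by apply: le_trans.
by split => // z; apply: le_trans (HC z); rewrite ?normrM; have := normr_ge0 z; have := normr_ge0 (h z); nra.
Qed.

Lemma continuous_gop_integrand (h f : R -> R) (x a : R) :
  continuous h -> continuous f -> continuous (fun z => h z * f (x + a * z)).
Proof.
move=> ch cf z; apply: cvgM; first exact: ch.
apply: continuous_comp; last exact: cf.
by apply: cvgD; [exact: cvg_cst|apply: cvgMr; exact: cvg_id].
Qed.

Lemma gop_integrand_le (h f : R -> R) (x a C B : R) :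
  (forall z, `|h z| <= C * gw z) -> (forall y, `|f y| <= B) ->
  forall z, `|h z * f (x + a * z)| <= C * B * gw z.
Proof.
move=> hC fB z; rewrite normrM mulrAC.
by apply: ler_pM.
Qed.

Lemma gop_integrable (h f : R -> R) (x a B : R) : gker h -> continuous f ->
  (forall y, `|f y| <= B) ->
  mu.-integrable setT (EFin \o (fun z => h z * f (x + a * z))).
Proof.
move=> kh cf fB; have [C [_ hC _]] := gker_bound kh; have [ch _] := kh.
apply: (integrable_gdom (C := C * B)); first exact: continuous_gop_integrand.
exact: gop_integrand_le.
Qed.

Lemma gop_bound (h : R -> R) : gker h ->
  exists2 C, 0 <= C & forall f x a B, continuous f -> (forall y, `|f y| <= B) ->
    `|gop h f x a| <= C * B.
Proof.
move=> kh; have [C [C0 hC _]] := gker_bound kh; have [ch _] := kh.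
exists (C * gmass (R := R)); first by rewrite mulr_ge0// gmass_ge0.
move=> f x a B cf fB; rewrite mulrAC.
apply: Rintegral_gdom_le; first exact: continuous_gop_integrand.
exact: gop_integrand_le.
Qed.

Lemma gop_cvg (T : pseudoMetricType R) (D : set T) (p : T) (h : R -> R)
    (f : T -> R -> R) (fp : R -> R) (x a : T -> R) (x0 a0 B : R) :
  gker h ->
  (\forall q \near within D (nbhs p), continuous (f q)) ->
  (\forall q \near within D (nbhs p), forall y, `|f q y| <= B) ->
  (forall z, f q (x q + a q * z) @[q --> within D (nbhs p)] --> fp (x0 + a0 * z)) ->
  gop h (f q) (x q) (a q) @[q --> within D (nbhs p)] --> gop h fp x0 a0.
Proof.
move=> kh cf fB fl; have [C [C0 hC _]] := gker_bound kh; have [ch _] := kh.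
apply: (@cvg_dominated_within _ _ _ _ _ _ _ (fun z => C * B * gw z)) => //.
- exact: integrableZl (@integrable_gw R).
- near=> q; apply: continuous_measurable_fun; apply: continuous_gop_integrand => //.
  by near: q.
- near=> q; move=> y _; apply: gop_integrand_le => //.
  by near: q.
- by move=> z _; apply: cvgM; [exact: cvg_cst|exact: fl].
Unshelve. all: end_near. Qed.

(** Differentiation under the integral. Moving the scale [a] brings down a factor z, which is why
    [gker] controls z h(z) as well. [F] may be unbounded, typically an antiderivative, so its
    integrability is a separate hypothesis. *)
Lemma is_derive_gop (h F f : R -> R) (x a dx da : R -> R) (t0 d B M : R) :
  gker h -> 0 < d ->
  (forall y : R, is_derive y 1 F (f y)) -> continuous f ->
  (forall y, `|f y| <= B) ->
  (forall t : R, `|t - t0| < d -> is_derive t 1 x (dx t) /\ is_derive t 1 a (da t)) ->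
  (forall t, `|t - t0| < d -> `|dx t| <= M /\ `|da t| <= M) ->
  (forall t, `|t - t0| < d ->
     mu.-integrable setT (EFin \o (fun z => h z * F (x t + a t * z)))) ->
  is_derive t0 1 (fun t => gop h F (x t) (a t))
    (dx t0 * gop h f (x t0) (a t0) + da t0 * gop (fun z => z * h z) f (x t0) (a t0)).
Proof.
move=> kh d0 Ff cf fB xad xaM iF.
have [C [C0 hC zhC]] := gker_bound kh; have [ch _] := kh.
pose k t z := h z * F (x t + a t * z).
pose dk t z := h z * (f (x t + a t * z) * (dx t + da t * z)).
have kd t z : `|t - t0| < d -> is_derive t 1 (k ^~ z) (dk t z).
  move=> /xad [Dx Da].
  have D1 : is_derive t 1 (fun t => x t + a t * z) (dx t + da t * z).
    by apply: is_derive_eq; rewrite /GRing.scale /= mulr0 add0r [z * _]mulrC.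
  have D2 : is_derive t 1 (fun t => F (x t + a t * z)) (f (x t + a t * z) * (dx t + da t * z)).
    exact: (@is_derive1_comp R F (fun t => x t + a t * z)).
  by rewrite /k /dk; apply: is_derive_eq; rewrite /GRing.scale /=; ring.
have inI t : `]t0 - d, t0 + d[ t -> `|t - t0| < d.
  by rewrite /= in_itv /= ltr_norml => /andP[]; lra.
have t0I : `]t0 - d, t0 + d[ t0 by rewrite /= in_itv /=; lra.
have dkE t z : `]t0 - d, t0 + d[ t -> partial1of2 k t z = dk t z.
  by move=> /inI/kd Dk; rewrite partial1of2E; have [_ <-] := Dk z.
pose G z := 2 * C * B * M * gw z.
have B0 : 0 <= B by apply: le_trans (fB 0).
have M0 : 0 <= M.
  by have [|+ _] := xaM t0; [rewrite subrr normr0|apply: le_trans].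
have iG : mu.-integrable setT (EFin \o G) by exact: integrableZl (@integrable_gw R).
have G0 z : 0 <= G z by rewrite /G !mulr_ge0// gw_ge0.
have dkG t z : `]t0 - d, t0 + d[ t -> setT z -> `|partial1of2 k t z| <= G z.
  move=> It _; rewrite dkE// /dk /G.
  have [M1 M2] := xaM t (inI _ It).
  have -> : h z * (f (x t + a t * z) * (dx t + da t * z)) =
     f (x t + a t * z) * (dx t * h z + da t * (z * h z)) by ring.
  rewrite normrM.
  have -> : 2 * C * B * M * gw z = B * (M * (C * gw z) + M * (C * gw z)) by ring.
  apply: ler_pM => //.
  by apply: (le_trans (ler_normD _ _)); apply: lerD; rewrite normrM; apply: ler_pM.
have kderiv t z : `]t0 - d, t0 + d[ t -> setT z -> derivable (k ^~ z) t 1.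
  by move=> /inI/kd Dk _; have [] := Dk z.
have ik t : `]t0 - d, t0 + d[ t -> mu.-integrable setT (EFin \o k t).
  by move=> /inI; exact: iF.
have D1 := derivable_under_integral measurableT t0I ik kderiv G0 iG dkG.
have D2 := differentiation_under_integral measurableT t0I ik kderiv G0 iG dkG.
apply: DeriveDef; first exact: D1.
rewrite -derive1E [LHS]D2.
transitivity (\int[mu]_z (dx t0 * (h z * f (x t0 + a t0 * z)) + da t0 * (z * h z * f (x t0 + a t0 * z)))).
  by apply: eq_Rintegral => z _; rewrite dkE// /dk; ring.
have czh : continuous (fun z : R => z * h z).
  by move=> z; apply: cvgM; [exact: cvg_id|exact: ch].
have i1 := gop_integrable (x t0) (a t0) kh cf fB.
have i2 : mu.-integrable setT (EFin \o (fun z => z * h z * f (x t0 + a t0 * z))).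
  apply: (integrable_gdom (C := C * B)); first exact: continuous_gop_integrand.
  exact: (gop_integrand_le (h := fun z => z * h z)).
rewrite RintegralD//; [|exact: integrableZl i1|exact: integrableZl i2].
by rewrite !RintegralZl.
Qed.

(** Over [-n-1, n+1] the integral is a difference of two boundary values, which the Gaussian bound
    on [Q] sends to 0; the bound on [q] allows passing to the whole line. This is integration by
    parts without boundary terms. *)
Lemma Rintegral_derive_eq0 (Q q : R -> R) (C : R) :
  (forall z : R, is_derive z 1 Q (q z)) -> continuous q ->
  (forall z, `|q z| <= C * gw z) -> (forall z, `|Q z| <= C * gw z) ->
  \int[mu]_z q z = 0.
Proof.
move=> Qq cq qC QC.
have iq := integrable_gdom cq qC.
have gwl : gw n%:R @[n --> \oo] --> (0 : R).
  have U : 2 * (n.+1%:R)^-1 @[n --> \oo] --> (0 : R).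
    by rewrite -[X in _ --> X](mulr0 2); apply: cvgMr; exact: cvg_harmonic.
  apply: (squeeze_cvgr _ (cvg_cst 0) U).
  near=> n; rewrite gw_ge0 /=.
  have n1 : (1 : R) <= n%:R by rewrite (_ : 1 = 1%:R)// ler_nat; near: n; exact: nbhs_infty_ge.
  have e1 : 1 + (n%:R ^+ 2 / 2 : R) <= expR (n%:R ^+ 2 / 2) by exact: expR_ge1Dx.
  rewrite /gw expRN; set E := expR _ in e1 *.
  have -> : n.+1%:R = n%:R + 1 :> R by rewrite natr1.
  set N := n%:R in n1 e1 *.
  rewrite ler_pdivlMr; last by lra.
  by rewrite mulrC ler_pdivrMr ?expR_gt0//; nra.
have bnd : (fun n : nat => Q n%:R - Q (- n%:R)) n @[n --> \oo] --> (0 : R).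
  have : (fun n : nat => C * gw n%:R + C * gw n%:R) n @[n --> \oo] --> (0 : R).
    by rewrite -[X in _ --> X](addr0 0) -[X in _ --> X + X](mulr0 C); apply: cvgD; apply: cvgMr.
  move=> U; apply: norm_cvg0; apply: squeeze_cvgr U; last exact: cvg_cst.
  apply: nearW => n; rewrite normr_ge0 /=.
  apply: (le_trans (ler_normB _ _)); apply: lerD; apply: (le_trans (QC _)) => //.
  by rewrite /gw sqrrN.
have int n : \int[mu]_(z in `[- n.+1%:R, n.+1%:R]) q z = Q n.+1%:R - Q (- n.+1%:R).
  rewrite /Rintegral (@continuous_FTC2 _ q Q)//.
  - by rewrite -subr_gt0 opprK addr_gt0.
  - exact: continuous_subspaceT.
  - have cQ : continuous Q.
      by move=> x; apply: differentiable_continuous; apply/derivable1_diffP; have [] := Qq x.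
    split; first by move=> x _; have [] := Qq x.
      by apply: cvg_at_right_filter; exact: cQ.
    by apply: cvg_at_left_filter; exact: cQ.
  - by move=> x _; rewrite derive1E; have [_ ->] := Qq x.
have lim : \int[mu]_(z in `[- n.+1%:R, n.+1%:R]) q z @[n --> \oo] --> \int[mu]_z q z.
  apply: fine_cvg.
  rewrite /Rintegral fineK; last exact: integrable_fin_num.
  under eq_fun do rewrite integral_mkcond.
  apply: (@dominated_cvg _ _ _ mu _ measurableT
     (fun n : nat => (EFin \o q) \_ `[- n.+1%:R, n.+1%:R]) _ (EFin \o (fun z => C * gw z))) => //=.
  - move=> n; apply/(measurable_restrictT _ _).1 => //.
    by apply: measurable_funTS; apply/measurable_EFinP; exact: continuous_measurable_fun.
  - move=> z _; apply: cvg_near_cst.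
    near=> n; rewrite patchE ifT// inE /= in_itv /= -ler_norml.
    near: n; exists (Num.truncn `|z|) => // n /= zn.
    apply: (le_trans (ltW (truncnS_gt _))); rewrite ler_nat ltnS; exact: zn.
  - exact: integrableZl (@integrable_gw R).
  - move=> n z _; rewrite patchE; case: ifPn => _ /=; first by rewrite lee_fin.
    by rewrite normr0 lee_fin; exact: le_trans (qC z).
have lim0 : \int[mu]_(z in `[- n.+1%:R, n.+1%:R]) q z @[n --> \oo] --> (0 : R).
  under eq_fun do rewrite int.
  by move: bnd; rewrite -(cvg_shiftS (fun n : nat => Q n%:R - Q (- n%:R))).
exact: (cvg_unique _ lim lim0).
Unshelve. all: end_near. Qed.

End gaussian_operators.

(** * Space and time derivatives of the Gaussian averages *)

Section gaussian_derivatives.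
Context {R : realType}.
Notation mu := (@lebesgue_measure R).

Lemma is_derive_continuous (F f : R -> R) :
  (forall y : R, is_derive y 1 F (f y)) -> continuous F.
Proof.
by move=> Ff x; apply: differentiable_continuous; apply/derivable1_diffP; have [] := Ff x.
Qed.

Lemma is_derive_lipschitz (F f : R -> R) B :
  (forall y : R, is_derive y 1 F (f y)) -> (forall y, `|f y| <= B) ->
  forall x y, `|F y - F x| <= B * `|y - x|.
Proof.
move=> Ff fB x y; have cF := is_derive_continuous Ff.
have [xy|xy|->] := ltgtP x y; last by rewrite !subrr normr0 mulr0.
- have [z _ ->] : exists2 z, z \in `]x, y[%R & F y - F x = f z * (y - x).
    by apply: MVT => //; exact: continuous_subspaceT.
  by rewrite normrM ler_wpM2r.
- have [z _] : exists2 z, z \in `]y, x[%R & F x - F y = f z * (x - y).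
    by apply: MVT => //; exact: continuous_subspaceT.
  by rewrite distrC => ->; rewrite normrM distrC ler_wpM2r.
Qed.

(** A Lipschitz function grows at most linearly, and the factor 1 + |z| built into [gker] absorbs
    exactly that. *)
Lemma gop_growth (h F : R -> R) (B x a : R) : gker h ->
  (forall y, `|F y - F x| <= B * `|y - x|) ->
  exists C, forall z, `|h z * F (x + a * z)| <= C * gw z.
Proof.
move=> [ch [C HC]] FB.
exists ((`|F x| + `|B| * `|a|) * C) => z.
have B1 : `|F (x + a * z)| <= `|F x| + `|B| * `|a| * `|z|.
  have -> : F (x + a * z) = F x + (F (x + a * z) - F x) by ring.
  apply: (le_trans (ler_normD _ _)); rewrite lerD2l.
  apply: (le_trans (FB _)).
  by rewrite addrAC subrr add0r normrM mulrA !ler_wpM2r// ler_norm.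
rewrite normrM -mulrA; apply: le_trans (ler_wpM2l _ (HC z)); last first.
  by rewrite addr_ge0// mulr_ge0.
have h0 := normr_ge0 (h z); have z0 := normr_ge0 z; have F0 := normr_ge0 (F x).
have b0 : 0 <= `|B| * `|a| by rewrite mulr_ge0.
apply: (le_trans (ler_wpM2l h0 B1)).
have := mulr_ge0 h0 (addr_ge0 (mulr_ge0 F0 z0) b0); lra.
Qed.

Lemma gop_integrable_growth (h F : R -> R) (B x a : R) : gker h -> continuous F ->
  (forall x y, `|F y - F x| <= B * `|y - x|) ->
  mu.-integrable setT (EFin \o (fun z => h z * F (x + a * z))).
Proof.
move=> kh cF FB; have [C HC] := gop_growth a kh (FB x).
by apply: integrable_gdom HC; apply: continuous_gop_integrand => //; case: kh.
Qed.

(** Integrate by parts in z, where the chain rule yields the factor [a]. Read from right to left, it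
    replaces a merely continuous f by its antiderivative F at the price of a heavier kernel. *)
Lemma gop_ibp (h k F f : R -> R) (B x a : R) : gker h -> gker k ->
  (forall z : R, is_derive z 1 k (- h z)) ->
  (forall y : R, is_derive y 1 F (f y)) -> continuous f ->
  (forall y, `|f y| <= B) ->
  gop h F x a = a * gop k f x a.
Proof.
move=> kh kk kd Ff cf fB.
have cF := is_derive_continuous Ff.
have FB := is_derive_lipschitz Ff fB.
have [C1 HC1] := gop_growth a kh (FB x).
have [C2 HC2] := gop_growth a kk (FB x).
have [C3 [C30 HC3 _]] := gker_bound kk.
have i1 := gop_integrable_growth x a kh cF FB.
have i2 := gop_integrable x a kk cf fB.
have B0 : 0 <= B by apply: le_trans (fB 0).
pose Q z := k z * F (x + a * z).
pose q z := a * (k z * f (x + a * z)) - h z * F (x + a * z).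
have i3 : mu.-integrable setT (EFin \o (fun z => a * (k z * f (x + a * z)))).
  exact: integrableZl i2.
suff : \int[mu]_z q z = 0.
  rewrite /q RintegralB// RintegralZl// -/(gop h F x a) -/(gop k f x a).
  by move/eqP; rewrite subr_eq0 => /eqP ->.
have gw0 := @gw_ge0 R.
apply: (@Rintegral_derive_eq0 R Q q (`|a| * (C3 * B) + C1 + C2)).
- move=> z; have Dk := kd z.
  have Dx : is_derive z 1 (fun z : R => x + a * z) a.
    by apply: is_derive_eq; rewrite /GRing.scale /=; ring.
  have DF : is_derive z 1 (fun z => F (x + a * z)) (f (x + a * z) * a).
    exact: (@is_derive1_comp R F (fun z => x + a * z)).
  by rewrite /Q /q; apply: is_derive_eq; rewrite /GRing.scale /=; ring.
- move=> z; apply: cvgB; last by apply: continuous_gop_integrand => //; case: kh.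
  by apply: cvgMr; apply: continuous_gop_integrand => //; case: kk.
- move=> z; apply: (le_trans (ler_normB _ _)); rewrite normrM.
  have := HC1 z; have := gop_integrand_le x a HC3 fB z.
  have := HC2 z; have := normr_ge0 (k z * F (x + a * z)); have := normr_ge0 a.
  set p := `|a|; set p1 := `|_|; set p2 := `|_|; set p3 := `|_|; nra.
- move=> z; apply: (le_trans (HC2 z)).
  have := HC1 z; have := normr_ge0 (h z * F (x + a * z)); have := gw0 z.
  have : 0 <= `|a| * (C3 * B) by rewrite !mulr_ge0.
  set p := `|a| * _; set p1 := `|_|; nra.
Qed.

Lemma gop_ibp01 (F f : R -> R) (B x a : R) :
  (forall y : R, is_derive y 1 F (f y)) -> continuous f ->
  (forall y, `|f y| <= B) -> gop gh1 F x a = a * gop gh0 f x a.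
Proof.
move=> Ff cf fB.
exact: (gop_ibp x a (@gker1 R) (@gker0 R) (@is_derive_gh0 R) Ff cf fB).
Qed.

Lemma gop_ibp12 (F f : R -> R) (B x a : R) :
  (forall y : R, is_derive y 1 F (f y)) -> continuous f ->
  (forall y, `|f y| <= B) -> gop gh2 F x a = a * gop gh1 f x a.
Proof.
move=> Ff cf fB.
exact: (gop_ibp x a (@gker2 R) (@gker1 R) (@is_derive_gh1 R) Ff cf fB).
Qed.

Lemma is_derive_gop_x (h F f : R -> R) (B x a : R) : gker h ->
  (forall y : R, is_derive y 1 F (f y)) -> continuous f ->
  (forall y, `|f y| <= B) ->
  is_derive x 1 (fun x => gop h F x a) (gop h f x a).
Proof.
move=> kh Ff cf fB.
have -> : gop h f x a = 1 * gop h f x a + 0 * gop (fun z => z * h z) f x a by ring.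
apply: (@is_derive_gop _ h F f id (fun=> a) (fun=> 1) (fun=> 0) x 1 B 1) => //.
- by move=> t _; split; [exact: is_derive_id|exact: is_derive_cst].
- by move=> t _; rewrite normr1 normr0.
- move=> t _; apply: (@gop_integrable_growth _ _ B) => //.
    exact: is_derive_continuous Ff.
  exact: is_derive_lipschitz.
Qed.

(** As f need not be differentiable, the average is first rewritten as [gop gh1 F x a / a] with F an
    antiderivative of f; the derivative then falls on F. *)
Lemma is_derive_gop0_x (f : R -> R) (B x a : R) : a != 0 -> continuous f ->
  (forall y, `|f y| <= B) ->
  is_derive x 1 (fun x => gop gh0 f x a) (gop gh1 f x a / a).
Proof.
move=> a0 cf fB.
have [F Ff] := continuous_antiderivative cf.
have E : (fun x => gop gh0 f x a) = (fun x => a^-1 * gop gh1 F x a).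
  by apply/funext => y; rewrite (gop_ibp01 _ _ Ff cf fB) mulrA mulVf// mul1r.
have D := is_derive_gop_x x a (@gker1 R) Ff cf fB.
by rewrite E; apply: is_derive_eq; rewrite /GRing.scale /=; ring.
Qed.

Lemma is_derive_gop1_x (f : R -> R) (B x a : R) : a != 0 -> continuous f ->
  (forall y, `|f y| <= B) ->
  is_derive x 1 (fun x => gop gh1 f x a) (gop gh2 f x a / a).
Proof.
move=> a0 cf fB.
have [F Ff] := continuous_antiderivative cf.
have E : (fun x => gop gh1 f x a) = (fun x => a^-1 * gop gh2 F x a).
  by apply/funext => y; rewrite (gop_ibp12 _ _ Ff cf fB) mulrA mulVf// mul1r.
have D := is_derive_gop_x x a (@gker2 R) Ff cf fB.
by rewrite E; apply: is_derive_eq; rewrite /GRing.scale /=; ring.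
Qed.

Lemma is_derive_sqrt2 (t : R) : 0 < t ->
  is_derive t 1 (fun t => 2 * Num.sqrt t) (Num.sqrt t)^-1.
Proof.
move=> t0; have D := is_derive1_sqrt t0.
have s0 : Num.sqrt t != 0 by rewrite gt_eqF// sqrtr_gt0.
by apply: is_derive_eq; rewrite /GRing.scale /=; field.
Qed.

Lemma is_derive_gop_t (h F f : R -> R) (B c xi t0 : R) : gker h -> 0 < t0 ->
  (forall y : R, is_derive y 1 F (f y)) -> continuous f ->
  (forall y, `|f y| <= B) ->
  is_derive t0 1 (fun t => gop h F (xi - c * t) (2 * Num.sqrt t))
   (- c * gop h f (xi - c * t0) (2 * Num.sqrt t0) +
    (Num.sqrt t0)^-1 * gop (fun z => z * h z) f (xi - c * t0) (2 * Num.sqrt t0)).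
Proof.
move=> kh t00 Ff cf fB.
have tp t : `|t - t0| < t0 / 2 -> t0 / 2 < t.
  by rewrite ltr_norml => /andP[]; lra.
apply: (@is_derive_gop _ h F f (fun t => xi - c * t) (fun t => 2 * Num.sqrt t)
  (fun=> - c) (fun t => (Num.sqrt t)^-1) t0 (t0 / 2) B
  (`|c| + (Num.sqrt (t0 / 2))^-1)) => //.
- by rewrite divr_gt0.
- move=> t /tp tt; split.
    by apply: is_derive_eq; rewrite /GRing.scale /=; ring.
  by apply: is_derive_sqrt2; lra.
- move=> t /tp tt.
  have s0 : 0 < Num.sqrt (t0 / 2) by rewrite sqrtr_gt0 divr_gt0.
  have s1 : Num.sqrt (t0 / 2) <= Num.sqrt t by rewrite ler_wsqrtr// ltW.
  rewrite normrN lerDl invr_ge0 ltW//; split => //.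
  rewrite ger0_norm ?invr_ge0 ?sqrtr_ge0//.
  apply: (@le_trans _ _ ((Num.sqrt (t0 / 2))^-1)); last by rewrite lerDr.
  by rewrite lef_pV2 ?posrE// (lt_le_trans s0).
- move=> t _; apply: (@gop_integrable_growth _ _ B) => //.
    exact: is_derive_continuous Ff.
  exact: is_derive_lipschitz.
Qed.

Lemma gopZl (k : R) (h f : R -> R) (x a B : R) : gker h -> continuous f ->
  (forall y, `|f y| <= B) ->
  gop (fun z => k * h z) f x a = k * gop h f x a.
Proof.
move=> kh cf fB; rewrite /gop -RintegralZl//; last exact: gop_integrable cf fB.
by apply: eq_Rintegral => z _; rewrite mulrA.
Qed.

Lemma gop_zgh0 (f : R -> R) (x a B : R) : continuous f -> (forall y, `|f y| <= B) ->
  gop (fun z => z * gh0 z) f x a = gop gh1 f x a / 2.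
Proof.
move=> cf fB; rewrite mulrC -(gopZl _ _ _ (@gker1 R) cf fB).
by congr gop; apply/funext => z; rewrite /gh1; field.
Qed.

Lemma gop_zgh1 (f : R -> R) (x a B : R) : continuous f -> (forall y, `|f y| <= B) ->
  gop (fun z => z * gh1 z) f x a = gop gh2 f x a / 2 + gop gh0 f x a.
Proof.
move=> cf fB.
have -> : gop gh2 f x a / 2 = \int[mu]_z (2^-1 * (gh2 z * f (x + a * z))).
  by rewrite RintegralZl 1?mulrC//; exact: gop_integrable (@gker2 R) cf fB.
rewrite /gop -RintegralD//.
- by apply: eq_Rintegral => z _; rewrite /gh1 /gh2; field.
- by have i2 := gop_integrable x a (@gker2 R) cf fB; exact: integrableZl i2.
- exact: gop_integrable (@gker0 R) cf fB.
Qed.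

(** Again through an antiderivative F. The term [gop gh0 f] coming from z [gh1] cancels against the
    derivative of the prefactor 1 / (2 sqrt t), so that only the second and first space derivatives
    remain: the drifted heat equation. *)
Lemma is_derive_heat_t (f : R -> R) (B c xi t : R) : 0 < t -> continuous f ->
  (forall y, `|f y| <= B) ->
  is_derive t 1 (fun t => gop gh0 f (xi - c * t) (2 * Num.sqrt t))
   (gop gh2 f (xi - c * t) (2 * Num.sqrt t) / (4 * t) -
    c * (gop gh1 f (xi - c * t) (2 * Num.sqrt t) / (2 * Num.sqrt t))).
Proof.
move=> t0 cf fB.
have [F Ff] := continuous_antiderivative cf.
pose s t := (2 * Num.sqrt t : R)^-1.
have st : Num.sqrt t != 0 by rewrite gt_eqF// sqrtr_gt0.
apply: (@near_eq_is_derive _ _ _ (fun t => s t * gop gh1 F (xi - c * t) (2 * Num.sqrt t))).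
  near=> u.
  have u0 : 0 < u by near: u; exact: lt_nbhsr.
  rewrite (gop_ibp01 _ _ Ff cf fB) /s mulrA mulVf ?mul1r// mulf_neq0//.
  by rewrite gt_eqF// sqrtr_gt0.
have D := is_derive_gop_t c xi (@gker1 R) t0 Ff cf fB.
have Ds : is_derive t 1 s (- (2 * Num.sqrt t) ^- 2 * (Num.sqrt t)^-1).
  have D1 := is_derive_sqrt2 t0.
  by rewrite /s; apply: is_deriveV; rewrite ?mulf_neq0.
apply: is_derive_eq; rewrite /GRing.scale /=.
rewrite (gop_ibp01 _ _ Ff cf fB) (gop_zgh1 _ _ cf fB) /s.
have -> : 4 * t = 4 * Num.sqrt t ^+ 2 by rewrite sqr_sqrtr// ltW.
set X := xi - c * t; set r := Num.sqrt t in st *.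
by field.
Unshelve. all: end_near. Qed.

(** One derivative of the datum is traded for one power of t^(-1/2): the singularity is now
    integrable in time, unlike the 1 / (4 t) of the version for continuous data. The Duhamel
    integral is differentiated in time with this form. *)
Lemma is_derive_heat_t_smooth (F f : R -> R) (B c xi t : R) : 0 < t ->
  (forall y : R, is_derive y 1 F (f y)) -> continuous f ->
  (forall y, `|f y| <= B) ->
  is_derive t 1 (fun t => gop gh0 F (xi - c * t) (2 * Num.sqrt t))
   (gop gh1 f (xi - c * t) (2 * Num.sqrt t) / (2 * Num.sqrt t) -
    c * gop gh0 f (xi - c * t) (2 * Num.sqrt t)).
Proof.
move=> t0 Ff cf fB.
have st : Num.sqrt t != 0 by rewrite gt_eqF// sqrtr_gt0.
have := is_derive_gop_t c xi (@gker0 R) t0 Ff cf fB.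
rewrite (gop_zgh0 _ _ cf fB) => D; apply: (is_derive_eq D).
by field.
Qed.

(** Completing the square, L |a| |z| is at most L^2 a^2 / 2 + z^2 / 2, and the second summand is
    absorbed by half of the Gaussian. For a = 2 sqrt t the exponent becomes 2 L^2 t, the rate that
    reappears in all growth bounds below. *)
Lemma gop0_loglipschitz : exists2 K : R, 0 <= K &
  forall (f : R -> R) (A B L x a : R), continuous f -> (forall y, `|f y| <= A) ->
  (forall y, `|f y| <= B * expR (L * `|x - y|)) ->
  `|gop gh0 f x a| <= K * B * expR (L ^+ 2 * a ^+ 2 / 2).
Proof.
have s0 := @sqrtpi_gt0 R.
exists (gmass / Num.sqrt pi); first by rewrite divr_ge0 ?gmass_ge0// ltW.
move=> f A B L x a cf fA fB.
rewrite [leRHS](_ : _ = (B * expR (L ^+ 2 * a ^+ 2 / 2) / Num.sqrt pi) * gmass); last by ring.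
have B0 : 0 <= B.
  by have := le_trans (normr_ge0 _) (fB x); rewrite subrr normr0 mulr0 expR0 mulr1.
apply: Rintegral_gdom_le.
  by apply: continuous_gop_integrand => //; exact: continuous_gh0.
move=> z; rewrite normrM.
apply: (le_trans (ler_wpM2l _ (fB _))) => //.
have -> : x - (x + a * z) = - (a * z) by ring.
rewrite normrN (normrM a z) (ger0_norm (_ : 0 <= gh0 z)); last by rewrite divr_ge0 ?expR_ge0// ltW.
rewrite /gh0 /gw.
have -> : expR (- z ^+ 2) / Num.sqrt pi * (B * expR (L * (`|a| * `|z|))) =
   (B / Num.sqrt pi) * (expR (- z ^+ 2) * expR (L * (`|a| * `|z|))) by ring.
have -> : B * expR (L ^+ 2 * a ^+ 2 / 2) / Num.sqrt pi * expR (- (z ^+ 2 / 2)) =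
   (B / Num.sqrt pi) * (expR (L ^+ 2 * a ^+ 2 / 2) * expR (- (z ^+ 2 / 2))) by ring.
apply: ler_wpM2l; first by rewrite divr_ge0// ltW.
rewrite -!expRD ler_expR.
rewrite -(real_normK (num_real z)) -(real_normK (num_real a)).
have := sqr_ge0 (L * `|a| - `|z|); lra.
Qed.

End gaussian_derivatives.

(** * The Duhamel integral of the drifted heat equation *)

Section duhamel.
Context {R : realType}.
Notation mu := (@lebesgue_measure R).
Implicit Types (f : R -> R -> R) (c t x s y : R).

(* The change of time s = t * sg th has a Jacobian dsg vanishing at both ends of
   ]0, 1[: it cancels the singularities in s^(-1/2) and (t - s)^(-1/2) of the
   Duhamel integrand. *)
Definition sg (th : R) : R := th ^+ 2 * (3 - 2 * th).
Definition dsg (th : R) : R := 6 * th * (1 - th).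

Definition duh c f t x : R :=
  \int[mu]_(th in `]0, 1[) (t * dsg th *
    gop gh0 (f (t * sg th)) (x - c * (t * (1 - sg th)))
      (2 * Num.sqrt (t * (1 - sg th)))).

Definition duh1 c f t x : R :=
  \int[mu]_(th in `]0, 1[) (t * dsg th *
    (gop gh1 (f (t * sg th)) (x - c * (t * (1 - sg th)))
      (2 * Num.sqrt (t * (1 - sg th))) / (2 * Num.sqrt (t * (1 - sg th))))).

Definition jcont f := forall s y : R, 0 < s ->
  {for (s, y), continuous (fun p : R * R => f p.1 p.2)}.

(* This allows a singularity in s^(-1/2) at s = 0, as for the space derivative of
   a solution with merely continuous initial datum. *)
Definition sing f := jcont f /\
  forall T, exists C, forall s y, 0 < s <= T -> Num.sqrt s * `|f s y| <= C.

(** The two quadratic lower bounds say that the square roots of [sg] and of 1 - [sg] dominate th and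
    1 - th, the two factors of [dsg]. *)
Lemma sg_bounds (th : R) : 0 < th < 1 ->
  [/\ 0 < sg th, sg th < 1, th ^+ 2 <= sg th, (1 - th) ^+ 2 <= 1 - sg th &
      0 <= dsg th].
Proof.
move=> /andP[t0 t1]; have t1' : 0 < 1 - th by lra.
have p1 : 0 < th ^+ 2 * (1 - th) by rewrite mulr_gt0// exprn_gt0.
have p2 : 0 < th * (1 - th) ^+ 2 by rewrite mulr_gt0// exprn_gt0.
have p3 : 0 < th ^+ 2 by rewrite exprn_gt0.
have p4 : 0 < (1 - th) ^+ 2 by rewrite exprn_gt0.
have p5 : 0 < th * (1 - th) by rewrite mulr_gt0.
by split; rewrite /sg /dsg; lra.
Qed.

Lemma cvg_R2 (T : Type) (F : set_system T) {FF : Filter F} (u v : T -> R) (a b : R) :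
  u x @[x --> F] --> a -> v x @[x --> F] --> b ->
  (u x, v x) @[x --> F] --> ((a, b) : R * R).
Proof. by move=> ua vb; apply: (cvg_pair ua vb). Qed.

Lemma jcont_cvg (T : topologicalType) (F : set_system T) {FF : Filter F}
    f (u v : T -> R) (a b : R) :
  {for (a, b), continuous (fun p : R * R => f p.1 p.2)} ->
  u x @[x --> F] --> a -> v x @[x --> F] --> b ->
  f (u x) (v x) @[x --> F] --> f a b.
Proof.
move=> cf ua vb.
by move=> A /= /cf /(cvg_R2 ua vb).
Qed.

Lemma jcont_section f s : jcont f -> 0 < s -> continuous (f s).
Proof.
by move=> cf s0 y; exact: (@jcont_cvg _ _ _ f (fun=> s) id s y (cf s y s0) (cvg_cst s) cvg_id).
Qed.

Lemma sing_bound f T : sing f -> exists2 C, 0 <= C & forall s y, 0 < s <= T ->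
  `|f s y| <= C / Num.sqrt s.
Proof.
move=> [_ /(_ T) [C HC]]; exists `|C| => // s y sT.
have /andP[s0 _] := sT.
have r0 : 0 < Num.sqrt s by rewrite sqrtr_gt0.
by rewrite ler_pdivlMr// mulrC (le_trans (HC s y sT))// ler_norm.
Qed.

Lemma sing_gop_cvg (T : pseudoMetricType R) (p : T) f (h : R -> R) (s x a : T -> R) :
  sing f -> gker h -> 0 < s p ->
  {for p, continuous s} -> {for p, continuous x} -> {for p, continuous a} ->
  {for p, continuous (fun q => gop h (f (s q)) (x q) (a q))}.
Proof.
move=> sf kh s0 cs cx ca.
have [C C0 HC] := sing_bound (s p + 1) sf; have [cf _] := sf.
have E : nbhs p = within setT (nbhs p).
  apply/seteqP; split => A; rewrite /within /=; apply: filterS => y; last exact.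
  by [].
have n1 : \forall q \near p, s p / 2 < s q.
  by apply: (cvgr_gt (s p)) => //; lra.
have n2 : \forall q \near p, s q < s p + 1.
  by apply: (cvgr_lt (s p)) => //; lra.
suff : gop h (f (s q)) (x q) (a q) @[q --> within setT (nbhs p)] --> gop h (f (s p)) (x p) (a p).
  by rewrite -E.
apply: (@gop_cvg _ _ _ _ _ _ _ x a _ _ (C / Num.sqrt (s p / 2))) => //; rewrite -E.
- near=> q; apply: jcont_section => //; apply: (@lt_trans _ _ (s p / 2)); first lra.
  by near: q.
- near=> q => y.
  have s1 : s p / 2 < s q by near: q.
  have s2 : s q < s p + 1 by near: q.
  have s3 : 0 < Num.sqrt (s p / 2) by rewrite sqrtr_gt0; lra.
  apply: (le_trans (HC (s q) y _)); first by apply/andP; split; lra.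
  apply: ler_wpM2l => //.
  by rewrite lef_pV2 ?posrE// ?ler_wsqrtr ?ltW// sqrtr_gt0; lra.
- move=> z.
  apply: (@jcont_cvg _ _ _ f s (fun q => x q + a q * z) _ _ (cf _ _ s0)); first exact: cs.
  by apply: cvgD; [exact: cx|apply: cvgM; [exact: ca|exact: cvg_cst]].
Unshelve. all: end_near. Qed.

Lemma sing_gop_bound f (h : R -> R) T : sing f -> gker h ->
  exists2 C, 0 <= C & forall s x a, 0 < s <= T ->
    `|gop h (f s) x a| <= C / Num.sqrt s.
Proof.
move=> sf kh; have [C C0 HC] := sing_bound T sf; have [cf _] := sf.
have [K K0 HK] := gop_bound kh.
exists (K * C); first by rewrite mulr_ge0.
move=> s x a sT; rewrite -mulrA; apply: HK => [|y]; last exact: HC.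
by apply: jcont_section => //; case/andP: sT.
Qed.

Lemma sg_cont (th : R) : {for th, continuous sg} .
Proof.
apply: cvgM; first exact: exprn_continuous.
by apply: cvgB; [exact: cvg_cst|apply: cvgMr; exact: cvg_id].
Qed.

Lemma dsg_cont (th : R) : {for th, continuous dsg} .
Proof.
apply: cvgM; first by apply: cvgMr; exact: cvg_id.
by apply: cvgB; [exact: cvg_cst|exact: cvg_id].
Qed.

Lemma cvg_sqrt (T : topologicalType) (F : set_system T) {FF : Filter F} (u : T -> R) (l : R) :
  u x @[x --> F] --> l -> Num.sqrt (u x) @[x --> F] --> Num.sqrt l.
Proof.
by move=> ul; apply: (@cvg_comp _ _ _ u Num.sqrt _ (nbhs l)) => //; exact: sqrt_continuous.
Qed.

Section integrands.
Variables (T : pseudoMetricType R) (p : T) (t x th : T -> R).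
Hypotheses (ct : {for p, continuous t}) (cx : {for p, continuous x})
  (cth : {for p, continuous th}).

Let csg : sg (th q) @[q --> p] --> sg (th p).
Proof. exact: (continuous_cvg _ (@sg_cont _) cth). Qed.

Let cdsg : dsg (th q) @[q --> p] --> dsg (th p).
Proof. exact: (continuous_cvg _ (@dsg_cont _) cth). Qed.

Let cts : t q * (1 - sg (th q)) @[q --> p] --> t p * (1 - sg (th p)).
Proof. by apply: cvgM => //; apply: cvgB => //; exact: cvg_cst. Qed.

Lemma duh_integrand_cont f c (h : R -> R) : sing f -> gker h -> 0 < t p -> 0 < th p < 1 ->
  t q * dsg (th q) * gop h (f (t q * sg (th q)))
     (x q - c * (t q * (1 - sg (th q)))) (2 * Num.sqrt (t q * (1 - sg (th q)))) @[q --> p]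
  --> t p * dsg (th p) * gop h (f (t p * sg (th p)))
     (x p - c * (t p * (1 - sg (th p)))) (2 * Num.sqrt (t p * (1 - sg (th p)))).
Proof.
move=> sf kh t0 /sg_bounds [s0 s1 _ _ _].
apply: cvgM; first by apply: cvgM.
apply: (@sing_gop_cvg _ _ _ _ (fun q => t q * sg (th q))
  (fun q => x q - c * (t q * (1 - sg (th q))))
  (fun q => 2 * Num.sqrt (t q * (1 - sg (th q))))) => //.
- exact: mulr_gt0.
- by apply: cvgM.
- by apply: cvgB => //; apply: cvgMr.
- by apply: cvgMr; apply: cvg_sqrt.
Qed.

Lemma duh1_integrand_cont f c (h : R -> R) : sing f -> gker h -> 0 < t p -> 0 < th p < 1 ->
  t q * dsg (th q) * (gop h (f (t q * sg (th q)))
     (x q - c * (t q * (1 - sg (th q)))) (2 * Num.sqrt (t q * (1 - sg (th q)))) /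
       (2 * Num.sqrt (t q * (1 - sg (th q))))) @[q --> p]
  --> t p * dsg (th p) * (gop h (f (t p * sg (th p)))
     (x p - c * (t p * (1 - sg (th p)))) (2 * Num.sqrt (t p * (1 - sg (th p)))) /
       (2 * Num.sqrt (t p * (1 - sg (th p))))).
Proof.
move=> sf kh t0 th01; have [s0 s1 _ _ _] := sg_bounds th01.
under eq_fun do rewrite mulrA.
rewrite mulrA; apply: cvgM; first exact: duh_integrand_cont.
apply: cvgV; last by apply: cvgMr; apply: cvg_sqrt.
by rewrite mulf_neq0// gt_eqF// sqrtr_gt0 mulr_gt0// subr_gt0.
Qed.

End integrands.

Lemma itv01P (th : R) : (`]0, 1[%classic : set R) th = (0 < th < 1) :> Prop.
Proof. by rewrite /= in_itv /=. Qed.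

Lemma measurable_fun01 (u : R -> R) :
  (forall th, 0 < th < 1 -> {for th, continuous u}) ->
  measurable_fun (`]0, 1[ : set R) u.
Proof.
move=> cu; apply: open_continuous_measurable_fun; first exact: interval_open.
by move=> th; rewrite inE itv01P => /cu.
Qed.

Lemma lebesgue_itv01 : mu (`]0, 1[ : set R) = 1%E.
Proof. by rewrite lebesgue_measure_itv /= lte_fin ltr01 -EFinB subr0. Qed.

Lemma integrable01_cst (C : R) : mu.-integrable (`]0, 1[ : set R) (EFin \o (fun=> C)).
Proof.
apply: measurable_bounded_integrable => //.
- by rewrite [ltLHS]lebesgue_itv01 ltry.
- exact: bounded_cst.
Qed.

Lemma Rintegral01_cst (C : R) : \int[mu]_(th in `]0, 1[) (fun=> C) th = C.
Proof.
transitivity (C * fine (mu (`]0, 1[ : set R))); first exact: Rintegral_cst.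
by rewrite lebesgue_itv01 mulr1.
Qed.

Lemma integrable01 (u : R -> R) (C : R) :
  (forall th, 0 < th < 1 -> {for th, continuous u}) ->
  (forall th, 0 < th < 1 -> `|u th| <= C) ->
  mu.-integrable (`]0, 1[ : set R) (EFin \o u).
Proof.
move=> cu uC; apply: le_integrable (integrable01_cst C) => //.
  by apply/measurable_EFinP; exact: measurable_fun01.
by move=> th; rewrite itv01P => /uC h /=; rewrite lee_fin (le_trans h)// ler_norm.
Qed.

Lemma Rintegral01_le (u v : R -> R) (C : R) :
  (forall th, 0 < th < 1 -> {for th, continuous u}) ->
  (forall th, 0 < th < 1 -> {for th, continuous v}) ->
  (forall th, 0 < th < 1 -> `|u th| <= v th) ->
  (forall th, 0 < th < 1 -> v th <= C) ->
  `|\int[mu]_(th in `]0, 1[) u th| <= \int[mu]_(th in `]0, 1[) v th.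
Proof.
move=> cu cv uv vC.
have iu : mu.-integrable (`]0, 1[ : set R) (EFin \o u).
  by apply: (integrable01 (C := C)) => // th th1; apply: (le_trans (uv th th1)); exact: vC.
have iv : mu.-integrable (`]0, 1[ : set R) (EFin \o v).
  apply: (integrable01 (C := C)) => // th th1; rewrite ger0_norm ?vC//.
  exact: le_trans (uv th th1).
apply: (le_trans (le_normr_Rintegral _ iu)) => //.
apply: le_Rintegral => //; first exact: integrable_norm.
Qed.

Lemma Rintegral01_le_cst (u : R -> R) (C : R) :
  (forall th, 0 < th < 1 -> {for th, continuous u}) ->
  (forall th, 0 < th < 1 -> `|u th| <= C) ->
  `|\int[mu]_(th in `]0, 1[) u th| <= C.
Proof.
move=> cu uC; rewrite -[leRHS]Rintegral01_cst.
by apply: (Rintegral01_le (C := C)) => // th _; exact: cvg_cst.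
Qed.

Lemma dsg_sqrt_bound t (th : R) : 0 < t -> 0 < th < 1 ->
  t * dsg th / Num.sqrt (t * sg th) <= 6 * Num.sqrt t.
Proof.
move=> t0 th01; have [s0 s1 s2 s3 d0] := sg_bounds th01; have /andP[h0 h1] := th01.
have a0 : 0 < Num.sqrt t by rewrite sqrtr_gt0.
have b0 : 0 < Num.sqrt (sg th) by rewrite sqrtr_gt0.
have b1 : th <= Num.sqrt (sg th).
  by rewrite -[leLHS](ger0_norm (ltW h0)) -sqrtr_sqr ler_wsqrtr.
have sM u : Num.sqrt (t * u) = Num.sqrt t * Num.sqrt u by rewrite sqrtrM// ltW.
rewrite sM ler_pdivrMr ?mulr_gt0//.
have tE : t = Num.sqrt t ^+ 2 by rewrite sqr_sqrtr// ltW.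
rewrite [in leLHS]tE /dsg; set r := Num.sqrt t in a0 *; set q := Num.sqrt _ in b0 b1 *.
have : r ^+ 2 * (6 * th * (1 - th)) <= r ^+ 2 * (6 * q) by apply: ler_wpM2l; [exact: sqr_ge0|nra].
by lra.
Qed.

Lemma dsg_sqrt_bound1 t (th : R) : 0 < t -> 0 < th < 1 ->
  t * dsg th / (2 * Num.sqrt (t * (1 - sg th))) <= 3 * Num.sqrt t.
Proof.
move=> t0 th01; have [s0 s1 s2 s3 d0] := sg_bounds th01; have /andP[h0 h1] := th01.
have a0 : 0 < Num.sqrt t by rewrite sqrtr_gt0.
have b0 : 0 < Num.sqrt (1 - sg th) by rewrite sqrtr_gt0 subr_gt0.
have h1' : 0 <= 1 - th by lra.
have b1 : 1 - th <= Num.sqrt (1 - sg th).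
  by rewrite -[leLHS](ger0_norm h1') -sqrtr_sqr ler_wsqrtr.
have sM u : Num.sqrt (t * u) = Num.sqrt t * Num.sqrt u by rewrite sqrtrM// ltW.
rewrite sM ler_pdivrMr ?mulr_gt0//.
have tE : t = Num.sqrt t ^+ 2 by rewrite sqr_sqrtr// ltW.
rewrite [in leLHS]tE /dsg; set r := Num.sqrt t in a0 *; set q := Num.sqrt _ in b0 b1 *.
have : r ^+ 2 * (6 * th * (1 - th)) <= r ^+ 2 * (6 * q) by apply: ler_wpM2l; [exact: sqr_ge0|nra].
by lra.
Qed.

(** Both singularities at once: the factor th of [dsg] pays for the one at s = 0, the factor 1 - th
    for the one at s = t, and the two roots of t cancel the Jacobian factor t. *)
Lemma dsg_sqrt_bound2 t (th : R) : 0 < t -> 0 < th < 1 ->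
  t * dsg th / Num.sqrt (t * sg th) / (2 * Num.sqrt (t * (1 - sg th))) <= 3.
Proof.
move=> t0 th01; have [s0 s1 s2 s3 d0] := sg_bounds th01; have /andP[h0 h1] := th01.
have a0 : 0 < Num.sqrt t by rewrite sqrtr_gt0.
have c0 : 0 < Num.sqrt (sg th) by rewrite sqrtr_gt0.
have c1 : th <= Num.sqrt (sg th).
  by rewrite -[leLHS](ger0_norm (ltW h0)) -sqrtr_sqr ler_wsqrtr.
have b0 : 0 < Num.sqrt (1 - sg th) by rewrite sqrtr_gt0 subr_gt0.
have h1' : 0 <= 1 - th by lra.
have b1 : 1 - th <= Num.sqrt (1 - sg th).
  by rewrite -[leLHS](ger0_norm h1') -sqrtr_sqr ler_wsqrtr.
have sM u : Num.sqrt (t * u) = Num.sqrt t * Num.sqrt u by rewrite sqrtrM// ltW.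
rewrite !sM.
rewrite ler_pdivrMr ?mulr_gt0// ler_pdivrMr ?mulr_gt0//.
have tE : t = Num.sqrt t ^+ 2 by rewrite sqr_sqrtr// ltW.
rewrite [in leLHS]tE /dsg; set r := Num.sqrt t in a0 *.
set q := Num.sqrt _ in b0 b1 *; set q' := Num.sqrt _ in c0 c1 *.
have : r ^+ 2 * (6 * th * (1 - th)) <= r ^+ 2 * (6 * (q * q')).
  apply: ler_wpM2l; first exact: sqr_ge0.
  rewrite -mulrA ler_pM2l// [q * q']mulrC; apply: ler_pM => //; exact: ltW.
by lra.
Qed.

Lemma tsg_range t (th T : R) : 0 < t <= T -> 0 < th < 1 -> 0 < t * sg th <= T.
Proof.
move=> /andP[t0 tT] /sg_bounds[s0 s1 _ _ _].
rewrite mulr_gt0//= (le_trans _ tT)//; nra.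
Qed.

Lemma duh_integrand_bound f (h : R -> R) T : sing f -> gker h ->
  exists2 C, 0 <= C & forall t x a th, 0 < t <= T -> 0 < th < 1 ->
    `|t * dsg th * gop h (f (t * sg th)) x a| <= C.
Proof.
move=> sf kh; have [C C0 HC] := sing_gop_bound T sf kh.
exists (C * (6 * Num.sqrt T)); first by rewrite !mulr_ge0// sqrtr_ge0.
move=> t x a th tT th01; have /andP[t0 t1] := tT.
have [s0 s1 s2 s3 d0] := sg_bounds th01.
rewrite normrM ger0_norm; last by rewrite mulr_ge0// ltW.
have := HC _ x a (tsg_range tT th01) => B.
apply: (le_trans (ler_wpM2l _ B)); first by rewrite mulr_ge0// ltW.
rewrite mulrCA; apply: ler_wpM2l => //.
apply: (le_trans (dsg_sqrt_bound t0 th01)).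
by rewrite ler_pM2l// ler_wsqrtr.
Qed.

Lemma duh1_integrand_bound f (h : R -> R) T : sing f -> gker h ->
  exists2 C, 0 <= C & forall t x a th, 0 < t <= T -> 0 < th < 1 ->
    `|t * dsg th * (gop h (f (t * sg th)) x a / (2 * Num.sqrt (t * (1 - sg th))))| <= C.
Proof.
move=> sf kh; have [C C0 HC] := sing_gop_bound T sf kh.
exists (C * 3); first by rewrite !mulr_ge0.
move=> t x a th tT th01; have /andP[t0 t1] := tT.
have [s0 s1 s2 s3 d0] := sg_bounds th01.
have q0 : 0 < 2 * Num.sqrt (t * (1 - sg th)).
  by rewrite mulr_gt0// sqrtr_gt0 mulr_gt0// subr_gt0.
rewrite normrM ger0_norm; last by rewrite mulr_ge0// ltW.
rewrite normrM normfV (gtr0_norm q0).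
have B := HC _ x a (tsg_range tT th01).
apply: (@le_trans _ _ (t * dsg th * (C / Num.sqrt (t * sg th) / (2 * Num.sqrt (t * (1 - sg th)))))).
  apply: ler_wpM2l; first by rewrite mulr_ge0// ltW.
  by apply: ler_wpM2r => //; rewrite invr_ge0 ltW.
have := ler_wpM2l C0 (dsg_sqrt_bound2 t0 th01); apply: le_trans.
set u := (Num.sqrt _)^-1; set v := (2 * _)^-1; lra.
Qed.

Lemma duh_cont f c : sing f -> jcont (duh c f).
Proof.
move=> sf t x t0.
have [C C0 HC] := duh_integrand_bound (t + 1) sf (@gker0 R).
have n1 : \forall q \near (t, x), 0 < (q.1 : R) <= t + 1.
  near=> q; apply/andP; split.
    by near: q; apply: (cvgr_gt t) => //; exact: cvg_fst.
  by near: q; apply: (cvgr_le t); [exact: cvg_fst|rewrite ltrDl].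
apply: (@cvg_dominated _ _ _ _ (fun (q : R * R) th => q.1 * dsg th *
    gop gh0 (f (q.1 * sg th)) (q.2 - c * (q.1 * (1 - sg th)))
      (2 * Num.sqrt (q.1 * (1 - sg th)))) _ (fun=> C)) => //.
- exact: integrable01_cst.
- apply: filterS n1 => q /andP[q1 _]; apply: measurable_fun01 => th th01.
  by apply: (@duh_integrand_cont _ _ (fun=> q.1) (fun=> q.2) id); [exact: cvg_cst|exact: cvg_cst|exact: cvg_id|..] => //; exact: gker0.
- by apply: filterS n1 => q q1 th; rewrite itv01P => th01; exact: HC.
- move=> th; rewrite itv01P => th01.
  by apply: (@duh_integrand_cont _ (t, x) fst snd (fun=> th)); [exact: cvg_fst|exact: cvg_snd|exact: cvg_cst|..] => //; exact: gker0.
Unshelve. all: end_near. Qed.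

Lemma duh1_cont f c : sing f -> jcont (duh1 c f).
Proof.
move=> sf t x t0.
have [C C0 HC] := duh1_integrand_bound (t + 1) sf (@gker1 R).
have n1 : \forall q \near (t, x), 0 < (q.1 : R) <= t + 1.
  near=> q; apply/andP; split.
    by near: q; apply: (cvgr_gt t) => //; exact: cvg_fst.
  by near: q; apply: (cvgr_le t); [exact: cvg_fst|rewrite ltrDl].
apply: (@cvg_dominated _ _ _ _ (fun (q : R * R) th => q.1 * dsg th *
    (gop gh1 (f (q.1 * sg th)) (q.2 - c * (q.1 * (1 - sg th)))
      (2 * Num.sqrt (q.1 * (1 - sg th))) / (2 * Num.sqrt (q.1 * (1 - sg th))))) _ (fun=> C)) => //.
- exact: integrable01_cst.
- apply: filterS n1 => q /andP[q1 _]; apply: measurable_fun01 => th th01.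
  by apply: (@duh1_integrand_cont _ _ (fun=> q.1) (fun=> q.2) id); [exact: cvg_cst|exact: cvg_cst|exact: cvg_id|..] => //; exact: gker1.
- by apply: filterS n1 => q q1 th; rewrite itv01P => th01; exact: HC.
- move=> th; rewrite itv01P => th01.
  by apply: (@duh1_integrand_cont _ (t, x) fst snd (fun=> th)); [exact: cvg_fst|exact: cvg_snd|exact: cvg_cst|..] => //; exact: gker1.
Unshelve. all: end_near. Qed.

Lemma is_derive_duh f c t x : sing f -> 0 < t ->
  is_derive x 1 (duh c f t) (duh1 c f t x).
Proof.
move=> sf t0.
have tt : 0 < t <= t by rewrite t0 lexx.
have [C C0 HC] := duh_integrand_bound t sf (@gker0 R).
have [C1 C10 HC1] := duh1_integrand_bound t sf (@gker1 R).
pose k x th := t * dsg th *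
    gop gh0 (f (t * sg th)) (x - c * (t * (1 - sg th)))
      (2 * Num.sqrt (t * (1 - sg th))).
pose dk x th := t * dsg th *
    (gop gh1 (f (t * sg th)) (x - c * (t * (1 - sg th)))
      (2 * Num.sqrt (t * (1 - sg th))) / (2 * Num.sqrt (t * (1 - sg th)))).
have kd y th : 0 < th < 1 -> is_derive y 1 (k ^~ th) (dk y th).
  move=> th01; have [s0 s1 _ _ _] := sg_bounds th01.
  have a0 : 2 * Num.sqrt (t * (1 - sg th)) != 0.
    by rewrite mulf_neq0// gt_eqF// sqrtr_gt0 mulr_gt0// subr_gt0.
  have /andP[ts0 _] := tsg_range tt th01.
  have [B B0 HB] := sing_bound t sf.
  have D := is_derive_gop0_x (y - c * (t * (1 - sg th))) a0 (jcont_section sf.1 ts0)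
    (fun z => HB _ z (tsg_range tt th01)).
  have D1 : is_derive y 1 (fun y => y - c * (t * (1 - sg th))) 1.
    by apply: is_derive_eq; rewrite /GRing.scale /=; ring.
  have D2 := @is_derive1_comp _ (fun x => gop gh0 (f (t * sg th)) x (2 * Num.sqrt (t * (1 - sg th))))
    (fun y => y - c * (t * (1 - sg th))) _ _ _ D D1; rewrite /comp in D2.
  by rewrite /k /dk; apply: is_derive_eq; rewrite /GRing.scale /=; ring.
have xI : `]x - 1, x + 1[ x by rewrite /= in_itv /=; lra.
have ik y : `]x - 1, x + 1[ y -> mu.-integrable (`]0, 1[ : set R) (EFin \o k y).
  move=> _; apply: (integrable01 (C := C)) => th th01; last exact: HC.
  by apply: (@duh_integrand_cont _ _ (fun=> t) (fun=> y) id); [exact: cvg_cst|exact: cvg_cst|exact: cvg_id|..] => //; exact: gker0.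
have kderiv y th : `]x - 1, x + 1[ y -> (`]0, 1[%classic : set R) th -> derivable (k ^~ th) y 1.
  by move=> _; rewrite itv01P => th01; have [] := kd y th th01.
have dkE y th : 0 < th < 1 -> partial1of2 k y th = dk y th.
  by move=> th01; rewrite partial1of2E; have [_ ->] := kd y th th01.
have dkC y th : `]x - 1, x + 1[ y -> (`]0, 1[%classic : set R) th -> `|partial1of2 k y th| <= C1.
  by move=> _; rewrite itv01P => th01; rewrite dkE//; exact: HC1.
have D1 := derivable_under_integral (mu := mu) (measurable_itv _) xI ik kderiv (fun=> C10) (integrable01_cst C1) dkC.
have D2 := differentiation_under_integral (mu := mu) (measurable_itv _) xI ik kderiv (fun=> C10) (integrable01_cst C1) dkC.
apply: DeriveDef; first exact: D1.
rewrite -derive1E [LHS]D2.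
by apply: eq_Rintegral => th; rewrite inE itv01P => th01; rewrite dkE.
Qed.

(** Moves the space derivative from the kernel to the source. Hence the second space derivative of
    [duh c f] is [duh1 c f'], which carries only one kernel singularity. *)
Lemma duh1_duh f f' c t x : sing f -> sing f' -> 0 < t ->
  (forall s y : R, 0 < s -> is_derive y 1 (f s) (f' s y)) ->
  duh1 c f t x = duh c f' t x.
Proof.
move=> sf sf' t0 ff'.
have tt : 0 < t <= t by rewrite t0 lexx.
have [B B0 HB] := sing_bound t sf'.
apply: eq_Rintegral => th; rewrite inE itv01P => th01.
have tr := tsg_range tt th01; have /andP[ts0 _] := tr.
have [s0 s1 _ _ _] := sg_bounds th01.
have a0 : 2 * Num.sqrt (t * (1 - sg th)) != 0.
  by rewrite mulf_neq0// gt_eqF// sqrtr_gt0 mulr_gt0// subr_gt0.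
rewrite (gop_ibp01 _ _ (fun y => ff' _ y ts0) (jcont_section sf'.1 ts0) (fun z => HB _ z tr)).
by rewrite [X in X / _]mulrC mulfK.
Qed.

Lemma duh1_bounded f c T B : sing f -> 0 <= B ->
  (forall s y, 0 < s <= T -> `|f s y| <= B) ->
  exists2 C, 0 <= C & forall t x, 0 < t <= T -> `|duh1 c f t x| <= C.
Proof.
move=> sf B0 fB; have [K K0 HK] := gop_bound (@gker1 R).
exists (K * B * (3 * Num.sqrt T)); first by rewrite !mulr_ge0// sqrtr_ge0.
move=> t x tT; have /andP[t0 t1] := tT.
apply: Rintegral01_le_cst => th th01.
  by apply: (@duh1_integrand_cont _ _ (fun=> t) (fun=> x) id); [exact: cvg_cst|exact: cvg_cst|exact: cvg_id|..] => //; exact: gker1.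
have [s0 s1 s2 s3 d0] := sg_bounds th01.
have tr := tsg_range tT th01; have /andP[ts0 _] := tr.
have q0 : 0 < 2 * Num.sqrt (t * (1 - sg th)).
  by rewrite mulr_gt0// sqrtr_gt0 mulr_gt0// subr_gt0.
rewrite normrM ger0_norm; last by rewrite mulr_ge0// ltW.
rewrite normrM normfV (gtr0_norm q0).
have H := HK _ (x - c * (t * (1 - sg th))) (2 * Num.sqrt (t * (1 - sg th))) B
  (jcont_section sf.1 ts0) (fun y => fB _ y tr).
apply: (@le_trans _ _ (t * dsg th * (K * B / (2 * Num.sqrt (t * (1 - sg th)))))).
  apply: ler_wpM2l; first by rewrite mulr_ge0// ltW.
  by apply: ler_wpM2r => //; rewrite invr_ge0 ltW.
rewrite mulrCA; apply: ler_wpM2l; first by rewrite mulr_ge0.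
apply: (le_trans (dsg_sqrt_bound1 t0 th01)).
by rewrite ler_pM2l// ler_wsqrtr.
Qed.

End duhamel.

(** * Growth bound and time derivative of the Duhamel integral *)

Section duhamel_time.
Context {R : realType}.
Notation mu := (@lebesgue_measure R).
Implicit Types (f : R -> R -> R) (c t x s y : R).

Lemma cvg_fun (T : Type) (F : set_system T) {FF : Filter F} (h : R -> R)
    (u : T -> R) (l : R) :
  {for l, continuous h} -> u x @[x --> F] --> l -> h (u x) @[x --> F] --> h l.
Proof. by move=> ch ul; exact: (continuous_cvg _ ch ul). Qed.

Lemma Rintegral01_FTC (F u : R -> R) : continuous u ->
  (forall x : R, is_derive x 1 F (u x)) ->
  \int[mu]_(th in `]0, 1[) u th = F 1 - F 0.
Proof.
move=> cu Fu.
have iu : mu.-integrable (`[0, 1] : set R) (EFin \o u).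
  by apply: continuous_compact_integrable; [exact: segment_compact|exact: continuous_subspaceT].
have cF := is_derive_continuous Fu.
rewrite Rintegral_itv_obnd_cbnd; last first.
  by apply: integrableS iu => //; exact: subset_itv_oo_cc.
rewrite Rintegral_itv_bndo_bndc; last first.
  by apply: integrableS iu => //; exact: subset_itv_co_cc.
rewrite /Rintegral (@continuous_FTC2 _ u F)//.
- exact: continuous_subspaceT.
- split; first by move=> x _; have [] := Fu x.
    by apply: cvg_at_right_filter; exact: cF.
  by apply: cvg_at_left_filter; exact: cF.
- by move=> x _; rewrite derive1E; have [_ ->] := Fu x.
Qed.

Lemma is_derive_sg (t : R) : is_derive t 1 sg (dsg t).
Proof.
rewrite /sg /dsg; apply: is_derive_eq; rewrite /GRing.scale /=; ring.
Qed.

Lemma sg0 : sg (0 : R) = 0. Proof. by rewrite /sg; ring. Qed.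

Lemma sg1 : sg (1 : R) = 1. Proof. by rewrite /sg; ring. Qed.

(** Measuring sources against e^(G s) turns the time integral into one of e^(-(G - rate)(t - s)),
    hence the denominator. A large [G] makes the Duhamel operator contract on any time interval. *)
Lemma duh_exp_bound : exists2 K : R, 0 <= K &
  forall f c L B G t x, 0 <= L -> sing f -> 0 < t ->
    L * `|c| + 2 * L ^+ 2 < G ->
    (forall s, 0 < s <= t -> exists A, forall y, `|f s y| <= A) ->
    (forall s y, 0 < s <= t -> `|f s y| <= B * expR (G * s) * expR (L * `|x - y|)) ->
    `|duh c f t x| <= K * B * expR (G * t) / (G - (L * `|c| + 2 * L ^+ 2)).
Proof.
have [K K0 HK] := @gop0_loglipschitz R.
exists K => // f c L B G t x L0 sf t0 G0 fA fB.
set b := G - _; have b0 : 0 < b by rewrite subr_gt0.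
have tt : 0 < t <= t by rewrite t0 lexx.
have B0 : 0 <= B.
  have := le_trans (normr_ge0 _) (fB t x tt).
  by rewrite subrr normr0 mulr0 expR0 mulr1 pmulr_lge0// expR_gt0.
pose E th := K * B * expR (G * t) * expR (- (b * (t * (1 - sg th)))).
pose v th := t * dsg th * E th.
have cE : continuous E.
  move=> th; apply: cvgMr; apply: (cvg_fun (h := expR)); first exact: continuous_expR.
  apply: cvgN; apply: cvgMr; apply: cvgMr; apply: cvgB; [exact: cvg_cst|exact: sg_cont].
have cv : continuous v.
  by move=> th; apply: cvgM; [apply: cvgMr; exact: dsg_cont|exact: cE].
(* The majorant is an exact derivative because [dsg] is the derivative of [sg], so its integral
   needs no estimate. *)
have Fv th : is_derive (th : R) 1 (fun th => b^-1 * E th) (v th).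
  have D := is_derive_sg th.
  rewrite /E /v; apply: is_derive_eq; rewrite /GRing.scale /E /=.
  by field; rewrite gt_eqF.
have E0 th : 0 <= E th by rewrite /E !mulr_ge0// expR_ge0.
have EM th : 0 < th < 1 -> E th <= K * B * expR (G * t).
  move=> /sg_bounds[s0 s1 _ _ _]; rewrite /E ler_piMr ?mulr_ge0 ?expR_ge0//.
  by rewrite -[leRHS]expR0 ler_expR oppr_le0 !mulr_ge0 ?ltW// subr_gt0.
apply: (@le_trans _ _ (\int[mu]_(th in `]0, 1[) v th)).
  apply: (Rintegral01_le (C := t * 6 * (K * B * expR (G * t)))).
  - move=> th th01.
    by apply: (@duh_integrand_cont _ _ _ (fun=> t) (fun=> x) id); [exact: cvg_cst|exact: cvg_cst|exact: cvg_id|..] => //; exact: gker0.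
  - by move=> th _; exact: cv.
  - move=> th th01; have [s0 s1 _ _ d0] := sg_bounds th01.
    have tr := tsg_range tt th01; have /andP[ts0 _] := tr.
    rewrite normrM ger0_norm; last by rewrite mulr_ge0// ltW.
    apply: ler_wpM2l; first by rewrite mulr_ge0// ltW.
    set X := x - _; set q := t * (1 - sg th) in X *; set s := t * sg th in tr ts0 *.
    have q0 : 0 <= q by rewrite mulr_ge0 ?ltW// subr_gt0.
    have [A HA] := fA s tr.
    apply: (le_trans (HK (f s) A (B * expR (G * s) * expR (L * `|c| * q)) L X _ (jcont_section sf.1 ts0) HA _)).
      move=> y; apply: (le_trans (fB s y tr)); rewrite -[leRHS]mulrA -expRD.
      apply: ler_wpM2l; first by rewrite mulr_ge0// expR_ge0.
      rewrite ler_expR -mulrA -mulrDr ler_wpM2l//.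
      have -> : x - y = c * q + (X - y) by rewrite /X; ring.
      by apply: (le_trans (ler_normD _ _)); rewrite normrM (ger0_norm q0).
    rewrite exprMn sqr_sqrtr// /E.
    rewrite le_eqVlt; apply/orP; left; apply/eqP.
    rewrite -!mulrA -!expRD; congr (_ * (_ * expR _)).
    by rewrite /b /s /q; field.
  - move=> th th01; have [s0 s1 _ _ d0] := sg_bounds th01; have /andP[h0 h1] := th01.
    apply: ler_pM => //; last exact: EM.
      by rewrite mulr_ge0// ltW.
    by apply: ler_wpM2l; [exact: ltW|rewrite /dsg; nra].
rewrite (Rintegral01_FTC cv Fv) -mulrBr mulrC.
apply: ler_wpM2r; first by rewrite invr_ge0 ltW.
apply: (@le_trans _ _ (E 1)); first by rewrite lerBlDr lerDl.
by rewrite /E sg1 subrr !mulr0 oppr0 expR0 mulr1.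
Qed.

Lemma duh_t0 f c x : duh c f 0 x = 0.
Proof.
rewrite /duh; transitivity (\int[mu]_(th in `]0, 1[) (fun=> 0 : R) th).
  by apply: eq_Rintegral => th _; rewrite !mul0r.
exact: Rintegral01_cst.
Qed.

Lemma is_derive_right_quotient (u : R -> R) (t l : R) : is_derive t 1 u l ->
  (u (t + h) - u t) / h @[h --> 0^'+] --> l.
Proof.
move=> [D <-].
have C : h^-1 *: (u (h *: 1 + t) - u t) @[h --> (0:R)^'] --> 'D_1 u t by exact: D.
have {}C : h^-1 *: (u (h *: 1 + t) - u t) @[h --> 0^'+] --> 'D_1 u t.
  apply: cvg_trans C; apply: cvg_app => P [e e0 He]; exists e => // h hb h0.
  by apply: He => //; rewrite /= gt_eqF.
apply: cvg_trans C; apply: near_eq_cvg; near=> h.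
by rewrite scaler1 [h + t]addrC [LHS]mulrC.
Unshelve. all: end_near. Qed.

Section time_derivative.
Variables (f f' : R -> R -> R) (c : R).
Hypotheses (cf : continuous (fun p : R * R => f p.1 p.2))
  (fB : forall T, exists C, forall s y, s <= T -> `|f s y| <= C)
  (ff' : forall s y : R, 0 < s -> is_derive y 1 (f s) (f' s y))
  (sf' : sing f').

(** Separates the observation time tau from the source time s. For s >= tau the root is 0 by
    convention and [k] is just f s at x - c (tau - s), so [k] is continuous on the whole plane, the
    diagonal included. *)
Let k x tau s := gop gh0 (f s) (x - c * (tau - s)) (2 * Num.sqrt (tau - s)).

Let cfs s : continuous (f s).
Proof. by move=> y; exact: (@jcont_cvg _ _ _ _ f (fun=> s) id s y (@cf (s, y)) (cvg_cst s) cvg_id). Qed.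

Lemma continuous_sing : sing f.
Proof.
split; first by move=> s y _; exact: cf.
move=> T; have [C HC] := fB T; exists (Num.sqrt T * C) => s y /andP[s0 sT].
by apply: ler_pM => //; [exact: ler_wsqrtr|exact: HC].
Qed.

Lemma duh_kernel_cont x (tau0 s0 : R) :
  k x p.1 p.2 @[p --> ((tau0, s0) : R * R)] --> k x tau0 s0.
Proof.
have [C HC] := fB (s0 + 1).
have E : nbhs ((tau0, s0) : R * R) = within setT (nbhs ((tau0, s0) : R * R)).
  apply/seteqP; split => A; rewrite /within /=; apply: filterS => y; last exact.
  by [].
suff : k x p.1 p.2 @[p --> within setT (nbhs ((tau0, s0) : R * R))] --> k x tau0 s0.
  by rewrite -E.
have c1 : (p.1 - p.2 : R) @[p --> ((tau0, s0) : R * R)] --> tau0 - s0.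
  by apply: cvgB; [exact: cvg_fst|exact: cvg_snd].
apply: (@gop_cvg _ _ _ _ _ (fun p => f p.2) _ (fun p => x - c * (p.1 - p.2))
   (fun p => 2 * Num.sqrt (p.1 - p.2)) _ _ C); rewrite -?E.
- exact: gker0.
- by apply: nearW => q; exact: cfs.
- near=> q => y; apply: HC; near: q.
  by apply: (cvgr_le s0); [exact: cvg_snd|rewrite ltrDl].
- move=> z.
  apply: (@jcont_cvg _ _ _ _ f snd (fun p => x - c * (p.1 - p.2) + 2 * Num.sqrt (p.1 - p.2) * z) s0 _ (@cf _)); first exact: cvg_snd.
  apply: cvgD; first by apply: cvgB; [exact: cvg_cst|apply: cvgMr].
  by apply: cvgMl; apply: cvgMr; exact: cvg_sqrt.
Unshelve. all: end_near. Qed.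

Let ck x tau : continuous (k x tau).
Proof.
move=> s; exact: (@jcont_cvg _ _ _ _ (k x) (fun=> tau) id tau s (@duh_kernel_cont x tau s) (cvg_cst tau) cvg_id).
Qed.

Let K_ex x tau : exists F : R -> R, forall s : R, is_derive s 1 F (k x tau s).
Proof. exact: continuous_antiderivative (@ck x tau). Qed.

Lemma duh_kernel_FTC x tau t (F : R -> R) :
  (forall s : R, is_derive s 1 F (k x tau s)) ->
  \int[mu]_(th in `]0, 1[) (t * dsg th * k x tau (t * sg th)) = F t - F 0.
Proof.
move=> Fk.
have -> : F t - F 0 = F (t * sg 1) - F (t * sg 0) by rewrite sg0 sg1 mulr0 mulr1.
apply: (@Rintegral01_FTC (fun th => F (t * sg th))).
  move=> th; apply: cvgM; first by apply: cvgMr; exact: dsg_cont.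
  by apply: (cvg_fun (@ck _ _ _)); apply: cvgMr; exact: sg_cont.
move=> th; have D := is_derive_sg th.
have D1 : is_derive th 1 (fun th => t * sg th) (t * dsg th).
  by apply: is_derive_eq; rewrite /GRing.scale /=; ring.
rewrite mulrC.
exact: (@is_derive1_comp _ F (fun th => t * sg th)).
Qed.

Lemma duh_kernelE t x :
  duh c f t x = \int[mu]_(th in `]0, 1[) (t * dsg th * k x t (t * sg th)).
Proof.
apply: eq_Rintegral => th _; rewrite /k.
by have -> : t - t * sg th = t * (1 - sg th) by ring.
Qed.

Let dk x tau s := gop gh1 (f' s) (x - c * (tau - s)) (2 * Num.sqrt (tau - s)) /
   (2 * Num.sqrt (tau - s)) - c * gop gh0 (f' s) (x - c * (tau - s)) (2 * Num.sqrt (tau - s)).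

Lemma is_derive_duh_kernel x tau s : 0 < s -> s < tau ->
  is_derive tau 1 (fun tau => k x tau s) (dk x tau s).
Proof.
move=> s0 st; have d0 : 0 < tau - s by rewrite subr_gt0.
have [B _ HB] := sing_bound s sf'.
have D := is_derive_heat_t_smooth c x d0 (fun y => ff' y s0) (jcont_section sf'.1 s0)
  (fun y => HB s y (introT andP (conj s0 (lexx s)))).
have D1 : is_derive tau 1 (fun tau => tau - s) 1.
  by apply: is_derive_eq; rewrite subr0.
have := @is_derive1_comp _ (fun t => gop gh0 (f s) (x - c * t) (2 * Num.sqrt t)) (fun tau => tau - s) _ _ _ D D1.
by rewrite mulr1.
Qed.

(** The majorant for dominated convergence. By the mean value theorem the quotient is a
    tau-derivative at some tau > t, where sqrt (tau - s) >= sqrt (t - s); to the left of t this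
    comparison fails, which explains the restriction to h > 0. *)
Lemma duh_kernel_lipschitz x t : 0 < t ->
  exists2 C, 0 <= C & forall h th, 0 < h -> 0 < th < 1 ->
   `|t * dsg th * ((k x (t + h) (t * sg th) - k x t (t * sg th)) / h)| <= C.
Proof.
move=> t0.
have tt : 0 < t <= t by rewrite t0 lexx.
have [C1 C10 HC1] := sing_gop_bound t sf' (@gker1 R).
have [C2 C20 HC2] := sing_gop_bound t sf' (@gker0 R).
exists (C1 * 3 + `|c| * (C2 * (6 * Num.sqrt t))).
  by rewrite addr_ge0 ?mulr_ge0// sqrtr_ge0.
move=> h th h0 th01; have [s0 s1 _ _ d0] := sg_bounds th01.
have tr := tsg_range tt th01; have /andP[ts0 _] := tr.
have st : t * sg th < t by rewrite gtr_pMr.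
set s := t * sg th in tr ts0 st *.
have [tau] : exists2 tau, tau \in `]t, t + h[%R & k x (t + h) s - k x t s = dk x tau s * (t + h - t).
  apply: (@MVT _ (fun tau => k x tau s) (fun tau => dk x tau s)); first by rewrite ltrDl.
  - move=> tau; rewrite in_itv /= => /andP[t1 t2].
    by apply: is_derive_duh_kernel => //; exact: lt_trans st t1.
  - apply: derivable_within_continuous => tau; rewrite in_itv /= => /andP[t1 t2].
    by have [] := is_derive_duh_kernel x ts0 (lt_le_trans st t1).
rewrite in_itv /= => /andP[t1 t2] ->.
rewrite addrAC subrr add0r mulfK; last by rewrite gt_eqF.
rewrite normrM ger0_norm; last by rewrite mulr_ge0// ltW.
have q0 : 0 < 2 * Num.sqrt (t - s) by rewrite mulr_gt0// sqrtr_gt0 subr_gt0.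
have q1 : 2 * Num.sqrt (t - s) <= 2 * Num.sqrt (tau - s).
  by rewrite ler_pM2l// ler_wsqrtr// lerD2r ltW.
have B1 : `|dk x tau s| <= C1 / Num.sqrt s / (2 * Num.sqrt (t - s)) + `|c| * (C2 / Num.sqrt s).
  apply: (le_trans (ler_normB _ _)); apply: lerD; rewrite normrM; last by apply: ler_wpM2l => //; exact: HC2.
  apply: ler_pM => //; first exact: HC1.
  rewrite normfV (gtr0_norm (lt_le_trans q0 q1)) lef_pV2 ?posrE//.
  exact: lt_le_trans q0 q1.
apply: (le_trans (ler_wpM2l _ B1)); first by rewrite mulr_ge0// ltW.
have E1 := dsg_sqrt_bound2 t0 th01; have E2 := dsg_sqrt_bound t0 th01.
have -> : t - s = t * (1 - sg th) by rewrite /s; ring.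
have F1 := ler_wpM2l C10 E1.
have F2 := ler_wpM2l (mulr_ge0 (normr_ge0 c) C20) E2.
rewrite mulrDr; apply: lerD.
  by apply: le_trans F1; rewrite /s le_eqVlt; apply/orP; left; apply/eqP; ring.
rewrite [leRHS]mulrA; apply: le_trans F2.
by rewrite /s le_eqVlt; apply/orP; left; apply/eqP; ring.
Qed.

(** Split the increment into the new sources on [t, t + h], which contribute f t x in the limit, and
    the old sources on [0, t] seen h later, whose quotients converge to the integral of [dk]. *)
Lemma duh_right_derivative t x : 0 < t ->
  (duh c f (t + h) x - duh c f t x) / h @[h --> 0^'+] -->
    f t x + (duh1 c f' t x - c * duh c f' t x).
Proof.
move=> t0.
have tt : 0 < t <= t by rewrite t0 lexx.
have [C C0 HC] := duh_kernel_lipschitz x t0.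
have kd th tau : 0 < th < 1 -> {for th, continuous (fun th => t * dsg th * k x tau (t * sg th))}.
  move=> _; apply: cvgM; first by apply: cvgMr; exact: dsg_cont.
  by apply: (cvg_fun (@ck _ _ _)); apply: cvgMr; exact: sg_cont.
have ci th tau : 0 < th < 1 -> {for th, continuous (fun th => k x tau (t * sg th))}.
  by move=> _; apply: (cvg_fun (@ck _ _ _)); apply: cvgMr; exact: sg_cont.
have kb tau : exists C, forall th, 0 < th < 1 -> `|t * dsg th * k x tau (t * sg th)| <= C.
  have [A HA] := fB t; have [K K0 HK] := gop_bound (@gker0 R).
  exists (t * 6 * (K * A)) => th th01.
  have [s0 s1 _ _ d0] := sg_bounds th01; have /andP[h0 h1] := th01.
  have tr := tsg_range tt th01; have /andP[_ ts1] := tr.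
  rewrite normrM; apply: ler_pM => //.
    rewrite ger0_norm; last by rewrite mulr_ge0// ltW.
    by apply: ler_wpM2l; [exact: ltW|rewrite /dsg; nra].
  by apply: HK => // y; exact: HA.
have ik tau : mu.-integrable (`]0, 1[ : set R) (EFin \o (fun th => t * dsg th * k x tau (t * sg th))).
  by have [A HA] := kb tau; apply: integrable01 HA => th; exact: kd.
have LB : \int[mu]_(th in `]0, 1[) (t * dsg th * ((k x (t + h) (t * sg th) - k x t (t * sg th)) / h)) @[h --> 0^'+]
   --> \int[mu]_(th in `]0, 1[) (t * dsg th * dk x t (t * sg th)).
  apply: (@cvg_dominated_within _ R [set h | 0 < h] 0 _ _ _ (fun=> C)) => //.
  - exact: integrable01_cst.
  - apply: nearW => h; apply: measurable_fun01 => th th01.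
    apply: cvgM; first by apply: cvgMr; exact: dsg_cont.
    by apply: cvgMl; apply: cvgB; exact: ci.
  - apply: (@filterS _ _ _ [set h | 0 < h]); last exact: withinT.
    by move=> h h0 th; rewrite itv01P => th01; exact: HC.
  - move=> th; rewrite itv01P => th01; apply: cvgMr.
    have [s0 s1 _ _ d0] := sg_bounds th01.
    have /andP[ts0 _] := tsg_range tt th01.
    apply: (@is_derive_right_quotient (fun tau => k x tau (t * sg th))).
    by apply: is_derive_duh_kernel => //; rewrite gtr_pMr.
have EB : \int[mu]_(th in `]0, 1[) (t * dsg th * dk x t (t * sg th)) = duh1 c f' t x - c * duh c f' t x.
  have [C1 C10 HC1] := duh1_integrand_bound t sf' (@gker1 R).
  have [C2 C20 HC2] := duh_integrand_bound t sf' (@gker0 R).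
  rewrite /duh1 /duh -RintegralZl//; last first.
    apply: (integrable01 (C := C2)) => th th01; last exact: HC2.
    by apply: (@duh_integrand_cont _ _ _ (fun=> t) (fun=> x) id); [exact: cvg_cst|exact: cvg_cst|exact: cvg_id|..] => //; exact: gker0.
  rewrite -RintegralB//.
  - apply: eq_Rintegral => th _; rewrite /dk.
    have -> : t - t * sg th = t * (1 - sg th) by ring.
    by ring.
  - apply: (integrable01 (C := C1)) => th th01; last exact: HC1.
    by apply: (@duh1_integrand_cont _ _ _ (fun=> t) (fun=> x) id); [exact: cvg_cst|exact: cvg_cst|exact: cvg_id|..] => //; exact: gker1.
  - apply: (integrable01 (C := `|c| * C2)) => th th01.
      by apply: cvgMr; apply: (@duh_integrand_cont _ _ _ (fun=> t) (fun=> x) id); [exact: cvg_cst|exact: cvg_cst|exact: cvg_id|..] => //; exact: gker0.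
    by rewrite normrM; apply: ler_wpM2l => //; exact: HC2.
(* The integral over [t, t + h] is h times a value of [k] at an intermediate time [w]. The value for
   h <= 0 is a dummy that lets [w] be chosen as a function of h. *)
have LA : forall h : R, exists w : R, 0 < h -> t < w < t + h /\
    duh c f (t + h) x - duh c f t x = h * k x (t + h) w + h *
   \int[mu]_(th in `]0, 1[) (t * dsg th * ((k x (t + h) (t * sg th) - k x t (t * sg th)) / h)).
  move=> h; have [h0|h0] := ltP 0 h; last by exists 0.
  have [F HF] := K_ex x (t + h).
  have [w] : exists2 w, w \in `]t, t + h[%R & F (t + h) - F t = k x (t + h) w * (t + h - t).
    apply: MVT => //; first by rewrite ltrDl.
    by apply: continuous_subspaceT; exact: is_derive_continuous HF.
  rewrite in_itv /= => wI Ew; exists w => _; split => //.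
  have -> : h * k x (t + h) w = F (t + h) - F t by rewrite Ew; ring.
  rewrite !duh_kernelE (duh_kernel_FTC _ HF) -RintegralZl//; last first.
    by apply: (integrable01 (C := C)) => th th01; [apply: cvgM; [by apply: cvgMr; exact: dsg_cont|by apply: cvgMl; apply: cvgB; exact: ci]|exact: HC].
  have -> : \int[mu]_(th in `]0, 1[) (h * (t * dsg th * ((k x (t + h) (t * sg th) - k x t (t * sg th)) / h))) =
     \int[mu]_(th in `]0, 1[) (t * dsg th * k x (t + h) (t * sg th) - t * dsg th * k x t (t * sg th)).
    by apply: eq_Rintegral => th _; field; rewrite gt_eqF.
  rewrite RintegralB//.
  rewrite (duh_kernel_FTC _ HF).
  by ring.
have [w Hw] := choice LA.
have LK : k x (t + h) (w h) @[h --> 0^'+] --> f t x.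
  have -> : f t x = k x t t.
    rewrite /k /gop subrr mulr0 subr0 sqrtr0 mulr0.
    transitivity (\int[mu]_z (f t x * gh0 z)).
      have i0 : mu.-integrable setT (EFin \o @gh0 R).
        have [C3 [_ H3 _]] := gker_bound (@gker0 R).
        exact: (integrable_gdom (@continuous_gh0 R) H3).
      by rewrite RintegralZl// Rintegral_gh0 mulr1.
    by apply: eq_Rintegral => z _; rewrite mul0r addr0 mulrC.
  have th_ : t + h @[h --> 0^'+] --> t.
    rewrite -[X in _ --> X]addr0; apply: cvgD; first exact: cvg_cst.
    exact: cvg_at_right_filter cvg_id.
  have tw : w h @[h --> 0^'+] --> t.
    apply: squeeze_cvgr (cvg_cst t) th_.
    near=> h.
    have h0 : 0 < h by near: h; exact: nbhs_right_gt.
    by have [/andP[/ltW-> /ltW->]] := Hw h h0.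
  exact: (@jcont_cvg _ _ _ _ (k x) (fun h => t + h) w t t (@duh_kernel_cont x t t) th_ tw).
rewrite -EB.
apply: cvg_trans (cvgD LK LB); apply: near_eq_cvg; near=> h.
have h0 : 0 < h by near: h; exact: nbhs_right_gt.
have [_ ->] := Hw h h0.
by rewrite -mulrDr mulrAC mulfV ?mul1r// gt_eqF.
Unshelve. all: end_near. Qed.

(** The right derivative just computed is continuous in t, which upgrades it to a two-sided one. *)
Lemma is_derive_duh_t t x : 0 < t ->
  is_derive t 1 (fun t => duh c f t x) (f t x + (duh1 c f' t x - c * duh c f' t x)).
Proof.
move=> t0.
have tp u : `|u - t| < t -> 0 < u by rewrite ltr_norml => /andP[]; lra.
apply: (@is_derive_right_cvg _ (fun t => duh c f t x)
  (fun t => f t x + (duh1 c f' t x - c * duh c f' t x)) t t t0).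
- move=> u /tp u0.
  exact: (@jcont_cvg _ _ _ _ (duh c f) id (fun=> x) u x (duh_cont continuous_sing u0) cvg_id (cvg_cst x)).
- by move=> u /tp u0; exact: duh_right_derivative.
- apply: cvgD; first exact: (@jcont_cvg _ _ _ _ f id (fun=> x) t x (@cf (t, x)) cvg_id (cvg_cst x)).
  apply: cvgB; first exact: (@jcont_cvg _ _ _ _ (duh1 c f') id (fun=> x) t x (duh1_cont sf' t0) cvg_id (cvg_cst x)).
  apply: cvgMr; exact: (@jcont_cvg _ _ _ _ (duh c f') id (fun=> x) t x (duh_cont sf' t0) cvg_id (cvg_cst x)).
Qed.

End time_derivative.
End duhamel_time.

(** * The drifted heat semigroup *)

Section heat.
Context {R : realType}.
Notation mu := (@lebesgue_measure R).

Definition hs (c : R) (phi : R -> R) (t x : R) : R :=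
  gop gh0 phi (x - c * t) (2 * Num.sqrt t).
Definition hs1 (c : R) (phi : R -> R) (t x : R) : R :=
  gop gh1 phi (x - c * t) (2 * Num.sqrt t) / (2 * Num.sqrt t).
Definition hs2 (c : R) (phi : R -> R) (t x : R) : R :=
  gop gh2 phi (x - c * t) (2 * Num.sqrt t) / (4 * t).

Section fixed_datum.
Variables (c A : R) (phi : R -> R).
Hypotheses (cphi : continuous phi) (phiA : forall y, `|phi y| <= A).

Lemma hs_gop_cvg (T : pseudoMetricType R) (p : T) (h : R -> R) (t x : T -> R) :
  gker h -> {for p, continuous t} -> {for p, continuous x} ->
  gop h phi (x q - c * t q) (2 * Num.sqrt (t q)) @[q --> p] -->
  gop h phi (x p - c * t p) (2 * Num.sqrt (t p)).
Proof.
move=> kh ct cx.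
have E : nbhs p = within setT (nbhs p).
  apply/seteqP; split => B; rewrite /within /=; apply: filterS => y; last exact.
  by [].
suff : gop h phi (x q - c * t q) (2 * Num.sqrt (t q)) @[q --> within setT (nbhs p)] -->
   gop h phi (x p - c * t p) (2 * Num.sqrt (t p)) by rewrite -E.
apply: (@gop_cvg _ _ _ _ _ (fun=> phi) phi (fun q => x q - c * t q)
   (fun q => 2 * Num.sqrt (t q)) _ _ A) => //; rewrite -?E.
- exact: nearW.
- exact: nearW.
- move=> z; apply: cvg_fun; first exact: cphi.
  apply: cvgD; first by apply: cvgB => //; apply: cvgMr.
  by apply: cvgMl; apply: cvgMr; exact: cvg_sqrt.
Qed.

Lemma hs_init x : hs c phi 0 x = phi x.
Proof.
rewrite /hs /gop mulr0 subr0 sqrtr0 mulr0.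
transitivity (\int[mu]_z (phi x * gh0 z)).
  by apply: eq_Rintegral => z _; rewrite mul0r addr0 mulrC.
have i0 : mu.-integrable setT (EFin \o @gh0 R).
  have [C3 [_ H3 _]] := gker_bound (@gker0 R).
  exact: (integrable_gdom (@continuous_gh0 R) H3).
by rewrite RintegralZl// Rintegral_gh0 mulr1.
Qed.

Lemma jcont_hs1 : jcont (hs1 c phi).
Proof.
move=> t x t0; apply: cvgM.
  exact: (@hs_gop_cvg _ (t, x) gh1 fst snd (@gker1 R) cvg_fst cvg_snd).
apply: cvgV; first by rewrite mulf_neq0// gt_eqF// sqrtr_gt0.
by apply: cvgMr; apply: cvg_sqrt; exact: cvg_fst.
Qed.

Lemma jcont_hs2 : jcont (hs2 c phi).
Proof.
move=> t x t0; apply: cvgM.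
  exact: (@hs_gop_cvg _ (t, x) gh2 fst snd (@gker2 R) cvg_fst cvg_snd).
apply: cvgV; first by rewrite mulf_neq0// gt_eqF.
by apply: cvgMr; exact: cvg_fst.
Qed.

Lemma sing_hs1 : sing (hs1 c phi).
Proof.
split; first exact: jcont_hs1.
have [K K0 HK] := gop_bound (@gker1 R).
move=> T; exists (K * A) => s y /andP[s0 _].
have r0 : 0 < Num.sqrt s by rewrite sqrtr_gt0.
rewrite /hs1 normrM normfV (gtr0_norm (_ : 0 < 2 * Num.sqrt s)) ?mulr_gt0//.
have := HK _ (y - c * s) (2 * Num.sqrt s) _ cphi phiA.
have := normr_ge0 (gop gh1 phi (y - c * s) (2 * Num.sqrt s)).
set g := `|_|; set r := Num.sqrt s in r0 *.
have -> : r * (g / (2 * r)) = g / 2 by field; rewrite gt_eqF.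
lra.
Qed.

Lemma is_derive_hs_x (t x : R) : 0 < t -> is_derive x 1 (hs c phi t) (hs1 c phi t x).
Proof.
move=> t0.
have a0 : 2 * Num.sqrt t != 0 by rewrite mulf_neq0// gt_eqF// sqrtr_gt0.
have D := is_derive_gop0_x (x - c * t) a0 cphi phiA.
have D1 : is_derive x 1 (fun x => x - c * t) 1 by apply: is_derive_eq; rewrite subr0.
have := @is_derive1_comp _ (fun x => gop gh0 phi x (2 * Num.sqrt t)) (fun x => x - c * t) _ _ _ D D1.
by rewrite mulr1.
Qed.

Lemma is_derive_hs1_x (t x : R) : 0 < t -> is_derive x 1 (hs1 c phi t) (hs2 c phi t x).
Proof.
move=> t0.
have s0 : Num.sqrt t != 0 by rewrite gt_eqF// sqrtr_gt0.
have a0 : 2 * Num.sqrt t != 0 by rewrite mulf_neq0.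
have D := is_derive_gop1_x (x - c * t) a0 cphi phiA.
have D1 : is_derive x 1 (fun x => x - c * t) 1 by apply: is_derive_eq; rewrite subr0.
have D2 := @is_derive1_comp _ (fun x => gop gh1 phi x (2 * Num.sqrt t)) (fun x => x - c * t) _ _ _ D D1.
rewrite /comp in D2; rewrite /hs1 /hs2; apply: is_derive_eq; rewrite /GRing.scale /=.
have -> : 4 * t = 4 * Num.sqrt t ^+ 2 by rewrite sqr_sqrtr// ltW.
set X := x - c * t; set r := Num.sqrt t in s0 *.
by field.
Qed.

Lemma is_derive_hs_t (t x : R) : 0 < t ->
  is_derive t 1 (fun t => hs c phi t x) (hs2 c phi t x - c * hs1 c phi t x).
Proof. by move=> t0; exact: is_derive_heat_t cphi phiA. Qed.

End fixed_datum.

Lemma hs_exp_bound : exists2 K : R, 0 <= K &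
  forall c phi A B L t x, 0 <= L -> 0 <= t -> continuous phi ->
    (forall y, `|phi y| <= A) -> (forall y, `|phi y| <= B * expR (L * `|x - y|)) ->
    `|hs c phi t x| <= K * B * expR ((L * `|c| + 2 * L ^+ 2) * t).
Proof.
have [K K0 HK] := @gop0_loglipschitz R.
exists K => // c phi A B L t x L0 t0 cphi phiA phiB.
have B0 : 0 <= B.
  by have := le_trans (normr_ge0 _) (phiB x); rewrite subrr normr0 mulr0 expR0 mulr1.
apply: (le_trans (HK phi A (B * expR (L * (`|c| * t))) L (x - c * t) _ cphi phiA _)).
  move=> y; apply: (le_trans (phiB y)); rewrite -mulrA -expRD.
  apply: ler_wpM2l => //; rewrite ler_expR -mulrDr ler_wpM2l//.
  have -> : x - y = c * t + (x - c * t - y) by ring.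
  by apply: (le_trans (ler_normD _ _)); rewrite normrM (ger0_norm t0).
rewrite exprMn sqr_sqrtr// le_eqVlt; apply/orP; left; apply/eqP.
rewrite -!mulrA -!expRD; congr (_ * (_ * expR _)); by field.
Qed.

Lemma sing_duh1 c (f : R -> R -> R) : continuous (fun p : R * R => f p.1 p.2) ->
  (forall T, exists C, forall s y, s <= T -> `|f s y| <= C) ->
  sing (duh1 c f).
Proof.
move=> cf fB; have sf : sing f := continuous_sing cf fB.
split; first exact: duh1_cont.
move=> T; have [C HC] := fB T.
have C0 : 0 <= C by apply: le_trans (HC T 0 (lexx T)).
have [D D0 HD] := @duh1_bounded R f c T C sf C0 (fun s y sT => HC s y (andP sT).2).
exists (Num.sqrt T * D) => s y sT; apply: ler_pM => //; last exact: HD.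
by apply: ler_wsqrtr; case/andP: sT.
Qed.

Lemma singD (f g : R -> R -> R) : sing f -> sing g -> sing (fun s y => f s y + g s y).
Proof.
move=> [cf fB] [cg gB]; split; first by move=> s y s0; apply: cvgD; [exact: cf|exact: cg].
move=> T; have [A HA] := fB T; have [B HB] := gB T; exists (A + B) => s y sT.
apply: (@le_trans _ _ (Num.sqrt s * `|f s y| + Num.sqrt s * `|g s y|)).
  by rewrite -mulrDr ler_wpM2l// ?sqrtr_ge0// ler_normD.
by apply: lerD; [exact: HA|exact: HB].
Qed.

Lemma singM (f g : R -> R -> R) B : jcont f -> (forall s y, `|f s y| <= B) ->
  sing g -> sing (fun s y => f s y * g s y).
Proof.
move=> cf fB [cg gB]; split; first by move=> s y s0; apply: cvgM; [exact: cf|exact: cg].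
move=> T; have [A HA] := gB T; exists (B * A) => s y sT.
by rewrite normrM mulrCA; apply: ler_pM => //; exact: HA.
Qed.

Lemma sing_bounded (f : R -> R -> R) B : jcont f -> (forall s y, `|f s y| <= B) -> sing f.
Proof.
move=> cf fB; split => // T; exists (Num.sqrt T * B) => s y /andP[_ sT].
by apply: ler_pM => //; exact: ler_wsqrtr.
Qed.

Lemma duhB c (f g : R -> R -> R) t x : sing f -> sing g -> 0 < t ->
  duh c (fun s y => f s y - g s y) t x = duh c f t x - duh c g t x.
Proof.
move=> sf sg' t0; have tt : 0 < t <= t by rewrite t0 lexx.
have [C1 C10 HC1] := duh_integrand_bound t sf (@gker0 R).
have [C2 C20 HC2] := duh_integrand_bound t sg' (@gker0 R).
have [A1 _ HA1] := sing_bound t sf; have [A2 _ HA2] := sing_bound t sg'.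
rewrite /duh -RintegralB//.
- apply: eq_Rintegral => th; rewrite inE itv01P => th01.
  have tr := tsg_range tt th01; have /andP[ts0 _] := tr.
  rewrite -mulrBr; congr (_ * _).
  rewrite /gop -RintegralB//; first by apply: eq_Rintegral => z _; rewrite mulrBr.
    exact: (gop_integrable _ _ (@gker0 R) (jcont_section sf.1 ts0) (fun y => HA1 _ y tr)).
  exact: (gop_integrable _ _ (@gker0 R) (jcont_section sg'.1 ts0) (fun y => HA2 _ y tr)).
- apply: (integrable01 (C := C1)) => th th01; last exact: HC1.
  by apply: (@duh_integrand_cont _ _ _ (fun=> t) (fun=> x) id); [exact: cvg_cst|exact: cvg_cst|exact: cvg_id|..] => //; exact: gker0.
- apply: (integrable01 (C := C2)) => th th01; last exact: HC2.
  by apply: (@duh_integrand_cont _ _ _ (fun=> t) (fun=> x) id); [exact: cvg_cst|exact: cvg_cst|exact: cvg_id|..] => //; exact: gker0.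
Qed.

(** The factor t serves to prove continuity of the Picard step at time 0. *)
Lemma duh_small : exists2 K : R, 0 <= K & forall c f A t x, sing f -> 0 < t ->
  (forall s y, 0 < s <= t -> `|f s y| <= A) -> `|duh c f t x| <= t * (K * A).
Proof.
have [K K0 HK] := gop_bound (@gker0 R).
exists (6 * K); first by rewrite mulr_ge0.
move=> c f A t x sf t0 fA; have tt : 0 < t <= t by rewrite t0 lexx.
apply: Rintegral01_le_cst => th th01.
  by apply: (@duh_integrand_cont _ _ _ (fun=> t) (fun=> x) id); [exact: cvg_cst|exact: cvg_cst|exact: cvg_id|..] => //; exact: gker0.
have [s0 s1 _ _ d0] := sg_bounds th01; have /andP[h0 h1] := th01.
have tr := tsg_range tt th01; have /andP[ts0 _] := tr.
have -> : t * (6 * K * A) = t * 6 * (K * A) by ring.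
rewrite normrM; apply: ler_pM => //.
  rewrite ger0_norm; last by rewrite mulr_ge0// ltW.
  by apply: ler_wpM2l; [exact: ltW|rewrite /dsg; nra].
by apply: HK => [|y]; [exact: jcont_section sf.1 ts0|exact: fA].
Qed.

Definition cont3 (g : R -> R -> R -> R) := forall x y z : R,
  {for ((x, y), z), continuous (fun p : R * R * R => g p.1.1 p.1.2 p.2)}.

Lemma cont3_cvg (g : R -> R -> R -> R) (T : Type) (F : set_system T) {FF : Filter F}
    (u v w : T -> R) (a b d : R) : cont3 g ->
  u x @[x --> F] --> a -> v x @[x --> F] --> b -> w x @[x --> F] --> d ->
  g (u x) (v x) (w x) @[x --> F] --> g a b d.
Proof.
move=> cg ua vb wd.
have H : ((u x, v x), w x) @[x --> F] --> (((a, b), d) : R * R * R).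
  exact: (cvg_pair (cvg_pair ua vb) wd).
by move=> A /(cg a b d) /H.
Qed.

Lemma geometric_cvg (u : nat -> R) (C : R) :
  (forall n, `|u n.+1 - u n| <= C / 2 ^+ n) ->
  exists l, forall n, `|l - u n| <= 2 * C / 2 ^+ n.
Proof.
move=> Hu.
have C0 : 0 <= C by have := le_trans (normr_ge0 _) (Hu 0%N); rewrite expr0 divr1.
have p2 n : 0 < 2 ^+ n :> R by rewrite exprn_gt0.
have key n k : `|u (n + k)%N - u n| <= 2 * C / 2 ^+ n - 2 * C / 2 ^+ (n + k).
  elim: k => [|k IH]; first by rewrite addn0 !subrr normr0.
  have -> : u (n + k.+1)%N - u n = (u (n + k).+1 - u (n + k)%N) + (u (n + k)%N - u n).
    by rewrite addnS; ring.
  apply: (le_trans (ler_normD _ _)); apply: (le_trans (lerD (Hu _) IH)).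
  rewrite addnS exprS.
  have := p2 (n + k)%N; set q := 2 ^+ (n + k) => q0.
  rewrite le_eqVlt; apply/orP; left; apply/eqP; field.
  by rewrite !gt_eqF// exprn_gt0.
have key2 n k : (n <= k)%N -> `|u k - u n| <= 2 * C / 2 ^+ n.
  move=> nk; rewrite -(subnKC nk); apply: (le_trans (key _ _)).
  by rewrite gerBl divr_ge0 ?mulr_ge0// ltW.
have lim0 : (2 * C / 2 ^+ n : R) @[n --> \oo] --> (0 : R).
  rewrite -[X in _ --> X](mulr0 (2 * C)); apply: cvgMr.
  under eq_fun do rewrite -exprVn.
  by apply: cvg_expr; rewrite ger0_norm ?invr_ge0// invf_lt1// ltr1n.
have cu : cvg (u n @[n --> \oo]).
  apply/cauchy_cvgP; apply: cauchy_exP => e e0.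
  have /cvgrPdist_lt/(_ e e0)[N _ HN] := lim0.
  have HNN := HN N (leqnn N); rewrite /= sub0r normrN in HNN.
  have NN : 2 * C / 2 ^+ N < e by apply: le_lt_trans HNN; exact: ler_norm.
  exists (u N); exists N => // k /= Nk; rewrite /ball /= distrC.
  exact: le_lt_trans (key2 _ _ Nk) NN.
have /cvg_ex[l ul] := cu.
exists l => n.
have D : `|u k - u n| @[k --> \oo] --> `|l - u n|.
  by apply: cvg_norm; apply: cvgB => //; exact: cvg_cst.
apply: (cvgr_to_le D); exists n => // k /= nk; exact: key2.
Qed.

End heat.

(** * Picard iteration *)

Section picard.
Context {R : realType}.

(** Freezes time at 0 for negative t, so that iterates are continuous on the whole plane and no
    boundary at t = 0 has to be treated apart. *)
Definition tpos (t : R) : R := Num.max t 0.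

Lemma tpos_ge0 t : 0 <= tpos t. Proof. by rewrite /tpos le_max lexx orbT. Qed.

Lemma tpos_id t : 0 <= t -> tpos t = t.
Proof. by move=> t0; apply/max_idPl. Qed.

Lemma tpos_neg t : t <= 0 -> tpos t = 0.
Proof. by move=> t0; apply/max_idPr. Qed.

Lemma continuous_tpos : continuous tpos.
Proof.
move=> t; rewrite /tpos.
by apply: (@continuous_max _ _ id (fun=> 0 : R)); [exact: cvg_id|exact: cvg_cst].
Qed.

Lemma le_half_pow_eq0 (x C : R) : (forall n, `|x| <= C / 2 ^+ n) -> x = 0.
Proof.
move=> H; apply/eqP; rewrite -normr_le0.
have l0 : (C / 2 ^+ n : R) @[n --> \oo] --> (0 : R).
  rewrite -[X in _ --> X](mulr0 C); apply: cvgMr.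
  under eq_fun do rewrite -exprVn.
  by apply: cvg_expr; rewrite ger0_norm ?invr_ge0// invf_lt1// ltr1n.
by apply: (cvgr_to_ge l0); apply: nearW => n; exact: H.
Qed.

Variables (c L0 L Mb K1 K2 : R) (N a0 a1 a2 : bool -> R -> R -> R -> R)
  (phi : bool -> R -> R) (m : R -> R).

Hypotheses (hK1 : 0 <= K1) (hK2 : 0 <= K2).
Hypothesis HK1 : forall c phi A B L t x, 0 <= L -> 0 <= t -> continuous phi ->
    (forall y, `|phi y| <= A) -> (forall y, `|phi y| <= B * expR (L * `|x - y|)) ->
    `|hs c phi t x| <= K1 * B * expR ((L * `|c| + 2 * L ^+ 2) * t).
Hypothesis HK2 : forall f c L B G t x, 0 <= L -> sing f -> 0 < t ->
    L * `|c| + 2 * L ^+ 2 < G ->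
    (forall s, 0 < s <= t -> exists A, forall y, `|f s y| <= A) ->
    (forall s y, 0 < s <= t -> `|f s y| <= B * expR (G * s) * expR (L * `|x - y|)) ->
    `|duh c f t x| <= K2 * B * expR (G * t) / (G - (L * `|c| + 2 * L ^+ 2)).
Hypotheses (hL0 : 0 <= L0) (hL : 0 <= L).
Hypothesis N_cont : forall i, cont3 (N i).
Hypothesis N_lip : forall i x w1 w2 v1 v2,
  `|N i x w1 w2 - N i x v1 v2| <= L0 * (`|w1 - v1| + `|w2 - v2|).
Hypothesis N_0 : forall i x, N i x 0 0 = 0.
Hypothesis phi_cont : forall i, continuous (phi i).
Hypothesis phi_m : forall i y, `|phi i y| <= m y.
Hypothesis m_le : forall y, m y <= Mb.
Hypothesis m_log : forall x y, m y <= m x * expR (L * `|x - y|).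

Let G0 := L * `|c| + 2 * L ^+ 2.
(** [G0] is the growth rate of the semigroup on functions of logarithmic slope [L]. The summand 4 K2
    L0 gives the Duhamel term the contraction factor 1/2, and 1 keeps the denominator G - G0
    positive. *)
Let G := G0 + 4 * K2 * L0 + 1.

Let m_ge0 y : 0 <= m y.
Proof. exact: le_trans (phi_m true y). Qed.

Let G_gt0 : 0 < G.
Proof. by rewrite /G /G0 ltr_wpDl// !addr_ge0 ?mulr_ge0// sqr_ge0. Qed.

Definition pic_f (W : bool -> R -> R -> R) i s y := N i y (W true s y) (W false s y).

Definition pic_step (W : bool -> R -> R -> R) i t x :=
  hs c (phi i) (tpos t) x + duh c (pic_f W i) (tpos t) x.

(** The bound by a multiple of [m], and not by a constant, is what preserves decay at infinity: [m]
    will be an envelope of the datum that still vanishes against the weight. *)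
Definition pic_good B (W : bool -> R -> R -> R) :=
  [/\ 0 <= B, forall i, continuous (fun p : R * R => W i p.1 p.2) &
    forall i t x, `|W i t x| <= B * expR (G * tpos t) * m x].

Lemma pic_f_cont B W i : pic_good B W -> continuous (fun p : R * R => pic_f W i p.1 p.2).
Proof.
move=> [_ cW _] [s y]; rewrite /pic_f.
apply: (@cont3_cvg _ (N i) _ (nbhs ((s, y) : R * R)) _ snd (fun p => W true p.1 p.2)
  (fun p => W false p.1 p.2) y (W true s y) (W false s y) (@N_cont i)); [exact: cvg_snd|exact: (cW true (s, y))|exact: (cW false (s, y))].
Qed.

Lemma pic_f_le B W i s y : pic_good B W ->
  `|pic_f W i s y| <= 2 * L0 * B * expR (G * tpos s) * m y.
Proof.
move=> [_ _ WB]; rewrite /pic_f.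
have := N_lip i y (W true s y) (W false s y) 0 0; rewrite N_0 !subr0.
move=> /le_trans; apply.
have -> : 2 * L0 * B * expR (G * tpos s) * m y = L0 * (B * expR (G * tpos s) * m y + B * expR (G * tpos s) * m y) by ring.
by apply: ler_wpM2l => //; apply: lerD.
Qed.

Lemma pic_f_bounded B W i T : pic_good B W ->
  exists C, forall s y, s <= T -> `|pic_f W i s y| <= C.
Proof.
move=> gW; exists (2 * L0 * B * expR (G * tpos T) * Mb) => s y sT.
have [B0 _ _] := gW.
apply: (le_trans (pic_f_le i s y gW)).
apply: ler_pM => //; first by rewrite !mulr_ge0// expR_ge0.
apply: ler_wpM2l; first by rewrite !mulr_ge0.
rewrite ler_expR; apply: ler_wpM2l; first exact: ltW.
by rewrite /tpos le_max2 .
Qed.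

Lemma pic_f_sing B W i : pic_good B W -> sing (pic_f W i).
Proof.
move=> gW; apply: continuous_sing; first exact: pic_f_cont gW.
by move=> T; exact: pic_f_bounded gW.
Qed.

Lemma duh_m_bound f D t x : sing f -> 0 <= t ->
  (forall s y, 0 < s <= t -> `|f s y| <= 2 * L0 * D * expR (G * s) * m y) -> 0 <= D ->
  `|duh c f t x| <= D / 2 * expR (G * t) * m x.
Proof.
move=> sf t0 fD D0.
have [->|tn0] := eqVneq t 0.
  by rewrite duh_t0 normr0 !mulr_ge0// ?divr_ge0// expR_ge0.
have {tn0}t0 : 0 < t by rewrite lt_neqAle eq_sym tn0.
have GG : G0 < G by rewrite /G; have := mulr_ge0 hK2 hL0; lra.
apply: (le_trans (HK2 (B := 2 * L0 * D * m x) hL sf t0 GG _ _)).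
- move=> s st; exists (2 * L0 * D * expR (G * s) * Mb) => y.
  apply: (le_trans (fD s y st)); apply: ler_wpM2l => //.
  by rewrite !mulr_ge0// expR_ge0.
- move=> s y st; apply: (le_trans (fD s y st)).
  have -> : 2 * L0 * D * m x * expR (G * s) * expR (L * `|x - y|) =
     2 * L0 * D * expR (G * s) * (m x * expR (L * `|x - y|)) by ring.
  by apply: ler_wpM2l => //; rewrite !mulr_ge0// expR_ge0.
rewrite -/G0 ler_pdivrMr; last by rewrite subr_gt0.
have k0 := mulr_ge0 hK2 hL0.
have X0 : 0 <= D * m x * expR (G * t) by rewrite !mulr_ge0// expR_ge0.
rewrite /G; set X := D * m x * _ in X0 *.
rewrite [leLHS](_ : _ = 2 * (K2 * L0) * X); last by rewrite /X; ring.
rewrite [leRHS](_ : _ = 2 * (K2 * L0) * X + X / 2); last by rewrite /X; field.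
by rewrite lerDl divr_ge0.
Qed.

Lemma pic_step_dist B B' W V D : pic_good B W -> pic_good B' V -> 0 <= D ->
  (forall i s y, `|W i s y - V i s y| <= D * expR (G * tpos s) * m y) ->
  forall i t x, `|pic_step W i t x - pic_step V i t x| <= D / 2 * expR (G * tpos t) * m x.
Proof.
move=> gW gV D0 WV i t x.
have sW := pic_f_sing i gW; have sV := pic_f_sing i gV.
rewrite /pic_step opprD addrACA subrr add0r.
have [t0|t0] := leP t 0.
  by rewrite tpos_neg// !duh_t0 subrr normr0 !mulr_ge0 ?divr_ge0// expR_ge0.
have tE : tpos t = t by rewrite tpos_id// ltW.
rewrite tE -duhB//.
have sD : sing (fun s y => pic_f W i s y - pic_f V i s y).
  split; first by move=> s y s0; apply: cvgB; [exact: sW.1|exact: sV.1].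
  move=> T; have [A HA] := sW.2 T; have [A' HA'] := sV.2 T; exists (A + A') => s y sT.
  apply: (@le_trans _ _ (Num.sqrt s * `|pic_f W i s y| + Num.sqrt s * `|pic_f V i s y|)).
    by rewrite -mulrDr ler_wpM2l// ?sqrtr_ge0// ler_normB.
  by apply: lerD; [exact: HA|exact: HA'].
apply: (duh_m_bound x sD (ltW t0) _ D0) => s y /andP[s0 st].
apply: (le_trans (N_lip _ _ _ _ _ _)).
have -> : 2 * L0 * D * expR (G * s) * m y = L0 * (D * expR (G * s) * m y + D * expR (G * s) * m y) by ring.
apply: ler_wpM2l => //.
have H i' := WV i' s y; rewrite (tpos_id (ltW s0)) in H.
by apply: lerD; exact: H.
Qed.

Lemma pic_step_cont B W i : pic_good B W ->
  continuous (fun p : R * R => pic_step W i p.1 p.2).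
Proof.
move=> gW [t x]; have sW := pic_f_sing i gW.
have ct : tpos p.1 @[p --> ((t, x) : R * R)] --> tpos t.
  by apply: cvg_fun; [exact: continuous_tpos|exact: cvg_fst].
apply: cvgD.
  have phiM y : `|phi i y| <= Mb := le_trans (phi_m i y) (m_le y).
  exact: (@hs_gop_cvg R c Mb (phi i) (@phi_cont i) phiM _ ((t, x) : R * R) gh0
    (fun p => tpos p.1) snd (@gker0 R) ct cvg_snd).
(* The Duhamel term is jointly continuous for positive times only; at t <= 0 it vanishes, and nearby
   it is at most a constant times [tpos]. *)
have [t0|t0] := leP t 0; last first.
  have E : tpos t = t by rewrite tpos_id// ltW.
  rewrite -E in t0.
  exact: (@jcont_cvg _ _ _ _ (duh c (pic_f W i)) (fun p => tpos p.1) snd _ _ (duh_cont sW t0) ct cvg_snd).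
rewrite /= tpos_neg// duh_t0.
have [K K0 HK] := @duh_small R.
have [C HC] := pic_f_bounded i 1 gW.
apply: norm_cvg0.
have U : tpos p.1 * (K * C) @[p --> ((t, x) : R * R)] --> (0 : R).
  by rewrite -(mul0r (K * C)) -(tpos_neg t0); apply: cvgMl.
apply: squeeze_cvgr (cvg_cst 0) U.
near=> p; rewrite normr_ge0 /=.
have [p0|p0] := leP p.1 0; first by rewrite tpos_neg// duh_t0 normr0 mul0r.
have -> : tpos p.1 = p.1 by rewrite tpos_id// ltW.
apply: HK => // s y /andP[_ sp]; apply: HC; apply: (le_trans sp).
near: p; apply: (cvgr_le t); first exact: cvg_fst.
by apply: le_lt_trans t0 _.
Unshelve. all: end_near. Qed.

(** The semigroup contributes K1 and the Duhamel term B / 2; their sum stays below B as soon as B >=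
    2 K1. *)
Lemma pic_step_good B W : pic_good B W -> 2 * K1 <= B -> pic_good B (pic_step W).
Proof.
move=> gW KB; have [B0 _ _] := gW; split => //; first by move=> i; exact: pic_step_cont gW.
move=> i t x; apply: (le_trans (ler_normD _ _)).
have H1 : `|hs c (phi i) (tpos t) x| <= K1 * expR (G * tpos t) * m x.
  apply: (le_trans (@HK1 c (phi i) Mb (m x) L (tpos t) x hL (tpos_ge0 t) (@phi_cont i) _ _)).
  - by move=> y; exact: le_trans (phi_m i y) (m_le y).
  - by move=> y; exact: le_trans (phi_m i y) (m_log x y).
  rewrite mulrAC; apply: ler_wpM2r => //; apply: ler_wpM2l => //.
  rewrite ler_expR; apply: ler_wpM2r; first exact: tpos_ge0.
  by rewrite -/G0 /G; have := mulr_ge0 hK2 hL0; lra.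
have H2 : `|duh c (pic_f W i) (tpos t) x| <= B / 2 * expR (G * tpos t) * m x.
  apply: duh_m_bound => //; [exact: pic_f_sing gW|exact: tpos_ge0|].
  move=> s y /andP[s0 _]; have := pic_f_le i s y gW.
  by rewrite (tpos_id (ltW s0)).
apply: (le_trans (lerD H1 H2)).
have X0 : 0 <= expR (G * tpos t) * m x by rewrite mulr_ge0// expR_ge0.
have KB' : K1 + B / 2 <= B by lra.
have := ler_wpM2r X0 KB'; lra.
Qed.

Fixpoint pic n : bool -> R -> R -> R :=
  if n is n'.+1 then pic_step (pic n') else fun _ _ _ => 0.

Lemma pic_n_good n : pic_good (2 * K1) (pic n).
Proof.
elim: n => [|n IH]; last exact: pic_step_good.
split; first exact: mulr_ge0.
  by move=> i p; exact: cvg_cst.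
by move=> i t x /=; rewrite normr0 !mulr_ge0// expR_ge0.
Qed.

Lemma pic_dist n i t x :
  `|pic n.+1 i t x - pic n i t x| <= 2 * K1 / 2 ^+ n * expR (G * tpos t) * m x.
Proof.
elim: n i t x => [|n IH] i t x.
  rewrite expr0 divr1 subr0.
  by have [_ _] := pic_n_good 1; apply.
rewrite exprSr invfM mulrA.
apply: (pic_step_dist (pic_n_good n.+1) (pic_n_good n)) => //.
by rewrite divr_ge0 ?mulr_ge0// exprn_ge0.
Qed.

Lemma pic_limit : exists W, forall n i t x,
  `|W i t x - pic n i t x| <= 4 * K1 / 2 ^+ n * expR (G * tpos t) * m x.
Proof.
have H (q : bool * R * R) : exists l, forall n,
  `|l - pic n q.1.1 q.1.2 q.2| <= 4 * K1 / 2 ^+ n * expR (G * tpos q.1.2) * m q.2.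
  have [n|l Hl] := @geometric_cvg R (fun n => pic n q.1.1 q.1.2 q.2) (2 * K1 * expR (G * tpos q.1.2) * m q.2).
    by apply: (le_trans (pic_dist n _ _ _)); rewrite le_eqVlt; apply/orP; left; apply/eqP; ring.
  exists l => n; apply: (le_trans (Hl n)); rewrite le_eqVlt; apply/orP; left; apply/eqP; ring.
have [W HW] := choice H.
by exists (fun i t x => W (i, t, x)) => n i t x; exact: HW (i, t, x) n.
Qed.

(** The geometric bound is uniform in x and on bounded time intervals, so the limit inherits
    continuity. The defect of the fixed point equation is at most C / 2^n for every n, hence
    zero. *)
Lemma pic_fixed_point : exists W, pic_good (4 * K1) W /\
  forall i t x, W i t x = pic_step W i t x.
Proof.
have [W HW] := pic_limit.
have K4 : 0 <= 4 * K1 by rewrite mulr_ge0.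
have gW : pic_good (4 * K1) W.
  split => //; last first.
    by move=> i t x; have := HW 0%N i t x; rewrite /= subr0 expr0 divr1.
  move=> i [t x]; apply/cvgrPdist_lt => e e0.
  pose C := 4 * K1 * expR (G * (tpos t + 1)) * Mb.
  have C0 : 0 <= C by rewrite !mulr_ge0 ?expR_ge0//; exact: le_trans (m_ge0 0) (m_le 0).
  have l0 : (C / 2 ^+ n : R) @[n --> \oo] --> (0 : R).
    rewrite -[X in _ --> X](mulr0 C); apply: cvgMr.
    under eq_fun do rewrite -exprVn.
    by apply: cvg_expr; rewrite ger0_norm ?invr_ge0// invf_lt1// ltr1n.
  have e3 : 0 < e / 3 by rewrite divr_gt0.
  have /cvgrPdist_lt/(_ _ e3)[n _ Hn] := l0.
  have {}Hn : C / 2 ^+ n < e / 3.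
    have := Hn n (leqnn n); rewrite /= sub0r normrN; apply: le_lt_trans; exact: ler_norm.
  have Hu s y : tpos s <= tpos t + 1 -> `|W i s y - pic n i s y| < e / 3.
    move=> st; apply: le_lt_trans Hn; apply: (le_trans (HW n i s y)).
    have E1 : expR (G * tpos s) * m y <= expR (G * (tpos t + 1)) * Mb.
      by apply: ler_pM; rewrite ?expR_ge0// ler_expR ler_wpM2l// ltW.
    have D0 : 0 <= 4 * K1 / 2 ^+ n by rewrite divr_ge0// exprn_ge0.
    by have := ler_wpM2l D0 E1; rewrite /C; lra.
  have [_ cn _] := pic_n_good n.
  have /cvgrPdist_lt/(_ _ e3) Hc := cn i (t, x).
  have ct : tpos p.1 @[p --> ((t, x) : R * R)] --> tpos t.
    by apply: cvg_fun; [exact: continuous_tpos|exact: cvg_fst].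
  near=> p.
  have p1 : tpos p.1 <= tpos t + 1.
    by near: p; apply: (cvgr_le (tpos t)) => //; rewrite ltrDl.
  have p2 : `|pic n i t x - pic n i p.1 p.2| < e / 3 by near: p; exact: Hc.
  have := Hu t x (ltW _); rewrite ltrDl => /(_ ltr01) u1.
  have u2 := Hu p.1 p.2 p1.
  rewrite /=.
  have -> : W i t x - W i p.1 p.2 = (W i t x - pic n i t x) +
    ((pic n i t x - pic n i p.1 p.2) - (W i p.1 p.2 - pic n i p.1 p.2)) by ring.
  apply: (le_lt_trans (ler_normD _ _)).
  have := ler_normB (pic n i t x - pic n i p.1 p.2) (W i p.1 p.2 - pic n i p.1 p.2).
  lra.
exists W; split => // i t x.
apply/eqP; rewrite -subr_eq0; apply/eqP.
apply: (@le_half_pow_eq0 _ (4 * K1 * expR (G * tpos t) * m x)) => n.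
have -> : W i t x - pic_step W i t x = (W i t x - pic n.+1 i t x) -
   (pic_step W i t x - pic_step (pic n) i t x) by rewrite opprB addrA subrK.
apply: (le_trans (ler_normB _ _)).
have D0 : 0 <= 4 * K1 / 2 ^+ n by rewrite divr_ge0// exprn_ge0.
have H1 := pic_step_dist gW (pic_n_good n) D0 (HW n) i t x.
have H2 := HW n.+1 i t x.
apply: (le_trans (lerD H2 H1)).
rewrite exprS le_eqVlt; apply/orP; left; apply/eqP; field.
by rewrite gt_eqF// exprn_gt0.
Unshelve. all: end_near. Qed.

Hypotheses (a0_cont : forall i, cont3 (a0 i)) (a1_cont : forall i, cont3 (a1 i))
  (a2_cont : forall i, cont3 (a2 i)).
Variable Ca : R.
Hypotheses (a0_le : forall i x u v, `|a0 i x u v| <= Ca)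
  (a1_le : forall i x u v, `|a1 i x u v| <= Ca)
  (a2_le : forall i x u v, `|a2 i x u v| <= Ca).
Hypothesis N_der : forall i (u v : R -> R) (x p q : R),
  is_derive x 1 u p -> is_derive x 1 v q ->
  is_derive x 1 (fun y => N i y (u y) (v y))
    (a0 i x (u x) (v x) + a1 i x (u x) (v x) * p + a2 i x (u x) (v x) * q).

Lemma pic_classical : exists W P Q : bool -> R -> R -> R,
  [/\ pic_good (4 * K1) W, forall i x, W i 0 x = phi i x,
      forall i, jcont (P i), forall i, jcont (Q i) &
      forall i (t x : R), 0 < t ->
       [/\ is_derive x 1 (W i t) (P i t x), is_derive x 1 (P i t) (Q i t x) &
           is_derive t 1 (fun t => W i t x)
             (Q i t x - c * P i t x + N i x (W true t x) (W false t x))]].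
Proof.
have [W [gW WE]] := pic_fixed_point.
have sW i := pic_f_sing i gW.
have cf i := @pic_f_cont _ _ i gW.
have bf i T := pic_f_bounded i T gW.
have phiM i y : `|phi i y| <= Mb by exact: le_trans (phi_m i y) (m_le y).
have Wt i t x : 0 < t -> W i t x = hs c (phi i) t x + duh c (pic_f W i) t x.
  by move=> t0; rewrite WE /pic_step tpos_id// ltW.
pose P i t x := hs1 c (phi i) t x + duh1 c (pic_f W i) t x.
have sP i : sing (P i).
  by apply: singD; [exact: sing_hs1 (@phi_cont i) (phiM i)|exact: sing_duh1 (cf i) (bf i)].
have DW i (t x : R) : 0 < t -> is_derive x 1 (W i t) (P i t x).
  move=> t0; have E : W i t = (fun x => hs c (phi i) t x + duh c (pic_f W i) t x).
    by apply/funext => y; exact: Wt.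
  have D1 := is_derive_hs_x c (@phi_cont i) (phiM i) x t0.
  have D2 := is_derive_duh c x (sW i) t0.
  by rewrite E; apply: is_derive_eq.
pose f' i s y := a0 i y (W true s y) (W false s y) + a1 i y (W true s y) (W false s y) * P true s y
   + a2 i y (W true s y) (W false s y) * P false s y.
have [_ cW _] := gW.
have ja (a : bool -> R -> R -> R -> R) i : (forall i, cont3 (a i)) -> jcont (fun s y => a i y (W true s y) (W false s y)).
  move=> ca s y _.
  apply: (@cont3_cvg _ (a i) _ (nbhs ((s, y) : R * R)) _ snd (fun p => W true p.1 p.2)
    (fun p => W false p.1 p.2) y (W true s y) (W false s y) (ca i)); [exact: cvg_snd|exact: (cW true (s, y))|exact: (cW false (s, y))].
have sf' i : sing (f' i).
  apply: singD; first apply: singD.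
  - exact: sing_bounded (ja a0 i a0_cont) (fun s y => a0_le i y _ _).
  - exact: singM (ja a1 i a1_cont) (fun s y => a1_le i y _ _) (sP true).
  - exact: singM (ja a2 i a2_cont) (fun s y => a2_le i y _ _) (sP false).
have Df i (s y : R) : 0 < s -> is_derive y 1 (pic_f W i s) (f' i s y).
  by move=> s0; apply: N_der; exact: DW.
have dE i t x : 0 < t -> duh1 c (pic_f W i) t x = duh c (f' i) t x.
  by move=> t0; apply: duh1_duh.
pose Q i t x := hs2 c (phi i) t x + duh1 c (f' i) t x.
exists W, P, Q; split => //.
- move=> i x; rewrite WE /pic_step tpos_neg// duh_t0 addr0; exact: hs_init.
- by move=> i; have [] := sP i.
- move=> i t x t0; apply: cvgD; first exact: jcont_hs2 (@phi_cont i) (phiM i) _ _ t0.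
  exact: duh1_cont (sf' i) _ _ t0.
- move=> i t x t0; split; first exact: DW.
    have E : P i t = (fun x => hs1 c (phi i) t x + duh c (f' i) t x).
      by apply/funext => y; rewrite /P dE.
    have D1 := is_derive_hs1_x c (@phi_cont i) (phiM i) x t0.
    have D2 := is_derive_duh c x (sf' i) t0.
    by rewrite E; apply: is_derive_eq.
  apply: (@near_eq_is_derive _ _ _ (fun t => hs c (phi i) t x + duh c (pic_f W i) t x)).
    near=> u; rewrite Wt//; near: u; exact: lt_nbhsr.
  have D1 := is_derive_hs_t c (@phi_cont i) (phiM i) x t0.
  have D2 := is_derive_duh_t c (cf i) (bf i) (Df i) (sf' i) x t0.
  apply: is_derive_eq.
  by rewrite /P /Q dE// /pic_f; ring.
Unshelve. all: end_near. Qed.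

End picard.

(** * Maximum principle *)

Section max_principle.
Context {R : realType}.

Lemma is_derive_left_max (g : R -> R) (s dg : R) : is_derive s 1 g dg ->
  (exists2 d, 0 < d & forall t, s - d < t < s -> g t <= g s) -> 0 <= dg.
Proof.
move=> Dg [d d0 H]; rewrite leNgt; apply/negP => dg0.
have /is_derive1_caratheodory [h [h1 h2 h3]] := Dg.
have dg0' : 0 < - dg by rewrite oppr_gt0.
have /cvgrPdist_lt/(_ _ dg0')/nbhs_ballP[d1 /= d10 Hd1] := h2.
rewrite h3 in Hd1.
pose r := Num.min d d1 / 2.
have m0 : 0 < Num.min d d1 by rewrite lt_min d0 d10.
have r0 : 0 < r by rewrite divr_gt0.
have rd : r < d by apply: (@lt_le_trans _ _ (Num.min d d1)); [rewrite /r; lra|rewrite ge_min lexx].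
have rd1 : r < d1 by apply: (@lt_le_trans _ _ (Num.min d d1)); [rewrite /r; lra|rewrite ge_min lexx orbT].
have := H (s - r); have -> : s - d < s - r < s by apply/andP; split; lra.
move=> /(_ isT) gs.
have hs : h (s - r) < 0.
  have : `|dg - h (s - r)| < - dg.
    by apply: Hd1; rewrite /ball /= opprB addrC subrK ger0_norm// ltW.
  by rewrite ltr_norml => /andP[]; lra.
have := h1 (s - r).
have -> : s - r - s = - r by ring.
have : 0 < h (s - r) * - r by rewrite nmulr_rgt0// oppr_lt0.
lra.
Qed.

(* Supersolutions are used where they are only minima of smooth functions: it is
   enough to have, at each point, a local C^2 majorant touching phi there. *)
Definition touch (c : R) (phi : R -> R) (x0 A : R) : Prop :=
  exists (psi dpsi : R -> R) (dd d : R),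
  [/\ 0 < d, forall x : R, `|x - x0| < d -> is_derive x 1 psi (dpsi x),
      is_derive x0 1 dpsi dd, psi x0 = phi x0 &
      (forall x, `|x - x0| < d -> phi x <= psi x) /\ dd - c * dpsi x0 <= A].

(** Far out [rho] |w| tends to 0 while [rho] phi stays above kap, so |w| is below half of the bound
    there; on the remaining compact interval the continuous quotient |w| / phi attains a maximum
    below L. *)
Lemma C0_gap (w phi : R -> R) (rho : R -> R) (kap L : R) :
  0 < L -> 0 < kap -> continuous w -> continuous phi -> (forall x, 0 < phi x) ->
  (forall x, kap <= rho x * phi x) ->
  (rho x * `|w x| @[x --> +oo] --> (0 : R)) -> (rho x * `|w x| @[x --> -oo] --> (0 : R)) ->
  (forall x, `|w x| < L * phi x) ->
  exists2 e, 0 < e & forall x, `|w x| <= (L - e) * phi x.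
Proof.
move=> L0 kap0 cw cphi phi0 rphi wp wm wL.
have e0 : 0 < L * kap / 2 by rewrite divr_gt0// mulr_gt0.
have /cvgrPdist_lt/(_ _ e0)[A [_ HA]] := wp.
have /cvgrPdist_lt/(_ _ e0)[B [_ HB]] := wm.
have far x : A < x \/ x < B -> `|w x| <= (L - L / 2) * phi x.
  move=> Hx.
  have H1 : rho x * `|w x| < L * kap / 2.
    by case: Hx => [/HA|/HB]; rewrite sub0r normrN; apply: le_lt_trans; exact: ler_norm.
  have r1 := rphi x; have p0 := phi0 x.
  have rr : 0 < rho x by rewrite -(pmulr_lgt0 _ p0); exact: lt_le_trans r1.
  have -> : L - L / 2 = L / 2 by field.
  rewrite -(ler_pM2l rr) (le_trans (ltW H1))//.
  have := ler_wpM2l (ltW L0) r1; lra.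
pose q x := `|w x| / phi x.
pose A' := Num.max A B + 1; pose B' := Num.min A B - 1.
have BA : B' <= A' by rewrite /A' /B'; case: (leP A B) => h; lra.
have cq : continuous q.
  move=> x; apply: cvgM; first by apply: cvg_norm; exact: cw.
  by apply: cvgV; [rewrite gt_eqF|exact: cphi].
have [z _ Hz] := EVT_max BA (continuous_subspaceT cq).
have qz : q z < L by rewrite /q ltr_pdivrMr.
exists (Num.min (L / 2) (L - q z)).
  by rewrite lt_min divr_gt0//= subr_gt0.
move=> x; have [xI|xI] := boolP (x \in `[B', A']%R).
  apply: (@le_trans _ _ (q z * phi x)).
    by rewrite -ler_pdivrMr//; exact: Hz.
  apply: ler_wpM2r; first exact: ltW.
  have : Num.min (L / 2) (L - q z) <= L - q z by rewrite ge_min lexx orbT.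
  lra.
apply: (@le_trans _ _ ((L - L / 2) * phi x)).
  apply: far; move: xI; rewrite in_itv /= negb_and -!ltNge /A' /B'.
  by case: (leP A B) => h /orP[] h'; (try (left; lra)); (try (right; lra)).
apply: ler_wpM2r; first exact: ltW.
by rewrite lerD2l lerN2 ge_min lexx.
Qed.

Variables (c kap eta ell ell0 kappa t1 : R) (rho : R -> R) (Phi : bool -> R -> R)
  (S : bool -> R -> R) (W Wt P Q Rr : bool -> R -> R -> R).

Hypotheses (kap0 : 0 < kap) (cPhi : forall i, continuous (Phi i))
  (Phi0 : forall i x, 0 < Phi i x) (rho0 : forall x, 0 < rho x)
  (rPhi : forall i x, kap <= rho x * Phi i x)
  (tPhi : forall i x, touch c (Phi i) x (S i x)).
Hypotheses
  (W_t : forall i (t x : R), 0 < t <= t1 -> is_derive t 1 (fun t => W i t x) (Wt i t x))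
  (W_x : forall i (t x : R), 0 < t <= t1 -> is_derive x 1 (W i t) (P i t x))
  (W_xx : forall i (t x : R), 0 < t <= t1 -> is_derive x 1 (P i t) (Q i t x))
  (W_pde : forall i t x, 0 < t <= t1 -> Wt i t x = Q i t x - c * P i t x + Rr i t x).
Hypotheses
  (W_cont : forall i t, 0 <= t <= t1 -> continuous (W i t))
  (W_p : forall i t, 0 <= t <= t1 -> rho x * `|W i t x| @[x --> +oo] --> (0 : R))
  (W_m : forall i t, 0 <= t <= t1 -> rho x * `|W i t x| @[x --> -oo] --> (0 : R))
  (W_unif : forall t0 e, 0 <= t0 <= t1 -> 0 < e -> exists2 d, 0 < d &
     forall i t x, 0 <= t <= t1 -> `|t - t0| < d -> rho x * `|W i t x - W i t0 x| <= e).
Hypothesis W_touch : forall i t x th (s : R), 0 < t <= t1 -> 0 < th <= eta ->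
  (forall j, `|W j t x| <= th * Phi j x) -> s = 1 \/ s = -1 -> s * W i t x = th * Phi i x ->
  s * Rr i t x + th * S i x < kappa * th * Phi i x.
Hypotheses (ell_lt : ell0 < ell) (ell_0 : 0 <= ell0)
  (W_init : forall i x, `|W i 0 x| <= ell0 * Phi i x)
  (ell_eta : forall t, 0 <= t <= t1 -> ell * expR (kappa * t) <= eta).

Let lev t := ell * expR (kappa * t).
Let ok t := forall i x, `|W i t x| <= lev t * Phi i x.

Let lev_gt0 t : 0 < lev t.
Proof. by rewrite mulr_gt0 ?expR_gt0// (le_lt_trans ell_0). Qed.

Let lev_cont : continuous lev.
Proof.
move=> t; apply: cvgMr; apply: (cvg_fun (h := expR)); first exact: continuous_expR.
by apply: cvgMr; exact: cvg_id.
Qed.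

(** Openness of the strict bound: half of the gap e covers the variation of the level, the other
    half the variation of [W], which is uniform in x against [rho]. *)
Lemma mp_strict_extends s : 0 <= s <= t1 ->
  (forall i x, `|W i s x| < lev s * Phi i x) ->
  exists2 d, 0 < d & forall t, 0 <= t <= t1 -> `|t - s| < d -> ok t.
Proof.
move=> s01 Hs.
have gap i := C0_gap (lev_gt0 s) kap0 (@W_cont i s s01) (@cPhi i) (@Phi0 i) (@rPhi i)
  (@W_p i s s01) (@W_m i s s01) (Hs i).
have [e1 e10 He1] := gap true; have [e2 e20 He2] := gap false.
pose e := Num.min e1 e2.
have e0 : 0 < e by rewrite lt_min e10 e20.
have He i x : `|W i s x| <= (lev s - e) * Phi i x.
  case: i.
    apply: (le_trans (He1 x)); apply: ler_wpM2r; first exact: ltW.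
    by rewrite lerD2l lerN2 ge_min lexx.
  apply: (le_trans (He2 x)); apply: ler_wpM2r; first exact: ltW.
  by rewrite lerD2l lerN2 ge_min lexx orbT.
have ek : 0 < e / 2 * kap by rewrite mulr_gt0// divr_gt0.
have [d d0 Hd] := W_unif s01 ek.
have e2' : 0 < e / 2 by rewrite divr_gt0.
have /cvgrPdist_lt/(_ _ e2')/nbhs_ballP[d1 /= d10 Hd1] := @lev_cont s.
exists (Num.min d d1); first by rewrite lt_min d0 d10.
move=> t t01; rewrite lt_min => /andP[td td1] i x.
have l1 : lev s - e / 2 < lev t.
  by have := Hd1 t; rewrite /ball /= distrC => /(_ td1); rewrite ltr_norml => /andP[]; lra.
have h1 : `|W i t x - W i s x| <= e / 2 * Phi i x.
  have h2 := Hd i t x t01 td; have r1 := rPhi i x.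
  rewrite -(ler_pM2l (rho0 x)) (le_trans h2)//.
  by have := ler_wpM2l (ltW e2') r1; lra.
have -> : W i t x = W i s x + (W i t x - W i s x) by ring.
apply: (le_trans (ler_normD _ _)); apply: (le_trans (lerD (He i x) h1)).
rewrite -mulrDl; apply: ler_wpM2r; first exact: ltW.
lra.
Qed.

(** Let s be the infimum of the times at which the bound fails. Strictness at s would propagate
    beyond s, and left limits keep the weak bound at s, so equality holds at some point. There the
    time derivative of |W| is at least that of the level, while the touching majorant bounds the
    space terms, contradicting [W_touch]. *)
Lemma max_principle t i x : 0 <= t <= t1 -> `|W i t x| <= ell * expR (kappa * t) * Phi i x.
Proof.
move=> t01; apply: contrapT => Hbad.
pose B := [set t | 0 <= t <= t1 /\ ~ ok t].
have Bt : B t by split => // Hok; apply: Hbad; exact: Hok.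
have hB : has_inf B by split; [exists t|exists 0 => u [/andP[]]].
set s := inf B.
have s0 : 0 <= s by apply: lb_le_inf; [exists t|move=> u [/andP[]]].
have st : s <= t by apply: ge_inf => //; exists 0 => u [/andP[]].
have s01 : 0 <= s <= t1 by rewrite s0 (le_trans st)//; case/andP: t01.
have okl u : 0 <= u -> u < s -> ok u.
  move=> u0 us; apply: contrapT => Hu.
  have : s <= u.
    apply: ge_inf; first by exists 0 => v [/andP[]].
    by split => //; rewrite u0 (le_trans (ltW us))//; case/andP: s01.
  by rewrite leNgt us.
have nstrict : ~ (forall i x, `|W i s x| < lev s * Phi i x).
  move=> /(mp_strict_extends s01)[d d0 Hd].
  have [u [u01 nu] us] := inf_adherent d0 hB.
  have su : s <= u by apply: ge_inf; [exists 0 => v [/andP[]]|].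
  apply: nu; apply: Hd => //.
  by rewrite ger0_norm ?subr_ge0// ltrBlDl.
have sp : 0 < s.
  rewrite lt_neqAle s0 andbT; apply/eqP => s0'; apply: nstrict => j y.
  rewrite -s0' /lev mulr0 expR0 mulr1.
  by apply: (le_lt_trans (W_init j y)); rewrite ltr_pM2r.
have oks : ok s.
  move=> j y; have [D _] := W_t j y (introT andP (conj sp (andP s01).2)).
  have cW : W j u y @[u --> s] --> W j s y.
    by apply: (@differentiable_continuous _ _ _ s (fun u => W j u y)); exact/derivable1_diffP.
  have C1 : lev u * Phi j y - `|W j u y| @[u --> s^'-] --> lev s * Phi j y - `|W j s y|.
    apply: cvg_at_left_filter; apply: cvgB; last exact: cvg_norm.
    by apply: cvgMl; exact: lev_cont.
  rewrite -subr_ge0; apply: (cvgr_to_ge C1).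
  near=> u; rewrite subr_ge0; apply: okl; near: u; last exact: nbhs_left_lt.
  by apply: nbhs_left_ge.
have [j [y Hjy]] : exists j y, `|W j s y| = lev s * Phi j y.
  apply: contrapT => Hn; apply: nstrict => j y; rewrite lt_neqAle oks andbT.
  by apply/eqP => E; apply: Hn; exists j, y.
have [sgn [hs hW]] : exists sgn : R, (sgn = 1 \/ sgn = -1) /\ sgn * W j s y = `|W j s y|.
  have [w0|w0] := leP 0 (W j s y).
    by exists 1; split; [left|rewrite mul1r ger0_norm].
  by exists (-1); split; [right|rewrite mulN1r ltr0_norm].
have sgnle z u : sgn * W j u z <= `|W j u z|.
  by case: hs => ->; rewrite ?mul1r ?mulN1r; [exact: ler_norm|rewrite -normrN; exact: ler_norm].
have s01' : 0 < s <= t1 by rewrite sp (andP s01).2.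
have E1 : sgn * W j s y = lev s * Phi j y by rewrite hW.
(* Before time s the difference of signed component and level is nonpositive, and at s it is 0: its
   time derivative is nonnegative. *)
have T1 : kappa * lev s * Phi j y <= sgn * Wt j s y.
  have D1 := W_t j y s01'.
  rewrite -subr_ge0; apply: (@is_derive_left_max (fun u => sgn * W j u y - lev u * Phi j y) s).
    rewrite /lev; apply: is_derive_eq; rewrite /GRing.scale /lev /=; ring.
  exists s => // u; rewrite subrr => /andP[u0 us]; rewrite E1 subrr subr_le0.
  by apply: (le_trans (sgnle _ _)); apply: okl => //; exact: ltW.
have [psi [dpsi [dd [d [d0 Dpsi Ddpsi psiE [psile ddS]]]]]] := tPhi j y.
(* The signed component minus the level times the majorant [psi] is maximal at [y], since [psi] lies
   above [Phi] nearby and touches it at [y]. *)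
have [] := @second_derivative_local_max R (fun z => sgn * W j s z - lev s * psi z)
  (fun z => sgn * P j s z - lev s * dpsi z) y d (sgn * Q j s y - lev s * dd) d0.
- move=> z /Dpsi Dz; have D1 := W_x j z s01'.
  by apply: is_derive_eq; rewrite /GRing.scale /=; ring.
- have D1 := W_xx j y s01'.
  by apply: is_derive_eq; rewrite /GRing.scale /=; ring.
- move=> z zd; rewrite E1 psiE subrr subr_le0.
  apply: (le_trans (sgnle _ _)); apply: (le_trans (oks j z)).
  by apply: ler_wpM2l; [exact: ltW|exact: psile].
move=> P0 Q0.
have L0 := lev_gt0 s.
have H1 := @W_touch j s y (lev s) sgn s01' _ (fun j => oks j y) hs E1.
have := H1 (introT andP (conj L0 (ell_eta s01))).
rewrite ltNge => /negP; apply.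
apply: (le_trans T1); rewrite W_pde//.
have := ler_wpM2l (ltW L0) ddS.
have -> : sgn * (Q j s y - c * P j s y + Rr j s y) =
  sgn * Q j s y - c * (sgn * P j s y) + sgn * Rr j s y by ring.
have -> : sgn * P j s y = lev s * dpsi y by lra.
lra.
Unshelve. all: end_near. Qed.

End max_principle.

(** * Supersolutions from a positive solution of the linearised equation *)

Section supersolution.
Context {R : realType}.
Variables (c s1 s2 Nh La Pm bl br X0 X1 Cp : R).
Variables (p dp ddp Dg Of : bool -> R -> R) (l r : bool -> R).

Hypotheses (s1_ge0 : 0 <= s1) (s2_gt0 : 0 < s2) (Nh0 : 0 <= Nh).
Hypotheses (p_gt0 : forall i x, 0 < p i x) (p_le : forall i x, p i x <= Pm).
Hypotheses (p_d : forall i (x : R), is_derive x 1 (p i) (dp i x))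
  (p_dd : forall i (x : R), is_derive x 1 (dp i) (ddp i x))
  (dp_le : forall i x, `|dp i x| <= Nh * p i x)
  (p_eq : forall i x, ddp i x - c * dp i x + Dg i x * p i x + Of i x * p (~~ i) x = 0).
Hypotheses (Of_ge0 : forall i x, 0 <= Of i x) (Dg_le : forall i x, `|Dg i x| <= La)
  (Of_le : forall i x, `|Of i x| <= La).
Hypotheses (l_gt0 : forall i, 0 < l i) (bl_gt0 : 0 < bl)
  (left_super : forall i x, x <= X0 ->
     (s2 ^+ 2 - c * s2) * l i + Dg i x * l i + Of i x * l (~~ i) <= - bl * l i).
Hypotheses (r_gt0 : forall i, 0 < r i) (br_gt0 : 0 < br)
  (right_super : forall i x, X1 <= x ->
     (s1 ^+ 2 + c * s1) * r i + Dg i x * r i + Of i x * r (~~ i) <= - br * r i).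
Hypothesis p_left : forall C, exists2 y, y < X0 & forall i, C * expR (s2 * y) <= p i y.
Hypotheses (Cp0 : 0 <= Cp) (p_right : forall i x, X1 <= x -> p i x <= Cp * expR (- (s1 * x))).

Let Pm_gt0 : 0 < Pm. Proof. exact: lt_le_trans (p_gt0 true 0) (p_le true 0). Qed.
Let La_ge0 : 0 <= La. Proof. exact: le_trans (normr_ge0 _) (Dg_le true 0). Qed.

Definition lmin := Num.min (l true) (l false).
Definition lmax := Num.max (l true) (l false).
Definition rmin := Num.min (r true) (r false).
Definition rmax := Num.max (r true) (r false).

Let lminP i : lmin <= l i. Proof. by case: i; rewrite /lmin ge_min lexx ?orbT. Qed.
Let lmaxP i : l i <= lmax. Proof. by case: i; rewrite /lmax le_max lexx ?orbT. Qed.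
Let rminP i : rmin <= r i. Proof. by case: i; rewrite /rmin ge_min lexx ?orbT. Qed.
Let rmaxP i : r i <= rmax. Proof. by case: i; rewrite /rmax le_max lexx ?orbT. Qed.
Let lmin0 : 0 < lmin. Proof. by rewrite /lmin lt_min !l_gt0. Qed.
Let rmin0 : 0 < rmin. Proof. by rewrite /rmin lt_min !r_gt0. Qed.

Lemma is_derive_expRM (a x : R) : is_derive x 1 (fun x => expR (a * x)) (a * expR (a * x)).
Proof. by apply: is_derive_eq; rewrite /GRing.scale /=; ring. Qed.

Definition phiL i (x : R) := l i * expR (s2 * x).
(* The factor 1 - exp / 2 turns p into a strict supersolution on compact sets. *)
Definition phiR (y0 e : R) i (x : R) := (1 - expR (- (2 * Nh + `|c| + 1) * (x - y0)) / 2) * p i x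
   + e * r i * expR (- s1 * x).

Let m := 2 * Nh + `|c| + 1.
Let gg (y0 x : R) := 1 - expR (- m * (x - y0)) / 2.
Let dgg (y0 x : R) := m * expR (- m * (x - y0)) / 2.

Let m_gt0 : 0 < m.
Proof. by rewrite /m ltr_wpDl// addr_ge0// mulr_ge0. Qed.

Let dexp (y0 x : R) : is_derive x 1 (fun x => expR (- m * (x - y0))) (- m * expR (- m * (x - y0))).
Proof. by apply: is_derive_eq; rewrite /GRing.scale /=; ring. Qed.

Definition dphiR (y0 e : R) i x := dgg y0 x * p i x + gg y0 x * dp i x - s1 * (e * r i * expR (- s1 * x)).
Definition ddphiR (y0 e : R) i x := - m * dgg y0 x * p i x + 2 * dgg y0 x * dp i x + gg y0 x * ddp i x
   + s1 ^+ 2 * (e * r i * expR (- s1 * x)).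

Lemma phiR_d y0 e i (x : R) : is_derive x 1 (phiR y0 e i) (dphiR y0 e i x).
Proof.
have D1 := p_d i x; have D2 := dexp y0 x; have D3 := is_derive_expRM (- s1) x.
rewrite /phiR -/m; apply: is_derive_eq; rewrite /GRing.scale /dphiR /gg /dgg /=; by field.
Qed.

Lemma phiR_dd y0 e i (x : R) : is_derive x 1 (dphiR y0 e i) (ddphiR y0 e i x).
Proof.
have D1 := p_d i x; have D2 := dexp y0 x; have D3 := is_derive_expRM (- s1) x.
have D4 := p_dd i x.
rewrite /dphiR /gg /dgg; apply: is_derive_eq; rewrite /GRing.scale /ddphiR /gg /dgg /=; by field.
Qed.

Lemma phiL_d i (x : R) : is_derive x 1 (phiL i) (s2 * phiL i x).
Proof.
have D := is_derive_expRM s2 x.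
by rewrite /phiL; apply: is_derive_eq; rewrite /GRing.scale /=; ring.
Qed.

Lemma phiL_dd i (x : R) : is_derive x 1 (fun x => s2 * phiL i x) (s2 ^+ 2 * phiL i x).
Proof. by have D := phiL_d i x; apply: is_derive_eq; rewrite /GRing.scale /=; ring. Qed.

Let Cr := (s1 ^+ 2 + `|c| * s1 + 2 * La) * rmax + 1.

(** The part in which [gg] is undifferentiated is [gg] times the equation of [p] and vanishes. What
    is left multiplies [dgg], besides the contribution of the exponential correction. *)
Lemma phiR_defect y0 e i x : y0 <= x -> 0 <= e ->
  ddphiR y0 e i x - c * dphiR y0 e i x + Dg i x * phiR y0 e i x + Of i x * phiR y0 e (~~ i) x
  <= - dgg y0 x * p i x + e * expR (- s1 * x) *
    ((s1 ^+ 2 + c * s1) * r i + Dg i x * r i + Of i x * r (~~ i)).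
Proof.
move=> yx e0.
have dg0 : 0 < dgg y0 x by rewrite /dgg divr_gt0// mulr_gt0// expR_gt0.
have E := p_eq i x.
have -> : ddphiR y0 e i x - c * dphiR y0 e i x + Dg i x * phiR y0 e i x + Of i x * phiR y0 e (~~ i) x =
  gg y0 x * (ddp i x - c * dp i x + Dg i x * p i x + Of i x * p (~~ i) x) +
  dgg y0 x * (- m * p i x + 2 * dp i x - c * p i x) +
  e * expR (- s1 * x) * ((s1 ^+ 2 + c * s1) * r i + Dg i x * r i + Of i x * r (~~ i)).
  by rewrite /ddphiR /dphiR /phiR /gg -/m; ring.
rewrite E mulr0 add0r lerD2r.
have := dp_le i x; have := p_gt0 i x => P0 /ler_normlP[_ P1].
have c1 : - c <= `|c| by rewrite -normrN ler_norm.
have c2 := ler_wpM2r (ltW P0) c1.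
(* The constant m = 2 Nh + |c| + 1 is chosen for this: m p dominates 2 dp - c p by the Harnack bound
   on [dp], with one p to spare. *)
have c3 : - m * p i x + 2 * dp i x - c * p i x <= - p i x by rewrite /m; lra.
have := ler_wpM2l (ltW dg0) c3; lra.
Qed.

Lemma right_bound i x :
  `|(s1 ^+ 2 + c * s1) * r i + Dg i x * r i + Of i x * r (~~ i)| <= Cr.
Proof.
have r0 := r_gt0 i; have r1 := rmaxP i; have r2 := rmaxP (~~ i); have r3 := r_gt0 (~~ i).
have q1 : `|(s1 ^+ 2 + c * s1) * r i| <= (s1 ^+ 2 + `|c| * s1) * rmax.
  rewrite normrM (gtr0_norm r0); apply: ler_pM => //; first exact: ltW.
  by apply: (le_trans (ler_normD _ _)); rewrite (normrM c) (ger0_norm s1_ge0) (ger0_norm (sqr_ge0 _)).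
have q2 : `|Dg i x * r i| <= La * rmax.
  by rewrite normrM (gtr0_norm r0); apply: ler_pM => //; exact: ltW.
have q3 : `|Of i x * r (~~ i)| <= La * rmax.
  by rewrite normrM (gtr0_norm r3); apply: ler_pM => //; exact: ltW.
apply: (le_trans (ler_normD _ _)); apply: (le_trans (lerD (ler_normD _ _) (lexx _))).
rewrite /Cr; lra.
Qed.

(** The scale that puts the right branch below the left one at [X0]: [phiR] will be at most 2 Pm
    there, so [Bc] times it is at most half of [phiL]. *)
Let Bc := lmin * expR (s2 * X0) / (4 * Pm).

Let Bc_gt0 : 0 < Bc.
Proof. by rewrite /Bc divr_gt0 ?mulr_gt0// expR_gt0. Qed.

(** The order of the choices matters: [y0] depends on [Bc] only, then e is small relative to the
    gain on the compact middle interval, then b relative to both. *)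
Lemma phiR_super : exists y0 e b, [/\ y0 < X0 /\ 0 < e, 0 < b,
   forall i, phiL i y0 < Bc * phiR y0 e i y0,
   forall i, Bc * phiR y0 e i X0 < phiL i X0 &
   forall i x, y0 <= x ->
     ddphiR y0 e i x - c * dphiR y0 e i x + Dg i x * phiR y0 e i x + Of i x * phiR y0 e (~~ i) x
      <= - b * phiR y0 e i x].
Proof.
(* Far to the left [p] beats every multiple of e^(s2 y). The factor 2 compensates gg = 1/2 at [y0],
   and [lmax] + 1 makes the inequality strict. *)
have [y0 y0X Hy0] := p_left (2 * (lmax + 1) / Bc).
pose X2 := Num.max X1 y0.
have X2y : y0 <= X2 by rewrite /X2 le_max lexx orbT.
have minp i : exists2 d, 0 < d & forall x, y0 <= x <= X2 -> d <= p i x.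
  have cp : continuous (p i) by exact: is_derive_continuous (p_d i).
  have [z _ Hz] := EVT_min X2y (continuous_subspaceT cp).
  by exists (p i z) => // x xI; apply: Hz; rewrite in_itv.
have [d1 d10 Hd1] := minp true; have [d2 d20 Hd2] := minp false.
pose pm := Num.min d1 d2.
have pm0 : 0 < pm by rewrite lt_min d10 d20.
have pmP i x : y0 <= x <= X2 -> pm <= p i x.
  by move=> xI; case: i; [apply: le_trans (Hd1 x xI)|apply: le_trans (Hd2 x xI)]; rewrite ge_min lexx ?orbT.
(* A lower bound on [y0, X2] for the gain [dgg] p of the defect estimate. *)
pose de := m * expR (- m * (X2 - y0)) / 2 * pm.
have de0 : 0 < de by rewrite mulr_gt0// divr_gt0// mulr_gt0// expR_gt0.
pose pX := Num.min (p true X0) (p false X0).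
have pX0 : 0 < pX by rewrite lt_min !p_gt0.
have pXP i : pX <= p i X0 by case: i; rewrite /pX ge_min lexx ?orbT.
have rmax0 : 0 < rmax by apply: lt_le_trans (rmaxP true).
have Cr0 : 0 < Cr.
  rewrite /Cr ltr_wpDl//; apply: mulr_ge0; last exact: ltW.
  by rewrite !addr_ge0 ?sqr_ge0 ?mulr_ge0.
(* The first entry keeps the correction below [p] at [X0], as [Bc] requires; the second keeps its
   defect below half of the gain [de]. *)
pose e := Num.min (pX / (rmax * expR (- s1 * X0))) (de / (2 * Cr * expR (- s1 * y0))).
have e0 : 0 < e by rewrite lt_min !divr_gt0 ?mulr_gt0 ?expR_gt0.
have e1 i : e * r i * expR (- s1 * X0) <= p i X0.
  apply: le_trans (pXP i).
  have h : e <= pX / (rmax * expR (- s1 * X0)) by rewrite ge_min lexx.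
  rewrite ler_pdivlMr in h; last by rewrite mulr_gt0// expR_gt0.
  apply: le_trans h; rewrite -mulrA; apply: ler_wpM2l; first exact: ltW.
  by apply: ler_wpM2r; rewrite ?expR_ge0.
have e2 : e * expR (- s1 * y0) * Cr <= de / 2.
  have h : e <= de / (2 * Cr * expR (- s1 * y0)) by rewrite ge_min lexx orbT.
  rewrite ler_pdivlMr in h; last by rewrite !mulr_gt0// expR_gt0.
  lra.
have gr i x : y0 <= x -> phiR y0 e i x <= p i x + e * r i * expR (- s1 * x).
  move=> yx; rewrite /phiR lerD2r ler_piMl ?ltW//.
  by have := expR_gt0 (- (2 * Nh + `|c| + 1) * (x - y0)); lra.
pose M := Pm + e * rmax * expR (- s1 * y0).
have M0 : 0 < M by rewrite addr_gt0// !mulr_gt0// expR_gt0.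
(* The first entry serves the compact interval, where a margin de / 2 is left and [phiR] is at most
   [M]; the second serves x >= X1, where both [p] and the correction are of order e^(-s1 x). *)
pose b := Num.min (de / (2 * M)) (e * br * rmin / (Cp + e * rmax)).
have CE : 0 < Cp + e * rmax by rewrite ltr_wpDl// mulr_gt0.
have b0 : 0 < b by rewrite lt_min; apply/andP; split; apply: divr_gt0 => //; rewrite !mulr_gt0.
exists y0, e, b; split => //.
- move=> i; have h := Hy0 i.
  have -> : phiR y0 e i y0 = p i y0 / 2 + e * r i * expR (- s1 * y0).
    by rewrite /phiR subrr mulr0 expR0; field.
  have h2 : 0 < e * r i * expR (- s1 * y0) by rewrite !mulr_gt0// expR_gt0.
  have E1 : Bc * (2 * (lmax + 1) / Bc * expR (s2 * y0)) = 2 * ((lmax + 1) * expR (s2 * y0)).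
    by field; rewrite gt_eqF.
  have h3 := ler_wpM2l (ltW Bc_gt0) h; rewrite E1 in h3.
  have h4 := mulr_gt0 Bc_gt0 h2.
  have h5 := ler_wpM2r (expR_ge0 (s2 * y0)) (lmaxP i).
  have h6 := expR_gt0 (s2 * y0).
  rewrite /phiL mulrDr; lra.
- move=> i; have h1 := gr i X0 (ltW y0X).
  have h2 : phiR y0 e i X0 <= 2 * Pm by have := e1 i; have := p_le i X0; lra.
  have h3 := ler_wpM2l (ltW Bc_gt0) h2.
  have h4 : Bc * (2 * Pm) = lmin * expR (s2 * X0) / 2 by rewrite /Bc; field; rewrite gt_eqF.
  have h5 := ler_wpM2r (expR_ge0 (s2 * X0)) (lminP i).
  have h6 : 0 < lmin * expR (s2 * X0) by rewrite mulr_gt0// expR_gt0.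
  rewrite /phiL; lra.
- move=> i x yx; apply: (le_trans (phiR_defect i yx (ltW e0))).
  have xr := gr i x yx.
  have dg0 : 0 < dgg y0 x by rewrite /dgg divr_gt0// mulr_gt0// expR_gt0.
  have [X1x|xX1] := leP X1 x.
    have h1 := right_super i X1x.
    have h2 : 0 <= e * expR (- s1 * x) by rewrite mulr_ge0 ?expR_ge0// ltW.
    have h3 := ler_wpM2l h2 h1.
    have h4 : phiR y0 e i x <= (Cp + e * rmax) * expR (- s1 * x).
      apply: (le_trans xr); rewrite mulrDl; apply: lerD.
        by rewrite mulNr; exact: p_right.
      apply: ler_wpM2r; first exact: expR_ge0.
      by apply: ler_wpM2l => //; exact: ltW.
    have h5 : b * (Cp + e * rmax) <= e * br * rmin.
      by rewrite -ler_pdivlMr// ge_min lexx orbT.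
    have h6 := ler_wpM2r (expR_ge0 (- s1 * x)) h5.
    have h7 := ler_wpM2l (ltW b0) h4.
    have h8 : e * br * rmin * expR (- s1 * x) <= e * br * r i * expR (- s1 * x).
      apply: ler_wpM2r; first exact: expR_ge0.
      by apply: ler_wpM2l => //; rewrite mulr_ge0// ltW.
    have h9 := mulr_gt0 dg0 (p_gt0 i x).
    lra.
  have xX2 : y0 <= x <= X2 by rewrite yx /X2 le_max (ltW xX1).
  have h1 : de <= dgg y0 x * p i x.
    apply: ler_pM; rewrite ?pmP//; [|exact: ltW|].
      by rewrite divr_ge0// mulr_ge0 ?expR_ge0// ltW.
    rewrite /dgg ler_pM2r ?invr_gt0// ler_pM2l// ler_expR.
    by rewrite -subr_ge0 -mulrBr; have /andP[_ hx] := xX2; rewrite nmulr_rge0 ?oppr_lt0//; lra.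
  have ex : expR (- s1 * x) <= expR (- s1 * y0).
    by rewrite ler_expR !mulNr lerN2; apply: ler_wpM2l.
  have h2 : e * expR (- s1 * x) * ((s1 ^+ 2 + c * s1) * r i + Dg i x * r i + Of i x * r (~~ i)) <= de / 2.
    apply: le_trans e2; apply: (@le_trans _ _ (e * expR (- s1 * x) * Cr)).
      apply: ler_wpM2l; first by rewrite mulr_ge0 ?expR_ge0// ltW.
      exact: le_trans (ler_norm _) (right_bound i x).
    apply: ler_wpM2r; first exact: ltW.
    by apply: ler_wpM2l => //; exact: ltW.
  have h3 : phiR y0 e i x <= M.
    apply: (le_trans xr); apply: lerD => //.
    have q1 : 0 <= e * r i by rewrite mulr_ge0// ltW.
    have q2 : e * r i <= e * rmax by apply: ler_wpM2l => //; exact: ltW.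
    by apply: ler_pM => //; exact: expR_ge0.
  have h4 : b * (2 * M) <= de by rewrite -ler_pdivlMr ?mulr_gt0// ge_min lexx.
  have h5 := ler_wpM2l (ltW b0) h3.
  lra.
Qed.

(** Each branch is known to be a supersolution on its side only, [phiL] up to [X0] and [phiR] from
    [y0] on; further left the factor in [phiR] even turns negative. The minimum is therefore taken
    on the overlap alone, and the strict order of the branches at [y0] and [X0] makes the switches
    harmless. *)
Definition phi_min (y0 e : R) i x :=
  if x <= y0 then phiL i x else if x < X0 then Num.min (phiL i x) (Bc * phiR y0 e i x)
  else Bc * phiR y0 e i x.

Section glue.
Variables (y0 e b : R).
Hypotheses (y0X : y0 < X0) (e_gt0 : 0 < e) (b_gt0 : 0 < b)
  (gl : forall i, phiL i y0 < Bc * phiR y0 e i y0)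
  (gr : forall i, Bc * phiR y0 e i X0 < phiL i X0)
  (gs : forall i x, y0 <= x ->
     ddphiR y0 e i x - c * dphiR y0 e i x + Dg i x * phiR y0 e i x + Of i x * phiR y0 e (~~ i) x
      <= - b * phiR y0 e i x).

Let bb := Num.min b bl.
Let fL i := phiL i.
Let fR i x := Bc * phiR y0 e i x.
Let Ph := phi_min y0 e.

Let cL i : continuous (fL i). Proof. exact: is_derive_continuous (phiL_d i). Qed.

Let cR i : continuous (fR i).
Proof.
move=> x; apply: cvgMr; have := is_derive_continuous (phiR_d y0 e i); exact.
Qed.

(** At [y0] and [X0] the order of the branches is strict, hence persists nearby by continuity, and
    the minimum agrees with a single branch across the switch. *)
Lemma phi_min_cases i x :
  [\/ x < X0 /\ \forall z \near x, Ph i z = fL i z,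
      y0 < x < X0 /\ \forall z \near x, Ph i z = Num.min (fL i z) (fR i z) |
      y0 < x /\ \forall z \near x, Ph i z = fR i z].
Proof.
have diff_near (f g : R -> R) : continuous f -> continuous g -> f x < g x -> \forall z \near x, f z < g z.
  move=> cf cg fg.
  have C : g z - f z @[z --> x] --> g x - f x by apply: cvgB; [exact: cg|exact: cf].
  have g0 : 0 < g x - f x by rewrite subr_gt0.
  by apply: filterS (@cvgr_gt R _ (nbhs x) _ _ _ C 0 g0) => z; rewrite subr_gt0.
have [xy|xy|xy] := ltgtP x y0.
- constructor 1; split; first exact: lt_trans xy y0X.
  near=> z; rewrite /Ph /phi_min ifT//; near: z; exact: lt_le_nbhsl.
- have [xX|xX|xX] := ltgtP x X0.
  + constructor 2; split => //.
    near=> z; rewrite /Ph /phi_min ifF ?ifT//.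
      by near: z; exact: lt_nbhsl.
    by apply/negbTE; rewrite -ltNge; near: z; exact: lt_nbhsr.
  + constructor 3; split => //.
    near=> z; rewrite /Ph /phi_min ifF ?ifF//.
      by apply/negbTE; rewrite -leNgt; near: z; exact: lt_le_nbhsr.
    by apply/negbTE; rewrite -ltNge; near: z; exact: lt_nbhsr.
  + constructor 3; split => //.
    have lt : \forall z \near x, fR i z < fL i z by apply: diff_near => //; rewrite xX; exact: gr.
    near=> z; rewrite /Ph /phi_min ifF; last first.
      by apply/negbTE; rewrite -ltNge; near: z; exact: lt_nbhsr.
    case: ifP => // _; rewrite -/(fL i z) -/(fR i z); apply/min_idPr/ltW.
    by near: z.
- constructor 1; rewrite xy; split => //.
  have lt : \forall z \near x, fL i z < fR i z by apply: diff_near => //; rewrite xy; exact: gl.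
  rewrite xy in lt *.
  near=> z; rewrite /Ph /phi_min; case: ifP => // _.
  rewrite ifT; last by near: z; exact: lt_nbhsl.
  rewrite -/(fL i z) -/(fR i z); apply/min_idPl/ltW.
  by near: z.
Unshelve. all: end_near. Qed.

Lemma phi_min_cont i : continuous (Ph i).
Proof.
move=> x.
have key (g : R -> R) : continuous g -> (\forall z \near x, Ph i z = g z) -> {for x, continuous (Ph i)}.
  move=> cg E; have Ex : Ph i x = g x by exact: nbhs_singleton E.
  suff : Ph i z @[z --> x] --> Ph i x by [].
  rewrite Ex; apply: cvg_trans (cg x); apply: near_eq_cvg.
  by apply: filterS E => z ->.
have [[_ E]|[_ E]|[_ E]] := phi_min_cases i x.
- exact: (key (fL i) (@cL i) E).
- apply: key E => z; apply: (@continuous_min _ _ (fL i) (fR i)); [exact: cL|exact: cR].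
- exact: (key (fR i) (@cR i) E).
Qed.

Let fR_gt0 i x : y0 <= x -> 0 < fR i x.
Proof.
move=> yx; rewrite mulr_gt0// /phiR addr_gt0 ?mulr_gt0 ?expR_gt0//.
have : expR (- (2 * Nh + `|c| + 1) * (x - y0)) <= 1.
  rewrite -[leRHS]expR0 ler_expR mulNr oppr_le0 mulr_ge0 ?subr_ge0//.
  exact: ltW m_gt0.
lra.
Qed.

Let fL_gt0 i x : 0 < fL i x. Proof. by rewrite mulr_gt0// expR_gt0. Qed.

Lemma phi_min_gt0 i x : 0 < Ph i x.
Proof.
rewrite /Ph /phi_min; case: (leP x y0) => [_|yx]; first exact: fL_gt0.
case: ifP => _; last by apply: fR_gt0; exact: ltW.
by rewrite lt_min fL_gt0; apply: fR_gt0; exact: ltW.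
Qed.

Lemma phi_min_le_left i x : x < X0 -> Ph i x <= fL i x.
Proof.
move=> xX; rewrite /Ph /phi_min; case: (leP x y0) => // _.
by rewrite xX ge_min lexx.
Qed.

Lemma phi_min_le_right i x : y0 < x -> Ph i x <= fR i x.
Proof.
rewrite /Ph /phi_min; case: (leP x y0) => [_ //|_ _].
by case: ifP => // _; rewrite ge_min lexx orbT.
Qed.

(** The branch that realises the minimum at x is the C^2 majorant. Its own inequality involves the
    same branch of the other component, which may be larger than the minimum; as [Of] is
    nonnegative, replacing it by the minimum only helps. *)
Lemma phi_min_touch i x :
  touch c (Ph i) x (- bb * Ph i x - Dg i x * Ph i x - Of i x * Ph (~~ i) x).
Proof.
have bbl : bb <= bl by rewrite /bb ge_min lexx orbT.
have bbb : bb <= b by rewrite /bb ge_min lexx.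
have TL : x < X0 -> Ph i x = fL i x -> (\forall z \near x, Ph i z <= fL i z) ->
    touch c (Ph i) x (- bb * Ph i x - Dg i x * Ph i x - Of i x * Ph (~~ i) x).
  move=> xX E /nbhs_ballP[d /= d0 Hd].
  exists (fL i), (fun z => s2 * fL i z), (s2 ^+ 2 * fL i x), d; split => //.
  - by move=> z _; exact: phiL_d.
  - exact: phiL_dd.
  - split; first by move=> z zd; apply: Hd; rewrite /ball /= distrC.
    have h1 := ler_wpM2r (expR_ge0 (s2 * x)) (left_super i (ltW xX)).
    have h2 := ler_wpM2l (Of_ge0 i x) (phi_min_le_left (~~ i) xX).
    have h3 := ler_wpM2r (ltW (fL_gt0 i x)) bbl.
    rewrite -/Ph in h2; rewrite E; rewrite /fL /phiL in h2 h3 *; lra.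
have TR : y0 < x -> Ph i x = fR i x -> (\forall z \near x, Ph i z <= fR i z) ->
    touch c (Ph i) x (- bb * Ph i x - Dg i x * Ph i x - Of i x * Ph (~~ i) x).
  move=> xX E /nbhs_ballP[d /= d0 Hd].
  exists (fR i), (fun z => Bc * dphiR y0 e i z), (Bc * ddphiR y0 e i x), d; split => //.
  - move=> z _; have D := phiR_d y0 e i z; rewrite /fR.
    by apply: is_derive_eq; rewrite /GRing.scale /=; ring.
  - have D := phiR_dd y0 e i x.
    by apply: is_derive_eq; rewrite /GRing.scale /=; ring.
  - split; first by move=> z zd; apply: Hd; rewrite /ball /= distrC.
    have h1 := ler_wpM2l (ltW Bc_gt0) (gs i (ltW xX)).
    have h2 := ler_wpM2l (Of_ge0 i x) (phi_min_le_right (~~ i) xX).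
    have h3 := ler_wpM2r (ltW (fR_gt0 i (ltW xX))) bbb.
    rewrite -/Ph in h2; rewrite E; rewrite /fR in h2 h3 *; lra.
have [[xX E]|[/andP[yx xX] E]|[yx E]] := phi_min_cases i x.
- by apply: TL => //; [exact: nbhs_singleton E|apply: filterS E => z ->].
- have Ex := nbhs_singleton E.
  have [LR|RL] := leP (fL i x) (fR i x).
    apply: TL => //; first by rewrite Ex; apply/min_idPl.
    by apply: filterS E => z ->; rewrite ge_min lexx.
  apply: TR => //; first by rewrite Ex; apply/min_idPr/ltW.
  by apply: filterS E => z ->; rewrite ge_min lexx orbT.
- by apply: TR => //; [exact: nbhs_singleton E|apply: filterS E => z ->].
Qed.

Let rho x := expR (s1 * x) + expR (- (s2 * x)).

(** On the right [p] may decay faster than e^(-s1 x); the added multiple of r e^(-s1 x) provides the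
    lower bound. *)
Lemma phi_min_lower : exists2 k1, 0 < k1 & forall i x, k1 <= rho x * Ph i x.
Proof.
pose k1 := Num.min lmin (Bc * e * rmin).
have k10 : 0 < k1 by rewrite lt_min lmin0 /=; apply: mulr_gt0 => //; apply: mulr_gt0.
exists k1 => // i x.
have HL : k1 <= rho x * fL i x.
  apply: (@le_trans _ _ lmin); first by rewrite ge_min lexx.
  apply: (le_trans (lminP i)).
  have -> : rho x * fL i x = l i * (expR (s1 * x + s2 * x) + expR (- (s2 * x) + s2 * x)).
    by rewrite !expRD /rho /fL /phiL; ring.
  rewrite addNr expR0 ler_pMr//; have := expR_gt0 (s1 * x + s2 * x); lra.
have HR : y0 < x -> k1 <= rho x * fR i x.
  move=> yx; apply: (@le_trans _ _ (Bc * e * rmin)); first by rewrite ge_min lexx orbT.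
  apply: (@le_trans _ _ (Bc * e * r i)).
    by apply: ler_wpM2l => //; rewrite mulr_ge0// ltW.
  have h1 : Bc * e * r i * expR (- s1 * x) <= fR i x.
    rewrite /fR -!(mulrA Bc); apply: ler_wpM2l; first exact: ltW.
    rewrite /phiR lerDr; apply: mulr_ge0; last exact: ltW.
    have : expR (- (2 * Nh + `|c| + 1) * (x - y0)) <= 1.
      rewrite -[leRHS]expR0 ler_expR mulNr oppr_le0 mulr_ge0 ?subr_ge0 ?ltW//.
    lra.
  have rho0 : 0 <= rho x by rewrite addr_ge0 ?expR_ge0.
  have h2 := ler_wpM2l rho0 h1.
  apply: le_trans h2.
  have -> : rho x * (Bc * e * r i * expR (- s1 * x)) =
     Bc * e * r i * (expR (s1 * x - s1 * x) + expR (- (s2 * x) + - s1 * x)).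
    by rewrite !expRD mulNr /rho; ring.
  have q0 : 0 < Bc * e * r i by apply: mulr_gt0 => //; apply: mulr_gt0.
  rewrite subrr expR0 ler_pMr//; have := expR_gt0 (- (s2 * x) + - s1 * x); lra.
rewrite /Ph /phi_min; case: (leP x y0) => // yx.
by case: ifP => _; [case: (leP (phiL i x) _) => _ //|]; exact: HR.
Qed.

Lemma phi_min_upper : exists2 k2, 0 < k2 & forall i x, rho x * Ph i x <= k2.
Proof.
have lmax0 : 0 < lmax by apply: lt_le_trans (lmaxP true).
have rmax0 : 0 < rmax by apply: lt_le_trans (rmaxP true).
pose A1 := lmax * (expR ((s1 + s2) * X0) + 1).
pose X2 := Num.max X1 X0.
pose A2 := Bc * (Cp + Pm * expR (s1 * `|X2|) + e * rmax) * (1 + expR (- (s1 + s2) * X0)).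
have A10 : 0 < A1 by rewrite mulr_gt0// addr_gt0// expR_gt0.
have A20 : 0 < A2.
  rewrite mulr_gt0 ?addr_gt0 ?expR_gt0// mulr_gt0//.
  by rewrite -addrA ltr_wpDl// addr_gt0 ?mulr_gt0 ?expR_gt0.
exists (A1 + A2); first by rewrite addr_gt0.
move=> i x; have rho0 : 0 <= rho x by rewrite addr_ge0 ?expR_ge0.
have [xX|xX] := ltP x X0.
  apply: (@le_trans _ _ A1); last by rewrite lerDl ltW.
  apply: (le_trans (ler_wpM2l rho0 (phi_min_le_left i xX))).
  have -> : rho x * fL i x = l i * (expR ((s1 + s2) * x) + expR (- (s2 * x) + s2 * x)).
    by rewrite (_ : (s1 + s2) * x = s1 * x + s2 * x) ?mulrDl// !expRD /rho /fL /phiL; ring.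
  rewrite addNr expR0; apply: ler_pM => //; first exact: ltW.
  rewrite lerD2r ler_expR; apply: ler_wpM2l; last exact: ltW.
  by rewrite addr_ge0// ltW.
apply: (@le_trans _ _ A2); last by rewrite lerDr ltW.
have yx : y0 < x by apply: lt_le_trans xX.
apply: (le_trans (ler_wpM2l rho0 (phi_min_le_right i yx))).
have pb : p i x <= (Cp + Pm * expR (s1 * `|X2|)) * expR (- (s1 * x)).
  have [X1x|xX1] := leP X1 x.
    apply: (le_trans (p_right i X1x)); apply: ler_wpM2r; first exact: expR_ge0.
    by rewrite lerDl mulr_ge0 ?expR_ge0// ltW.
  apply: (le_trans (p_le i x)); rewrite mulrDl -mulrA -expRD.
  rewrite -[leLHS]add0r; apply: lerD; first by rewrite mulr_ge0// expR_ge0.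
  rewrite ler_pMr// -[leLHS]expR0 ler_expR -mulrBr mulr_ge0// subr_ge0.
  by apply: (le_trans (ltW xX1)); apply: le_trans (ler_norm _); rewrite /X2 le_max lexx.
have fb : fR i x <= Bc * (Cp + Pm * expR (s1 * `|X2|) + e * rmax) * expR (- (s1 * x)).
  rewrite /fR -mulrA; apply: ler_wpM2l; first exact: ltW.
  rewrite mulrDl /phiR mulNr; apply: lerD.
    apply: le_trans pb; rewrite ler_piMl//; first exact: ltW.
  rewrite -mulNr; apply: ler_wpM2r; first exact: expR_ge0.
  by apply: ler_wpM2l => //; exact: ltW.
apply: (le_trans (ler_wpM2l rho0 fb)); rewrite /A2.
set Z := Bc * _.
have Z0 : 0 <= Z.
  apply: mulr_ge0; first exact: ltW.
  by rewrite !addr_ge0 ?mulr_ge0 ?expR_ge0// ltW.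
have -> : rho x * (Z * expR (- (s1 * x))) = Z * (expR (s1 * x - s1 * x) + expR (- (s1 + s2) * x)).
  rewrite (_ : - (s1 + s2) * x = - (s2 * x) - s1 * x); last by ring.
  by rewrite !expRD /rho; ring.
rewrite subrr expR0; apply: ler_wpM2l => //; rewrite lerD2l ler_expR !mulNr lerN2.
by apply: ler_wpM2l => //; rewrite addr_ge0// ltW.
Qed.

End glue.

Lemma supersolution_exists : exists (Ph : bool -> R -> R) (b k1 k2 : R),
  [/\ [/\ 0 < b, 0 < k1 & 0 < k2], forall i, continuous (Ph i), forall i x, 0 < Ph i x,
   forall i x, k1 <= (expR (s1 * x) + expR (- (s2 * x))) * Ph i x <= k2 &
   forall i x, touch c (Ph i) x (- b * Ph i x - Dg i x * Ph i x - Of i x * Ph (~~ i) x)].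
Proof.
have [y0 [e [b [[y0X e0] b0 gl gr gs]]]] := phiR_super.
have [k1 k10 H1] := phi_min_lower y0 e0.
have [k2 k20 H2] := phi_min_upper y0X e0.
exists (phi_min y0 e), (Num.min b bl), k1, k2; split => //.
- by split => //; rewrite lt_min b0.
- by move=> i; exact: phi_min_cont.
- by move=> i x; exact: phi_min_gt0.
- by move=> i x; rewrite H1 H2.
- by move=> i x; exact: phi_min_touch.
Qed.

End supersolution.

(** * Harnack inequality and the nonlinearity *)

Section pairs.
Context {R : realType}.

Lemma is_derive_cvgP (V : normedModType R) (f : R -> V) (x : R) d :
  is_derive x 1 f d <-> h^-1 *: (f (h *: 1 + x) - f x) @[h --> 0^'] --> d.
Proof.
split=> [[ex <-]|H]; first exact: ex.
split; first by apply/cvg_ex; exists d.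
exact: cvg_lim H.
Qed.

Lemma is_derive_pair (f : R -> R * R) (x : R) d :
  is_derive x 1 f d <->
  is_derive x 1 (fun y => (f y).1) d.1 /\ is_derive x 1 (fun y => (f y).2) d.2.
Proof.
rewrite !is_derive_cvgP; split=> [H|[H1 H2]].
  split.
    apply: cvg_trans (cvg_comp _ _ H (@cvg_fst _ _ (nbhs d.1) (nbhs d.2) _)).
    by apply: near_eq_cvg; near=> h.
  apply: cvg_trans (cvg_comp _ _ H (@cvg_snd _ _ (nbhs d.1) (nbhs d.2) _)).
  by apply: near_eq_cvg; near=> h.
rewrite [d]surjective_pairing.
apply: cvg_trans (cvg_pair H1 H2).
by apply: near_eq_cvg; near=> h.
Unshelve. all: end_near. Qed.

Lemma le_of_derive (f df : R -> R) : (forall x : R, is_derive x 1 f (df x)) ->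
  (forall x, df x <= 0) -> forall x y, x <= y -> f y <= f x.
Proof.
move=> fd d0 x y; rewrite le_eqVlt => /orP[/eqP->//|xy].
have cf : {within `[x, y], continuous f}.
  by apply: continuous_subspaceT; exact: is_derive_continuous fd.
have [z _ E] := MVT xy (fun z _ => fd z) cf.
by rewrite -subr_le0 E mulr_le0_ge0 ?subr_ge0// ltW.
Qed.

Lemma derive_mvt (f df : R -> R) (x y : R) : (forall x : R, is_derive x 1 f (df x)) ->
  x < y -> exists2 z, x < z < y & f y - f x = df z * (y - x).
Proof.
move=> fd xy.
have cf : {within `[x, y], continuous f}.
  by apply: continuous_subspaceT; exact: is_derive_continuous fd.
by have [z zI E] := MVT xy (fun z _ => fd z) cf; exists z => //; move: zI; rewrite in_itv.
Qed.

Lemma increasing_derive_ge0 (f df : R -> R) : (forall x : R, is_derive x 1 f (df x)) ->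
  {homo f : x y / x < y} -> forall x, 0 <= df x.
Proof.
move=> fd fi x.
have := @incr_derive1_ge0 _ f setT x; rewrite interiorT derive1E derive_val; apply => //.
- by move=> y z _ _; exact: fi.
Qed.

Lemma norm_sub3 (x y z A B C : R) : 0 <= x <= A -> 0 <= y <= B -> 0 <= z <= C ->
  `|x - y - z| <= A + B + C.
Proof.
by move=> /andP[? ?] /andP[? ?] /andP[? ?]; rewrite ler_norml; apply/andP; split; lra.
Qed.

End pairs.

Section harnack.
Context {R : realType}.

(* With bp, bm the roots of X^2 - c X - L, the function y = dp - bm p satisfies
   y' <= bp y; if y were negative somewhere it would stay so to the right, forcing p
   to become negative. *)
Lemma harnack_lower (c L : R) (p dp ddp : R -> R) : 0 < L ->
  (forall x, 0 <= p x) ->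
  (forall x : R, is_derive x 1 p (dp x)) -> (forall x : R, is_derive x 1 dp (ddp x)) ->
  (forall x, ddp x - c * dp x - L * p x <= 0) ->
  forall x, - ((Num.sqrt (c ^+ 2 + 4 * L) - c) / 2) * p x <= dp x.
Proof.
move=> L0 p0 pd pdd pe x0.
have s2 := @sqr_sqrtr R (c ^+ 2 + 4 * L) _.
set s := Num.sqrt _ in s2 *.
have S : s ^+ 2 = c ^+ 2 + 4 * L by apply: s2; have := sqr_ge0 c; lra.
have s0 : 0 <= s by exact: sqrtr_ge0.
have sc : `|c| < s.
  by rewrite -(@ltr_pXn2r _ 2)// ?nnegrE// S -normrX ger0_norm ?sqr_ge0//; lra.
have [sc1 sc2] : - s < c /\ c < s by move: sc; rewrite ltr_norml => /andP[].
pose bm := - ((s - c) / 2); pose bp := (c + s) / 2.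
have EL : L = - (bm * bp).
  have LS : L = (s ^+ 2 - c ^+ 2) / 4 by lra.
  by rewrite LS /bm /bp; field.
have Ec : c = bm + bp by rewrite /bm /bp; field.
have bm0 : bm < 0 by rewrite /bm; lra.
have bp0 : 0 < bp by rewrite /bp; lra.
pose y x := (dp x - bm * p x) * expR (- bp * x).
pose dy x := (ddp x - c * dp x - L * p x) * expR (- bp * x).
have yd (x : R) : is_derive x 1 y (dy x).
  have D1 := pd x; have D2 := pdd x; have D3 := is_derive_expRM (- bp) x.
  rewrite /y; apply: is_derive_eq; rewrite /GRing.scale /= /dy.
  rewrite EL [c in RHS]Ec; ring.
have yn := le_of_derive yd (fun x => mulr_le0_ge0 (pe x) (expR_ge0 _)).
rewrite -/bm -subr_ge0 leNgt; apply/negP => neg.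
set de := - (dp x0 - bm * p x0).
have de0 : 0 < de by rewrite oppr_gt0.
have dpl x : x0 <= x -> dp x <= - de.
  move=> xx; have := yn _ _ xx; rewrite /y => h.
  have h1 : dp x - bm * p x <= (dp x0 - bm * p x0) * expR (bp * (x - x0)).
    have -> : expR (bp * (x - x0)) = expR (- bp * x0) * expR (bp * x) by rewrite -expRD; congr expR; ring.
    rewrite mulrA; have h2 := ler_wpM2r (expR_ge0 (bp * x)) h.
    move: h2; rewrite -(mulrA (dp x - _)) -expRD (_ : - bp * x + bp * x = 0); last by ring.
    by rewrite expR0 mulr1.
  have h3 : 1 <= expR (bp * (x - x0)).
    by rewrite -[leLHS]expR0 ler_expR mulr_ge0 ?subr_ge0// ltW.
  have h4 : de <= de * expR (bp * (x - x0)) by rewrite ler_pMr.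
  have h5 : bm * p x <= 0 by rewrite mulr_le0_ge0// ltW.
  rewrite -/de in h4; have -> : dp x = (dp x - bm * p x) + bm * p x by ring.
  rewrite (_ : (dp x0 - _) = - de) in h1; last by rewrite /de opprK.
  lra.
pose x1 := x0 + (p x0 + 1) / de.
have x01 : x0 < x1 by rewrite ltrDl divr_gt0// ltr_wpDl.
have [z /andP[z1 _] E] := derive_mvt pd x01.
have h := dpl z (ltW z1).
have h2 : dp z * (x1 - x0) <= - (p x0 + 1).
  have -> : - (p x0 + 1) = - de * (x1 - x0) by rewrite /x1 [x0 + _]addrC addrK mulNr mulrC divfK ?gt_eqF.
  by apply: ler_wpM2r => //; rewrite subr_ge0 ltW.
by have := p0 x1; lra.
Qed.

(** The upper bound on [dp] is the lower one for the reflected function x |-> p (-x), which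
    satisfies the same inequality with -c. *)
Lemma harnack_derive (c L : R) (p dp ddp : R -> R) : 0 < L ->
  (forall x, 0 <= p x) ->
  (forall x : R, is_derive x 1 p (dp x)) -> (forall x : R, is_derive x 1 dp (ddp x)) ->
  (forall x, ddp x - c * dp x - L * p x <= 0) ->
  forall x, `|dp x| <= (Num.sqrt (c ^+ 2 + 4 * L) + `|c|) / 2 * p x.
Proof.
move=> L0 p0 pd pdd pe x.
have h1 := harnack_lower L0 p0 pd pdd pe x.
have negd (f df : R -> R) : (forall x : R, is_derive x 1 f (df x)) ->
    forall x : R, is_derive x 1 (fun y => f (- y)) (- df (- x)).
  move=> fd y; have D : is_derive y 1 (fun z : R => - z) (- 1) by apply: is_derive_eq.
  by apply: is_derive_eq (@is_derive1_comp _ f (fun z => - z) _ _ _ (fd (- y)) D) _; rewrite mulrN1.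
have D2 (y : R) : is_derive y 1 (fun z => - dp (- z)) (ddp (- y)).
  by have D := negd _ _ pdd y; apply: is_derive_eq; rewrite opprK.
have e2 y : ddp (- y) - - c * - dp (- y) - L * p (- y) <= 0 by rewrite mulrNN; exact: pe.
have := harnack_lower L0 (fun y => p0 (- y)) (negd _ _ pd) D2 e2 (- x).
rewrite !opprK sqrrN => h2.
have c1 := ler_norm c; have c2 := ler_norm (- c); rewrite normrN in c2.
have q1 : (Num.sqrt (c ^+ 2 + 4 * L) - c) / 2 * p x <= (Num.sqrt (c ^+ 2 + 4 * L) + `|c|) / 2 * p x.
  by apply: ler_wpM2r => //; lra.
have q2 : (Num.sqrt (c ^+ 2 + 4 * L) + c) / 2 * p x <= (Num.sqrt (c ^+ 2 + 4 * L) + `|c|) / 2 * p x.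
  by apply: ler_wpM2r => //; lra.
by rewrite ler_norml; apply/andP; split; lra.
Qed.

(** The function p e^(-N z) is nonincreasing and p e^(N z) is nondecreasing. Values of [p] at
    bounded distance are thus comparable. *)
Lemma gronwall_two_sided (N : R) (p dp : R -> R) :
  (forall x : R, is_derive x 1 p (dp x)) -> (forall x, `|dp x| <= N * p x) ->
  forall x y, p y <= p x * expR (N * `|x - y|).
Proof.
move=> pd dpN x y.
have D1 (z : R) : is_derive z 1 (fun z => p z * expR (- N * z)) ((dp z - N * p z) * expR (- N * z)).
  have := pd z; have := is_derive_expRM (- N) z => D1 D2.
  by apply: is_derive_eq; rewrite /GRing.scale /=; ring.
have D2 (z : R) : is_derive z 1 (fun z => - (p z * expR (N * z))) (- (dp z + N * p z) * expR (N * z)).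
  have := pd z; have := is_derive_expRM N z => D3 D4.
  by apply: is_derive_eq; rewrite /GRing.scale /=; ring.
have m1 := le_of_derive D1; have m2 := le_of_derive D2.
have b z : dp z - N * p z <= 0 /\ - (dp z + N * p z) <= 0.
  by have := dpN z; rewrite ler_norml => /andP[]; lra.
have [xy|yx] := leP x y.
  have := m1 (fun z => mulr_le0_ge0 (b z).1 (expR_ge0 _)) _ _ xy => h.
  have := ler_wpM2r (expR_ge0 (N * y)) h.
  rewrite -!mulrA -!expRD (_ : - N * y + N * y = 0); last by ring.
  rewrite expR0 mulr1; rewrite (_ : - N * x + N * y = N * `|x - y|)//.
  by rewrite ler0_norm ?subr_le0//; ring.
have := m2 (fun z => mulr_le0_ge0 (b z).2 (expR_ge0 _)) _ _ (ltW yx).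
rewrite lerN2 => h.
have := ler_wpM2r (expR_ge0 (- N * y)) h.
rewrite -!mulrA -!expRD (_ : N * y + - N * y = 0); last by ring.
rewrite expR0 mulr1; rewrite (_ : N * x + - N * y = N * `|x - y|)//.
by rewrite ger0_norm ?subr_ge0// ?ltW//; ring.
Qed.

End harnack.

(** * The reaction term and its Jacobian along the wave *)

Section nonlinearity.
Context {R : realType}.
Variables alpha k : R.

Let K : R := Kstar alpha k.
Definition Fc (i : bool) (a b : R) : R := if i then (F alpha k (a, b)).1 else (F alpha k (a, b)).2.

Let den (a : R) := 1 + k * (K - a).

(* Jacobian entries of F; the index true stands for the first component. *)
Definition Fa (i j : bool) (a b : R) : R :=
  let d := den a in
  let qq := (K - a + b) / d in
  match i, j with
  | true, true => 1 - alpha - qq - (K - a) * (1 - k * b) / d ^+ 2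
  | true, false => (K - a) / d
  | false, true => b * (1 - k * b) / d ^+ 2
  | false, false => 1 - qq - b / d
  end.

Lemma is_derive_divr (f g : R -> R) (x df dg : R) : is_derive x 1 f df -> is_derive x 1 g dg ->
  g x != 0 -> is_derive x 1 (fun y => f y / g y) ((df * g x - f x * dg) / g x ^+ 2).
Proof.
move=> D1 D2 g0; have D3 := is_deriveV g0 D2.
by apply: is_derive_eq; rewrite /GRing.scale /=; field.
Qed.

Lemma is_derive_Fc (i : bool) (u v : R -> R) (x p q : R) : is_derive x 1 u p -> is_derive x 1 v q ->
  den (u x) != 0 ->
  is_derive x 1 (fun y => Fc i (u y) (v y)) (Fa i true (u x) (v x) * p + Fa i false (u x) (v x) * q).
Proof.
move=> D1 D2 d0.
have Dw : is_derive x 1 (fun y => K - u y) (- p).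
  by have := is_deriveB (is_derive_cst K x 1) D1; rewrite sub0r.
have Dd : is_derive x 1 (fun y => den (u y)) (- (k * p)).
  by rewrite /den; apply: is_derive_eq; rewrite /GRing.scale /=; ring.
have Dn : is_derive x 1 (fun y => K - u y + v y) (- p + q) by apply: is_derive_eq.
have Dq := is_derive_divr Dn Dd d0.
case: i; rewrite /Fc /F /= -/K /denom /= -/K -/(den _).
- apply: is_derive_eq; rewrite /GRing.scale /= /den in d0 *; by field.
- apply: is_derive_eq; rewrite /GRing.scale /= /den in d0 *; by field.
Qed.

Lemma cvg_Fa (T : Type) (G : set_system T) {FG : Filter G} (u v : T -> R) (a b : R) i j :
  den a != 0 -> u @ G --> a -> v @ G --> b -> (fun t => Fa i j (u t) (v t)) @ G --> Fa i j a b.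
Proof.
move=> d0 ua vb.
have cw : (fun t => K - u t) @ G --> K - a by apply: cvgB => //; exact: cvg_cst.
have cd : (fun t => den (u t)) @ G --> den a.
  by apply: cvgD; [exact: cvg_cst|apply: cvgMr; exact: cw].
have cv : (fun t => (den (u t))^-1) @ G --> (den a)^-1 by apply: cvgV.
have cv2 : (fun t => (den (u t) ^+ 2)^-1) @ G --> (den a ^+ 2)^-1.
  by apply: cvgV; [rewrite expf_neq0|rewrite expr2; apply: cvgM].
have cn : (fun t => K - u t + v t) @ G --> K - a + b by apply: cvgD.
have ck : (fun t => 1 - k * v t) @ G --> 1 - k * b.
  by apply: cvgB; [exact: cvg_cst|apply: cvgMr].
have cq : (fun t => (K - u t + v t) / den (u t)) @ G --> (K - a + b) / den a by apply: cvgM.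
case: i; case: j; rewrite /Fa.
- apply: cvgB; first by apply: cvgB => //; exact: cvg_cst.
  by apply: cvgM => //; apply: cvgM.
- by apply: cvgM.
- by apply: cvgM => //; apply: cvgM.
- by apply: cvgB; [apply: cvgB => //; exact: cvg_cst|apply: cvgM].
Qed.

Lemma cvg_Fc (T : Type) (G : set_system T) {FG : Filter G} (u v : T -> R) (a b : R) i :
  den a != 0 -> u @ G --> a -> v @ G --> b -> (fun t => Fc i (u t) (v t)) @ G --> Fc i a b.
Proof.
move=> d0 ua vb.
have cw : (fun t => K - u t) @ G --> K - a by apply: cvgB => //; exact: cvg_cst.
have cd : (fun t => den (u t)) @ G --> den a.
  by apply: cvgD; [exact: cvg_cst|apply: cvgMr; exact: cw].
have cv : (fun t => (den (u t))^-1) @ G --> (den a)^-1 by apply: cvgV.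
have cn : (fun t => K - u t + v t) @ G --> K - a + b by apply: cvgD.
have cq : (fun t => (K - u t + v t) / den (u t)) @ G --> (K - a + b) / den a by apply: cvgM.
case: i; rewrite /Fc /F /=.
- by apply: cvgN; apply: cvgM => //; apply: cvgB => //; exact: cvg_cst.
- by apply: cvgM => //; apply: cvgB => //; exact: cvg_cst.
Qed.

Hypotheses (ha : 0 < alpha < 1) (hk : 0 < k < 1).

Lemma Kden_gt0 : 0 < 1 - k + alpha * k.
Proof. by move/andP: ha => [a0 a1]; move/andP: hk => [k0 k1]; rewrite addr_gt0 ?subr_gt0 ?mulr_gt0. Qed.

Lemma K_gt0 : 0 < K.
Proof. by move/andP: ha => [a0 a1]; rewrite /K /Kstar divr_gt0 ?subr_gt0 ?Kden_gt0. Qed.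

Lemma den_ge1 a : a <= K -> 1 <= den a.
Proof. by move=> aK; move/andP: hk => [k0 k1]; rewrite /den lerDl mulr_ge0 ?subr_ge0// ltW. Qed.

Lemma den0 : den 0 = (1 - k + alpha * k)^-1.
Proof. by have := Kden_gt0 => /gt_eqF/negbT h; rewrite /den /K /Kstar; field. Qed.

Lemma Fa_bound i j a b : 0 <= a <= K -> 0 <= b <= 1 -> `|Fa i j a b| <= 2 * K + 4.
Proof.
move=> /andP[a0 aK] /andP[b0 b1]; move/andP: hk => [k0 k1]; move/andP: ha => [al0 al1].
have d1 := den_ge1 aK; set d := den a in d1 *.
have d0 : 0 < d by apply: lt_le_trans d1.
have dv1 : d^-1 <= 1 by rewrite invf_le1.
have dv0 : 0 < d^-1 by rewrite invr_gt0.
have K0 := K_gt0.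
have w0 : 0 <= K - a by rewrite subr_ge0.
have kb : 0 <= 1 - k * b <= 1.
  rewrite subr_ge0 mulr_ile1 ?(ltW k0) ?(ltW k1)//= gerBl mulr_ge0// ltW//.
have le1 (X Y : R) : 0 <= X <= Y -> 0 <= X * d^-1 <= Y.
  move=> /andP[X0 XY]; rewrite mulr_ge0 ?(ltW dv0)//=; apply: le_trans XY; exact: ler_piMr.
have wb : 0 <= K - a <= K by rewrite w0 gerBl.
have bb : 0 <= b <= 1 by rewrite b0.
have q : 0 <= (K - a + b) / d <= K + 1.
  by apply: le1; rewrite addr_ge0//= lerD// gerBl.
have e1 (X Y : R) : 0 <= X <= Y -> 0 <= X * (1 - k * b) / d ^+ 2 <= Y.
  move=> /andP[X0 XY]; rewrite expr2 invfM (mulrA _ d^-1); apply: (le1); apply: (le1).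
  move/andP: kb => [kb0 kb1]; rewrite mulr_ge0//=; apply: le_trans XY; exact: ler_piMr.
have al : 0 <= 1 - alpha <= 1 by rewrite subr_ge0 (ltW al1) gerBl ltW.
have one : 0 <= (1 : R) <= 1 by rewrite ler01 lexx.
have small (X Y : R) : 0 <= X <= Y -> Y <= 2 * K + 4 -> `|X| <= 2 * K + 4.
  by move=> /andP[X0 XY] YK; rewrite ger0_norm//; exact: le_trans YK.
have KB : K <= 2 * K + 4 by rewrite -[leLHS]addr0 lerD// ler_peMl// ?ler1n// ltW.
have OB : 1 <= 2 * K + 4 by have := K0; lra.
case: i; case: j; rewrite /Fa -/d.
- apply: le_trans (norm_sub3 al q (e1 _ _ wb)) _.
  by rewrite mulr_natl mulr2n; lra.
- exact: small (le1 _ _ wb) KB.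
- exact: small (e1 _ _ bb) OB.
- apply: le_trans (norm_sub3 one q (le1 _ _ bb)) _.
  by rewrite mulr_natl mulr2n; lra.
Qed.

Lemma Fa_off_ge0 i a b : 0 <= a <= K -> 0 <= b <= 1 -> 0 <= Fa i (~~ i) a b.
Proof.
move=> /andP[a0 aK] /andP[b0 b1]; move/andP: hk => [k0 k1].
have d0 : 0 <= den a by apply: le_trans (den_ge1 aK).
case: i; rewrite /Fa /=; first by rewrite divr_ge0// subr_ge0.
by rewrite divr_ge0 ?exprn_ge0// mulr_ge0// subr_ge0 mulr_ile1// ltW.
Qed.

(** The Jacobian at the left end state is triangular: the second component decouples with rate
    alpha, the only unstable entry and the one that [sigma2] has to beat. At the right end state it
    is the first component that decouples, with rate -alpha. *)
Lemma Fa_left : [/\ Fa true true 0 0 < 0, Fa true false 0 0 = 1 - alpha,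
  Fa false true 0 0 = 0 & Fa false false 0 0 = alpha].
Proof.
have h := Kden_gt0; have h' := h; move/gt_eqF/negbT: h' => h'.
have K0 := K_gt0.
have E : K / den 0 = 1 - alpha by rewrite den0 invrK /K /Kstar; field.
rewrite /Fa !(subr0, addr0, mulr0, mul0r, E, mulr1); split => //; last by ring.
rewrite subrr sub0r oppr_lt0 divr_gt0// exprn_gt0// den0 invr_gt0//.
Qed.

Lemma Fa_right : [/\ Fa true true K 1 = - alpha, Fa true false K 1 = 0,
  Fa false true K 1 = 1 - k & Fa false false K 1 = - 1].
Proof.
have E : den K = 1 by rewrite /den subrr mulr0 addr0.
by rewrite /Fa E !subrr expr1n !divr1; split; ring.
Qed.

End nonlinearity.

(** * The traveling wave *)

Section limits.
Context {R : realType}.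

Lemma lt_lim_Noo (f : R -> R) (l x : R) : {homo f : x y / x < y} -> f y @[y --> -oo] --> l -> l < f x.
Proof.
move=> fi fl; apply: (@le_lt_trans _ _ (f (x - 1))); last by apply: fi; rewrite ltrBlDr ltrDl.
apply: (ler_cvg_to fl (cvg_cst _)).
by near=> y; apply/ltW/fi; near: y; apply: nbhs_ninfty_lt; exact: num_real.
Unshelve. all: end_near. Qed.

Lemma gt_lim_oo (f : R -> R) (l x : R) : {homo f : x y / x < y} -> f y @[y --> +oo] --> l -> f x < l.
Proof.
move=> fi fl; apply: (@lt_le_trans _ _ (f (x + 1))); first by apply: fi; rewrite ltrDl.
apply: (ler_cvg_to (cvg_cst _) fl).
by near=> y; apply/ltW/fi; near: y; apply: nbhs_pinfty_gt; exact: num_real.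
Unshelve. all: end_near. Qed.

Lemma near_Noo (P : R -> Prop) : (\forall x \near -oo, P x) -> exists X : R, forall x, x <= X -> P x.
Proof.
case=> X [_ H]; exists (X - 1) => x xX; apply: H.
by apply: le_lt_trans xX _; rewrite ltrBlDr ltrDl.
Qed.

Lemma near_oo (P : R -> Prop) : (\forall x \near +oo, P x) -> exists X : R, forall x, X <= x -> P x.
Proof.
case=> X [_ H]; exists (X + 1) => x xX; apply: H.
by apply: lt_le_trans xX; rewrite ltrDl.
Qed.

Lemma expR_ge_large (a C : R) : 0 < a -> exists Y : R, forall y, y <= Y -> C <= expR (- (a * y)).
Proof.
move=> a0; exists (- (`|C| / a)) => y yY; apply: (@le_trans _ _ (1 + - (a * y))); last first.
  exact: expR_ge1Dx.
have h : a * y <= - `|C|.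
  have -> : - `|C| = a * (- (`|C| / a)) by field; rewrite gt_eqF.
  by rewrite ler_pM2l.
by have := ler_norm C; lra.
Qed.

(** The arithmetic A / 2 - 2 A / 8 = A / 4 behind the step of length ln 8 / [la] used for the wave
    on the left. *)
Lemma quarter_gap (a b d A E : R) : a - b = d -> A / 2 * E <= a -> b <= 2 * A * (E / 8) ->
  A / 4 * E <= d.
Proof. by move=> <- h1 h2; lra. Qed.

End limits.

Section wave.
Context {R : realType}.
Variables (alpha k c s1 s2 : R) (U : R -> R * R).
Hypotheses (ha : 0 < alpha < 1) (hk : 0 < k < 1) (hc : 2 * Num.sqrt alpha < c).
Hypothesis hw : traveling_wave alpha k c U.
Hypotheses (hs1 : 0 <= s1 < (- c + Num.sqrt (c ^+ 2 + 4 * alpha)) / 2)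
  (hs2 : (c - Num.sqrt (c ^+ 2 - 4 * alpha)) / 2 < s2 < (c + Num.sqrt (c ^+ 2 - 4 * alpha)) / 2).

Let K : R := Kstar alpha k.
Definition wv (i : bool) (x : R) : R := if i then (U x).1 else (U x).2.
Definition wvd (i : bool) (x : R) : R := if i then (U^`() x).1 else (U^`() x).2.
Let top (i : bool) : R := if i then K else 1.

Let K0 : 0 < K. Proof. exact: K_gt0. Qed.
Let top0 i : 0 < top i. Proof. by case: i. Qed.

Lemma wv_d i (x : R) : is_derive x 1 (wv i) (wvd i x).
Proof.
have D : is_derive x 1 U (U^`() x).
  by rewrite derive1E; split => //; exact: tw_derivable hw x.
by move/is_derive_pair: D => []; case: i.
Qed.

Lemma wvd_d i (x : R) : is_derive x 1 (wvd i) (c * wvd i x - Fc alpha k i (wv true x) (wv false x)).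
Proof.
have D : is_derive x 1 U^`() (U^`()^`() x).
  by rewrite derive1E; split => //; exact: tw_derivable2 hw x.
have E := tw_ode hw x.
have aux (a b f : R) : a - c * b + f = 0 -> a = c * b - f by lra.
have E1 : (U^`()^`() x).1 - c * (U^`() x).1 + (F alpha k (U x)).1 = 0 := congr1 fst E.
have E2 : (U^`()^`() x).2 - c * (U^`() x).2 + (F alpha k (U x)).2 = 0 := congr1 snd E.
move/is_derive_pair: D => -[h1 h2].
case: i; rewrite /Fc /wv -surjective_pairing.
  by rewrite /wvd -(aux _ _ _ E1).
by rewrite /wvd -(aux _ _ _ E2).
Qed.

Lemma wv_incr i : {homo wv i : x y / x < y}.
Proof. by case: i => x y xy; [exact: tw_incr1 hw x y xy|exact: tw_incr2 hw x y xy]. Qed.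

Lemma wv_left i : wv i x @[x --> -oo] --> (0 : R).
Proof.
have H := tw_left hw; case: i.
- exact: cvg_comp _ _ H (@cvg_fst _ _ (nbhs (0:R)) (nbhs (0:R)) _).
- exact: cvg_comp _ _ H (@cvg_snd _ _ (nbhs (0:R)) (nbhs (0:R)) _).
Qed.

Lemma wv_right i : wv i x @[x --> +oo] --> (top i).
Proof.
have H := tw_right hw; case: i.
- exact: cvg_comp _ _ H (@cvg_fst _ _ (nbhs K) (nbhs (1:R)) _).
- exact: cvg_comp _ _ H (@cvg_snd _ _ (nbhs K) (nbhs (1:R)) _).
Qed.

Lemma wv_gt0 i x : 0 < wv i x.
Proof. exact: lt_lim_Noo (@wv_incr i) (@wv_left i). Qed.

Lemma wv_lt i x : wv i x < top i.
Proof. exact: gt_lim_oo (@wv_incr i) (@wv_right i). Qed.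

Let wv1 x : 0 <= wv true x <= K. Proof. by rewrite !ltW//; [exact: (wv_lt true)|exact: wv_gt0]. Qed.
Let wv2 x : 0 <= wv false x <= 1. Proof. by rewrite !ltW//; [exact: (wv_lt false)|exact: wv_gt0]. Qed.

Lemma wv_den x : 1 <= 1 + k * (K - wv true x).
Proof. by apply: (den_ge1 hk); have /andP[] := wv1 x. Qed.

Definition Dgw i x := Fa alpha k i i (wv true x) (wv false x).
Definition Ofw i x := Fa alpha k i (~~ i) (wv true x) (wv false x).
Let dp i x := c * wvd i x - Fc alpha k i (wv true x) (wv false x).
Let ddp i x := c * dp i x - (Dgw i x * wvd i x + Ofw i x * wvd (~~ i) x).

Let dp_d i (x : R) : is_derive x 1 (dp i) (ddp i x).
Proof.
have d0 : 1 + k * (Kstar alpha k - wv true x) != 0.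
  by rewrite gt_eqF//; apply: lt_le_trans (wv_den x).
have D1 := wvd_d i x; have D2 := is_derive_Fc i (wv_d true x) (wv_d false x) d0.
have -> : ddp i x = c * dp i x - (Fa alpha k i true (wv true x) (wv false x) * wvd true x +
   Fa alpha k i false (wv true x) (wv false x) * wvd false x).
  by rewrite /ddp /Dgw /Ofw; case: i {D1 D2} => /=; ring.
by rewrite /dp; apply: is_derive_eq; rewrite /GRing.scale.
Qed.

Let La := 2 * K + 4.
Let La0 : 0 < La. Proof. by rewrite /La; have := K0; lra. Qed.

Lemma Dgw_le i x : `|Dgw i x| <= La.
Proof. exact: Fa_bound. Qed.

Lemma Ofw_le i x : `|Ofw i x| <= La.
Proof. exact: Fa_bound. Qed.

Lemma Ofw_ge0 i x : 0 <= Ofw i x.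
Proof. exact: Fa_off_ge0. Qed.

Let pd i (x : R) : is_derive x 1 (wvd i) (dp i x) := wvd_d i x.

Lemma wvd_ge0 i x : 0 <= wvd i x.
Proof. exact: increasing_derive_ge0 (wv_d i) (@wv_incr i) x. Qed.

(** As the coupling is nonnegative and |[Dgw]| is at most [La], each component of the derivative is
    by itself a supersolution of the scalar equation p'' - c p' - La p = 0; no Harnack inequality
    for systems is required. *)
Lemma wv_harnack : exists2 N, 0 <= N &
  (forall i x, `|dp i x| <= N * wvd i x) /\
  (forall i x y, wvd i y <= wvd i x * expR (N * `|x - y|)).
Proof.
pose N := (Num.sqrt (c ^+ 2 + 4 * La) + `|c|) / 2.
have HN i x : `|dp i x| <= N * wvd i x.
  apply: (harnack_derive La0 (wvd_ge0 i) (pd i) (dp_d i)) => {}x.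
  have -> : ddp i x - c * dp i x - La * wvd i x = - ((Dgw i x + La) * wvd i x) - Ofw i x * wvd (~~ i) x.
    by rewrite /ddp; ring.
  have h1 : 0 <= (Dgw i x + La) * wvd i x.
    apply: mulr_ge0; last exact: wvd_ge0.
    by have := Dgw_le i x; rewrite ler_norml => /andP[]; lra.
  have h2 : 0 <= Ofw i x * wvd (~~ i) x by apply: mulr_ge0; [exact: Ofw_ge0|exact: wvd_ge0].
  lra.
exists N; first by rewrite /N divr_ge0// addr_ge0// sqrtr_ge0.
by split => // i x y; exact: gronwall_two_sided (pd i) (HN i) x y.
Qed.

(** A zero of the derivative would spread to the whole line by the Harnack inequality, against
    strict monotonicity of the wave. *)
Lemma wvd_gt0 i x : 0 < wvd i x.
Proof.
have [N N0 [_ H]] := wv_harnack.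
rewrite lt0r wvd_ge0 andbT; apply/eqP => E.
have Z y : wvd i y = 0.
  by apply/eqP; rewrite eq_le wvd_ge0 andbT; have := H i x y; rewrite E mul0r.
have lt01 : (0 : R) < 1 by [].
have [z _] := derive_mvt (wv_d i) lt01.
by rewrite Z mul0r => /eqP; rewrite subr_eq0 gt_eqF// (@wv_incr i _ _ lt01).
Qed.

Lemma wv_asympt_left i : exists2 A, 0 < A & exists X, forall x, x <= X ->
  A / 2 * expR ((c - Num.sqrt (c ^+ 2 - 4 * alpha)) / 2 * x) <= wv i x <=
  2 * A * expR ((c - Num.sqrt (c ^+ 2 - 4 * alpha)) / 2 * x).
Proof.
have [A1 [A2 [A10 A20 H1 H2]]] := tw_asympt_left hw.
set la := (c - _) / 2 in H1 H2 *.
have key (f : R -> R) A : 0 < A -> f x / (A * expR (la * x)) @[x --> -oo] --> (1 : R) ->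
    exists X, forall x, x <= X -> A / 2 * expR (la * x) <= f x <= 2 * A * expR (la * x).
  move=> A0 Hf; apply: near_Noo.
  have h1 : 2^-1 < (1 : R) by lra.
  have h2 : (1 : R) < 2 by lra.
  have n1 : \forall x \near -oo, 2^-1 < f x / (A * expR (la * x)) by exact: cvgr_gt Hf _ h1.
  have n2 : \forall x \near -oo, f x / (A * expR (la * x)) < 2 by exact: cvgr_lt Hf _ h2.
  near=> x.
  have e0 : 0 < A * expR (la * x) by rewrite mulr_gt0// expR_gt0.
  have q1 : 2^-1 < f x / (A * expR (la * x)) by near: x.
  have q2 : f x / (A * expR (la * x)) < 2 by near: x.
  rewrite ltr_pdivlMr// in q1; rewrite ltr_pdivrMr// in q2.
  by apply/andP; split; lra.
case: i; [exists A1 => //; exact: key H1|exists A2 => //; exact: key H2].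
Unshelve. all: end_near. Qed.

Lemma wv_asympt_right i : exists2 A, 0 < A & exists X, forall x, X <= x ->
  top i - wv i x <= A * expR ((c - Num.sqrt (c ^+ 2 + 4 * alpha)) / 2 * x).
Proof.
have [A1 [A2 [A10 A20 H1 H2]]] := tw_asympt_right hw.
set la := (c - _) / 2 in H1 H2 *.
have key (f : R -> R) A : 0 < A -> f x / (A * expR (la * x)) @[x --> +oo] --> (1 : R) ->
    exists X, forall x, X <= x -> f x <= 2 * A * expR (la * x).
  move=> A0 Hf; apply: near_oo.
  have h2 : (1 : R) < 2 by lra.
  have n2 : \forall x \near +oo, f x / (A * expR (la * x)) < 2 by exact: cvgr_lt Hf _ h2.
  near=> x.
  have e0 : 0 < A * expR (la * x) by rewrite mulr_gt0// expR_gt0.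
  have q2 : f x / (A * expR (la * x)) < 2 by near: x.
  rewrite ltr_pdivrMr// in q2; lra.
case: i; [exists (2 * A1)|exists (2 * A2)]; rewrite ?mulr_gt0//; [exact: key H1|exact: key H2].
Unshelve. all: end_near. Qed.

(** The asymptotics are given for the wave and cannot be differentiated. The Harnack inequality
    compares the derivative at x with its value at a mean value point in [x, x + 1], hence with an
    increment of the wave. *)
Lemma wvd_le N : 0 <= N -> (forall i x y, wvd i y <= wvd i x * expR (N * `|x - y|)) ->
  forall i x, wvd i x <= expR N * (wv i (x + 1) - wv i x).
Proof.
move=> N0 H i x.
have lt1 : x < x + 1 by rewrite ltrDl.
have [z /andP[xz zx] E] := derive_mvt (wv_d i) lt1.
rewrite E (_ : x + 1 - x = 1); last by ring.
rewrite mulr1 mulrC; apply: (le_trans (H i z x)); apply: ler_wpM2l; first exact: wvd_ge0.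
rewrite ler_expR -[leRHS]mulr1; apply: ler_wpM2l => //.
by rewrite ger0_norm ?subr_ge0 ?(ltW xz)//; lra.
Qed.

Let al0 : 0 < alpha. Proof. by case/andP: ha. Qed.
Let al1 : alpha < 1. Proof. by case/andP: ha. Qed.
Let c0 : 0 < c.
Proof. by apply: le_lt_trans hc; rewrite mulr_ge0// sqrtr_ge0. Qed.
Let c2 : 4 * alpha < c ^+ 2.
Proof.
have -> : 4 * alpha = (2 * Num.sqrt alpha) ^+ 2 by rewrite exprMn sqr_sqrtr ?ltW//; ring.
by rewrite ltr_pXn2r// nnegrE ?mulr_ge0 ?sqrtr_ge0// ltW.
Qed.

Let la := (c - Num.sqrt (c ^+ 2 - 4 * alpha)) / 2.
Let la0 : 0 < la.
Proof.
rewrite /la divr_gt0// subr_gt0 -(@ltr_pXn2r _ 2)// ?nnegrE ?sqrtr_ge0 ?(ltW c0)//.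
by rewrite sqr_sqrtr; have := c2; have := al0; lra.
Qed.

Lemma s2_gt0 : 0 < s2. Proof. by case/andP: hs2 => h _; apply: lt_trans h; exact: la0. Qed.

(** [s2] lies strictly between the two roots of this polynomial, so e^(s2 x) is a strict
    supersolution of phi'' - c phi' + alpha phi = 0. *)
Lemma s2_char : s2 ^+ 2 - c * s2 + alpha < 0.
Proof.
case/andP: hs2; set s := Num.sqrt _ => h1 h2.
have S : s ^+ 2 = c ^+ 2 - 4 * alpha by rewrite sqr_sqrtr; have := c2; have := al0; lra.
have : (s2 - (c - s) / 2) * (s2 - (c + s) / 2) < 0 by rewrite pmulr_rlt0; lra.
have -> : (s2 - (c - s) / 2) * (s2 - (c + s) / 2) = s2 ^+ 2 - c * s2 + (c ^+ 2 - s ^+ 2) / 4 by field.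
by rewrite S; lra.
Qed.

(** [s1] is nonnegative and below the positive root; e^(-s1 x) is then a strict supersolution of
    phi'' - c phi' - alpha phi = 0. *)
Lemma s1_char : s1 ^+ 2 + c * s1 - alpha < 0.
Proof.
case/andP: hs1; set s := Num.sqrt _ => h1 h2.
have s0 : 0 <= s by exact: sqrtr_ge0.
have S : s ^+ 2 = c ^+ 2 + 4 * alpha by rewrite sqr_sqrtr; have := sqr_ge0 c; have := al0; lra.
have : (s1 - (- c - s) / 2) * (s1 - (- c + s) / 2) < 0 by rewrite pmulr_rlt0; have := c0; lra.
have -> : (s1 - (- c - s) / 2) * (s1 - (- c + s) / 2) = s1 ^+ 2 + c * s1 + (c ^+ 2 - s ^+ 2) / 4 by field.
by rewrite S; lra.
Qed.

(** Mean value theorem and Harnack inequality turn the two-sided asymptotics of the wave into a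
    lower bound of order e^(la x) for its derivative; as la < s2 this exceeds any multiple of e^(s2
    x) far enough to the left. *)
Lemma wvd_left X0 C : exists2 y, y < X0 & forall i, C * expR (s2 * y) <= wvd i y.
Proof.
have [N N0 [_ H]] := wv_harnack.
have key i : exists2 c1, 0 < c1 & exists X, forall x, x <= X -> c1 * expR (la * x) <= wvd i x.
  have [A A0 [X HX]] := wv_asympt_left i; rewrite -/la in HX.
  (* The asymptotics hold up to the factors 1/2 and 2; a step over which the exponential grows by 8
     > 4 guarantees a definite increment in spite of them. *)
  pose h := ln 8 / la.
  have h0 : 0 < h by apply: divr_gt0 => //; rewrite ln_gt0// (_ : 1 = 1%:R)// ltr_nat.
  have eh : expR (la * h) = 8 by rewrite /h mulrC divfK ?gt_eqF// lnK// posrE.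
  exists (A / 4 / h * expR (- (N * h))); first by apply: mulr_gt0; rewrite ?expR_gt0//; apply: divr_gt0 => //; apply: divr_gt0.
  exists X => x xX.
  have xh : x - h < x by rewrite ltrBlDr ltrDl.
  have /andP[B1 _] := HX x xX.
  have /andP[_ B2] := HX (x - h) (le_trans (ltW xh) xX).
  have E2 : expR (la * (x - h)) = expR (la * x) / 8.
    by rewrite mulrBr expRD expRN eh.
  rewrite E2 in B2.
  have [z /andP[xz zx] E] := derive_mvt (wv_d i) xh.
  have B3 : wvd i z <= wvd i x * expR (N * h).
    apply: (le_trans (H i x z)); apply: ler_wpM2l; first exact: wvd_ge0.
    by rewrite ler_expR; apply: ler_wpM2l => //; rewrite ger0_norm ?subr_ge0 ?(ltW zx)//; lra.
  have B4 : A / 4 * expR (la * x) <= wvd i z * h.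
    have EE : x - (x - h) = h by ring.
    rewrite EE in E; exact: (quarter_gap E B1 B2).
  rewrite mulrAC expRN ler_pdivrMr ?expR_gt0// mulrAC.
  by apply: le_trans B3; rewrite ler_pdivrMr.
have [a1 a10 [Y1 H1]] := key true; have [a2 a20 [Y2 H2]] := key false.
pose a := Num.min a1 a2.
have a0 : 0 < a by rewrite lt_min a10.
have sl : 0 < s2 - la by rewrite subr_gt0; case/andP: hs2.
have [Y3 H3] := @expR_ge_large R _ (C / a) sl.
pose y := Num.min (X0 - 1) (Num.min Y1 (Num.min Y2 Y3)).
have yX : y <= X0 - 1 by rewrite /y ge_min lexx.
have y1 : y <= Y1 by rewrite /y !ge_min lexx ?orbT.
have y2 : y <= Y2 by rewrite /y !ge_min lexx ?orbT.
have y3 : y <= Y3 by rewrite /y !ge_min lexx ?orbT.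
exists y; first by lra.
have Q : C * expR (s2 * y) <= a * expR (la * y).
  have := H3 y y3; rewrite ler_pdivrMr// => h.
  have h2 := ler_wpM2r (expR_ge0 (s2 * y)) h; apply: (le_trans h2).
  by rewrite mulrAC -expRD (_ : - ((s2 - la) * y) + s2 * y = la * y) 1?mulrC//; ring.
move=> i; apply: (le_trans Q); case: i.
  by apply: le_trans (H1 _ y1); apply: ler_wpM2r; rewrite ?expR_ge0// /a ge_min lexx.
by apply: le_trans (H2 _ y2); apply: ler_wpM2r; rewrite ?expR_ge0// /a ge_min lexx orbT.
Qed.

(** The wave approaches its limit at a rate faster than [s1], and [wvd_le] hands this rate on to the
    derivative. *)
Lemma wvd_right : exists2 Cp, 0 <= Cp & exists X1, forall i x, X1 <= x ->
  wvd i x <= Cp * expR (- (s1 * x)).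
Proof.
have [N N0 [_ H]] := wv_harnack.
have W := wvd_le N0 H.
have key i : exists2 C, 0 <= C & exists X, forall x, X <= x -> wvd i x <= C * expR (- (s1 * x)).
  have [A A0 [X HX]] := wv_asympt_right i.
  exists (expR N * A); first by rewrite mulr_ge0 ?expR_ge0// ltW.
  exists (Num.max X 0) => x; rewrite ge_max => /andP[xX x0].
  apply: (le_trans (W i x)); rewrite -mulrA; apply: ler_wpM2l; first exact: expR_ge0.
  apply: (@le_trans _ _ (top i - wv i x)); first by rewrite lerD2r ltW// wv_lt.
  apply: (le_trans (HX x xX)); apply: ler_wpM2l; first exact: ltW.
  rewrite ler_expR -mulNr; apply: ler_wpM2r => //.
  by case/andP: hs1; lra.
have [C1 C10 [Y1 H1]] := key true; have [C2 C20 [Y2 H2]] := key false.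
exists (C1 + C2); first exact: addr_ge0.
exists (Num.max Y1 Y2) => i x; rewrite ge_max => /andP[x1 x2]; rewrite mulrDl.
have e1 : 0 <= C1 * expR (- (s1 * x)) by rewrite mulr_ge0// expR_ge0.
have e2 : 0 <= C2 * expR (- (s1 * x)) by rewrite mulr_ge0// expR_ge0.
by case: i; [have := H1 x x1; lra|have := H2 x x2; lra].
Qed.

Lemma wvd_bounded : exists Pm, forall i x, wvd i x <= Pm.
Proof.
have [N N0 [_ H]] := wv_harnack.
have W := wvd_le N0 H.
exists (expR N * (K + 1)) => i x; apply: (le_trans (W i x)).
apply: ler_wpM2l; first exact: expR_ge0.
have := wv_lt i (x + 1); have := wv_gt0 i x; have := K0; rewrite /top; case: i; lra.
Qed.

Lemma left_coeffs (e : R) : 0 < e -> exists X0, forall x, x <= X0 ->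
  [/\ Dgw true x <= 0, Ofw true x <= 1, Ofw false x <= e & Dgw false x <= alpha + e].
Proof.
move=> e0; apply: near_Noo.
have [F1 F2 F3 F4] := Fa_left ha hk.
have d0 : 1 + k * (Kstar alpha k - 0) != 0.
  by rewrite gt_eqF//; apply: lt_le_trans (den_ge1 hk _) => //; exact: ltW.
have L i j : Fa alpha k i j (wv true x) (wv false x) @[x --> -oo] --> Fa alpha k i j 0 0.
  by apply: cvg_Fa => //; [exact: (@wv_left true)|exact: (@wv_left false)].
have n1 : \forall x \near -oo, Fa alpha k true true (wv true x) (wv false x) < 0 by exact: cvgr_lt (L true true) _ F1.
have n2 : \forall x \near -oo, Fa alpha k true false (wv true x) (wv false x) < 1.
  by apply: cvgr_lt (L true false) _ _; rewrite F2; have := al0; lra.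
have n3 : \forall x \near -oo, Fa alpha k false true (wv true x) (wv false x) < e.
  by apply: cvgr_lt (L false true) _ _; rewrite F3; lra.
have n4 : \forall x \near -oo, Fa alpha k false false (wv true x) (wv false x) < alpha + e.
  by apply: cvgr_lt (L false false) _ _; rewrite F4; have := al1; lra.
near=> x; split; apply: ltW.
- by near: x.
- by near: x.
- by near: x.
- by near: x.
Unshelve. all: end_near. Qed.

Lemma right_coeffs (e : R) : 0 < e -> exists X0, forall x, X0 <= x ->
  [/\ Dgw true x <= - alpha + e, Ofw true x <= e, Ofw false x <= 1 & Dgw false x <= - 1 + (1 - alpha) / 2].
Proof.
move=> e0; apply: near_oo.
have [F1 F2 F3 F4] := Fa_right alpha k.
have d0 : 1 + k * (Kstar alpha k - K) != 0.
  by rewrite gt_eqF//; apply: lt_le_trans (den_ge1 hk _) => //.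
have L i j : Fa alpha k i j (wv true x) (wv false x) @[x --> +oo] --> Fa alpha k i j K 1.
  by apply: cvg_Fa => //; [exact: (@wv_right true)|exact: (@wv_right false)].
have k0 : 0 < k by case/andP: hk.
have n1 : \forall x \near +oo, Fa alpha k true true (wv true x) (wv false x) < - alpha + e.
  by apply: cvgr_lt (L true true) _ _; rewrite F1; lra.
have n2 : \forall x \near +oo, Fa alpha k true false (wv true x) (wv false x) < e.
  by apply: cvgr_lt (L true false) _ _; rewrite F2; lra.
have n3 : \forall x \near +oo, Fa alpha k false true (wv true x) (wv false x) < 1.
  by apply: cvgr_lt (L false true) _ _; rewrite F3; lra.
have n4 : \forall x \near +oo, Fa alpha k false false (wv true x) (wv false x) < - 1 + (1 - alpha) / 2.
  by apply: cvgr_lt (L false false) _ _; rewrite F4; have := al1; lra.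
near=> x; split; apply: ltW.
- by near: x.
- by near: x.
- by near: x.
- by near: x.
Unshelve. all: end_near. Qed.

Lemma wave_supersolution : exists (Ph : bool -> R -> R) (b k1 k2 : R),
  [/\ [/\ 0 < b, 0 < k1 & 0 < k2], forall i, continuous (Ph i), forall i x, 0 < Ph i x,
   forall i x, k1 <= weight s1 s2 x * Ph i x <= k2 &
   forall i x, touch c (Ph i) x (- b * Ph i x - Dgw i x * Ph i x - Ofw i x * Ph (~~ i) x)].
Proof.
have [N N0 [HN _]] := wv_harnack.
have [Pm HPm] := wvd_bounded.
have [Cp Cp0 [X1 HX1]] := wvd_right.
pose de := - (s2 ^+ 2 - c * s2 + alpha).
have de0 : 0 < de by rewrite oppr_gt0 s2_char.
pose ga := - (s1 ^+ 2 + c * s1 - alpha).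
have ga0 : 0 < ga by rewrite oppr_gt0 s1_char.
have s10 : 0 <= s1 by case/andP: hs1.
have k0 : 0 < k by case/andP: hk.
(* On the left the first component receives at most 1 from the second; the value 2 / alpha makes its
   damping 2 outweigh this. The feedback on the second component carries a coefficient that vanishes
   at -oo. On the right the roles are exchanged, with 4 / (1 - alpha). *)
pose lv (i : bool) := if i then 2 / alpha else 1.
pose rv (i : bool) := if i then 1 else 4 / (1 - alpha).
have om : 0 < 1 - alpha by have := al1; lra.
have lvt : lv true = 2 / alpha by [].
have lvf : lv false = 1 by [].
have rvt : rv true = 1 by [].
have rvf : rv false = 4 / (1 - alpha) by [].
have lv0 i : 0 < lv i by case: i; rewrite /lv ?divr_gt0.
have rv0 i : 0 < rv i by case: i; rewrite /rv ?divr_gt0.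
(* One quarter of the margin [de] for the diagonal error and one for the feedback multiplied by 2 /
   alpha, which leaves de / 2. [e2] is chosen alike. *)
pose e1 := Num.min (de / 4) (de / 4 / (2 / alpha)).
have e10 : 0 < e1 by rewrite lt_min !divr_gt0.
have [X0 L0] := left_coeffs e10.
pose e2 := Num.min (ga / 4) (ga / 4 / (4 / (1 - alpha))).
have e20 : 0 < e2 by rewrite lt_min !divr_gt0.
have [X2 R0] := right_coeffs e20.
pose bl := Num.min (alpha / 2) (de / 2).
have bl0 : 0 < bl by rewrite lt_min !divr_gt0.
have br0 : 0 < ga / 2 by rewrite divr_gt0.
have LS i x : x <= X0 ->
     (s2 ^+ 2 - c * s2) * lv i + Dgw i x * lv i + Ofw i x * lv (~~ i) <= - bl * lv i.
  move=> /L0[q1 q2 q3 q4].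
  have E : s2 ^+ 2 - c * s2 = - alpha - de by rewrite /de; ring.
  rewrite E.
  have b1 : bl <= alpha / 2 by rewrite ge_min lexx.
  have b2 : bl <= de / 2 by rewrite ge_min lexx orbT.
  have f1 : e1 <= de / 4 by rewrite ge_min lexx.
  have f2 : e1 <= de / 4 / (2 / alpha) by rewrite ge_min lexx orbT.
  rewrite ler_pdivlMr ?divr_gt0// in f2.
  have a2 : 0 < 2 / alpha by rewrite divr_gt0.
  case: i; rewrite [~~ _]/= ?lvt ?lvf.
    have h1 : bl * (2 / alpha) <= 1.
      apply: (le_trans (ler_wpM2r (ltW a2) b1)); rewrite le_eqVlt; apply/orP; left; apply/eqP; field.
      by rewrite gt_eqF.
    have h2 : Dgw true x * (2 / alpha) <= 0 by rewrite mulr_le0_ge0// ltW.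
    have h3 : alpha * (2 / alpha) = 2 by field; rewrite gt_eqF.
    have h4 : 0 < de * (2 / alpha) by exact: mulr_gt0.
    lra.
  have h1 := ler_wpM2r (ltW a2) q3.
  lra.
have RS i x : Num.max X1 X2 <= x ->
     (s1 ^+ 2 + c * s1) * rv i + Dgw i x * rv i + Ofw i x * rv (~~ i) <= - (ga / 2) * rv i.
  rewrite ge_max => /andP[_ /R0[q1 q2 q3 q4]].
  have E : s1 ^+ 2 + c * s1 = alpha - ga by rewrite /ga; ring.
  rewrite E.
  have f1 : e2 <= ga / 4 by rewrite ge_min lexx.
  have f2 : e2 <= ga / 4 / (4 / (1 - alpha)) by rewrite ge_min lexx orbT.
  rewrite ler_pdivlMr ?divr_gt0// in f2.
  have a2 : 0 < 4 / (1 - alpha) by rewrite divr_gt0.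
  case: i; rewrite [~~ _]/= ?rvt ?rvf.
    have h1 := ler_wpM2r (ltW a2) q2; lra.
  have h1 := ler_wpM2r (ltW a2) q4.
  have h3 : (1 - alpha) * (4 / (1 - alpha)) = 4 by field; rewrite gt_eqF.
  have h4 : 0 < ga * (4 / (1 - alpha)) by exact: mulr_gt0.
  lra.
have eq0 i x : ddp i x - c * dp i x + Dgw i x * wvd i x + Ofw i x * wvd (~~ i) x = 0.
  by rewrite /ddp; ring.
have RP i x : Num.max X1 X2 <= x -> wvd i x <= Cp * expR (- (s1 * x)).
  by rewrite ge_max => /andP[h _]; exact: HX1.
exact: (supersolution_exists s10 s2_gt0 N0 wvd_gt0 HPm pd dp_d HN eq0 Ofw_ge0 Dgw_le Ofw_le
  lv0 bl0 LS rv0 br0 RS (wvd_left X0) Cp0 RP).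
Qed.

End wave.

(** * Truncation and Taylor expansion of the nonlinearity *)

Section truncation.
Context {R : realType}.

(** The truncation is an antiderivative of a trapezoidal cut-off, 1 up to h and 0 beyond 2 h. It is
    C^1, as the regularity of the Picard limit demands, where a clipped identity would not be. *)
Lemma truncation_exists (h : R) : 0 < h -> exists tau dtau : R -> R,
  [/\ continuous dtau, forall x : R, is_derive x 1 tau (dtau x), forall x, `|dtau x| <= 1,
      forall x, `|x| <= h -> tau x = x & forall x, `|tau x| <= 2 * h].
Proof.
move=> h0.
pose dtau (x : R) := Num.max 0 (Num.min 1 (2 - `|x| / h)).
have cd : continuous dtau.
  move=> x; apply: (@continuous_max _ _ (fun=> 0 : R) (fun x => Num.min 1 (2 - `|x| / h))); first exact: cvg_cst.
  apply: (@continuous_min _ _ (fun=> 1 : R) (fun x => 2 - `|x| / h)); first exact: cvg_cst.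
  apply: cvgB; first exact: cvg_cst.
  by apply: cvgMl; apply: cvg_norm; exact: cvg_id.
have [G HG] := continuous_antiderivative cd.
pose tau x := G x - G 0.
have HD (x : R) : is_derive x 1 tau (dtau x).
  by have := is_deriveB (HG x) (is_derive_cst (G 0) x 1); rewrite subr0.
have d0 x : 0 <= dtau x by rewrite /dtau le_max lexx.
have d1 x : dtau x <= 1 by rewrite /dtau ge_max ler01 ge_min lexx.
have t0 : tau 0 = 0 by rewrite /tau subrr.
have din x : `|x| <= h -> dtau x = 1.
  move=> xh; have : `|x| / h <= 1 by rewrite ler_pdivrMr// mul1r.
  move=> h1; rewrite /dtau (min_idPl _); last lra.
  by apply/max_idPr; exact: ler01.
have dout x : 2 * h <= `|x| -> dtau x = 0.
  move=> xh; have h1 : 2 <= `|x| / h by rewrite ler_pdivlMr.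
  rewrite /dtau; apply/max_idPl; rewrite ge_min; apply/orP; right; lra.
have le1 x : `|tau x| <= `|x|.
  by have := is_derive_lipschitz HD (fun y => _ : `|dtau y| <= 1) 0 x; rewrite t0 !subr0 mul1r; apply => y; rewrite ger0_norm.
exists tau, dtau; split => //.
- by move=> x; rewrite ger0_norm.
- move=> x xh.
  have [x0|x0|->//] := ltgtP x 0.
    have [z /andP[z1 z2] E] := derive_mvt HD x0.
    rewrite din in E; first by rewrite t0 in E; lra.
    rewrite ltr0_norm//; apply: le_trans xh; rewrite ltr0_norm// lerN2; exact: ltW.
  have [z /andP[z1 z2] E] := derive_mvt HD x0.
  rewrite din in E; first by rewrite t0 in E; lra.
  rewrite gtr0_norm//; apply: le_trans xh; rewrite gtr0_norm//; exact: ltW.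
- move=> x; have [xh|xh] := leP `|x| (2 * h); first exact: le_trans (le1 x) xh.
  have hh : `|2 * h| = 2 * h by rewrite ger0_norm// mulr_ge0// ltW.
  have [x0|x0] := leP 0 x.
    rewrite ger0_norm// in xh.
    have [z /andP[z1 z2] E] := derive_mvt HD xh.
    rewrite dout ?mul0r in E; last by rewrite ger0_norm ?(ltW z1)//; apply: le_trans (ltW z1); rewrite mulr_ge0// ltW.
    by move/eqP: E; rewrite subr_eq0 => /eqP->; rewrite -[leRHS]hh; exact: le1.
  rewrite ltr0_norm// in xh.
  have xh' : x < - (2 * h) by lra.
  have [z /andP[z1 z2] E] := derive_mvt HD xh'.
  rewrite dout ?mul0r in E; last first.
    rewrite ltr0_norm; first by lra.
    by apply: (lt_trans z2); rewrite oppr_lt0 mulr_gt0.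
  by move/eqP: E; rewrite subr_eq0 => /eqP<-; apply: (le_trans (le1 _)); rewrite normrN hh.
Qed.

End truncation.

Section box.
Context {R : realType}.
Variables alpha k : R.
Hypotheses (ha : 0 < alpha < 1) (hk : 0 < k < 1).
Let K : R := Kstar alpha k.
Let den (a : R) := 1 + k * (K - a).
Let quo (a b : R) := (K - a + b) / den a.
Let K0 : 0 < K. Proof. exact: K_gt0. Qed.
Let k0 : 0 < k. Proof. by case/andP: hk. Qed.
Let k1 : k < 1. Proof. by case/andP: hk. Qed.
Let al0 : 0 < alpha. Proof. by case/andP: ha. Qed.
Let al1 : alpha < 1. Proof. by case/andP: ha. Qed.

(* A neighbourhood of the range of the wave on which the denominator of F is at
   least 1/2. *)
Definition inbox (a b : R) : Prop := -1 <= a <= Kstar alpha k + 2^-1 /\ -1 <= b <= 2.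

Lemma inbox_den a b : inbox a b -> 2^-1 <= 1 + k * (Kstar alpha k - a).
Proof.
move=> [/andP[_ a1] _].
have h : - 2^-1 <= k * (K - a).
  have [h|h] := leP 0 (K - a); first by have := mulr_ge0 (ltW k0) h; lra.
  have := k1; have := k0; have : (1 - k) * (K - a) <= 0 by rewrite mulr_ge0_le0 ?subr_ge0 ?(ltW k1)// ltW.
  rewrite -/K in a1; lra.
rewrite -/K; lra.
Qed.

Let inv2 a b : inbox a b -> 0 < (den a)^-1 <= 2.
Proof.
move=> ab; have h := inbox_den ab; have d0 : 0 < den a by apply: lt_le_trans h.
rewrite invr_gt0 d0/= -[leRHS]invrK lef_pV2 ?posrE ?invr_gt0//.
Qed.

Let den_le a b : inbox a b -> `|den a| <= K + 2.
Proof.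
move=> ab; have h := inbox_den ab; have [/andP[a0 a1] _] := ab.
rewrite ger0_norm; last by apply: le_trans h; rewrite invr_ge0.
have : k * (K - a) <= K + 1.
  have [h2|h2] := leP 0 (K - a); last by have := mulr_ge0_le0 (ltW k0) (ltW h2); have := K0; lra.
  have : (1 - k) * (K - a) >= 0 by rewrite mulr_ge0// subr_ge0 ltW.
  lra.
rewrite /den; lra.
Qed.

Let kb_le a b : inbox a b -> `|1 - k * b| <= 3.
Proof.
move=> [_ /andP[b0 b1]]; have e1 : `|k * b| <= 2.
  rewrite normrM (gtr0_norm k0) -[leRHS]mul1r; apply: ler_pM => //; first exact: ltW.
    exact: ltW.
  by rewrite ler_norml; apply/andP; split; lra.
by apply: (le_trans (ler_normB _ _)); rewrite normr1; lra.
Qed.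

Let w_le a b : inbox a b -> `|K - a| <= K + 1.
Proof. by move=> [/andP[a0 a1] _]; rewrite -/K in a1; rewrite ler_norml; have := K0; lra. Qed.

Let b_le a b : inbox a b -> `|b| <= 2.
Proof. by move=> [_ /andP[b0 b1]]; rewrite ler_norml; lra. Qed.

Let normMinv a b x : inbox a b -> `|x / den a| <= 2 * `|x|.
Proof.
move=> ab; have /andP[h1 h2] := inv2 ab.
by rewrite normrM (gtr0_norm h1) mulrC; apply: ler_wpM2r.
Qed.

Let Qm := 2 * (K + 3).
Let quo_le a b : inbox a b -> `|quo a b| <= Qm.
Proof.
move=> ab; apply: (le_trans (normMinv _ ab)); rewrite /Qm; apply: ler_wpM2l => //.
by apply: (le_trans (ler_normD _ _)); have := w_le ab; have := b_le ab; lra.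
Qed.

(** Numerator of the differential of [quo]: applied to (x, y), that differential is [lin] /
    [den]^2. *)
Let lin (a b x y : R) := - x * (1 - k * b) + y * den a.
Let Ql := K + 5.
Let lin_le a b x y : inbox a b -> `|lin a b x y| <= Ql * (`|x| + `|y|).
Proof.
move=> ab; apply: (le_trans (ler_normD _ _)); rewrite (mulrDr Ql) (normrM (- x)) (normrM y) (normrN x).
have h1 := ler_wpM2l (normr_ge0 x) (kb_le ab).
have h2 := ler_wpM2l (normr_ge0 y) (den_le ab).
have h3 := mulr_ge0 (ltW K0) (normr_ge0 x); have := normr_ge0 x; have := normr_ge0 y.
rewrite /Ql; lra.
Qed.

Let den_neq0 a b : inbox a b -> den a != 0.
Proof. by move=> ab; have h := inbox_den ab; rewrite gt_eqF//; apply: lt_le_trans h. Qed.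

Let quo_diff a b a' b' : inbox a b -> inbox a' b' ->
  quo a' b' - quo a b = lin a b (a' - a) (b' - b) / den a / den a'.
Proof.
move=> /den_neq0 h /den_neq0 h'; rewrite /quo /lin /den in h h' *; field.
by rewrite h h'.
Qed.

(** As [quo] is a quotient of affine functions its Taylor remainder is an explicit product of two
    increments, and no second derivatives have to be estimated. *)
Let quo_rem a b a' b' : inbox a b -> inbox a' b' ->
  quo a' b' - quo a b - lin a b (a' - a) (b' - b) / den a ^+ 2 =
  k * (a' - a) * (lin a b (a' - a) (b' - b) / den a / den a / den a').
Proof.
move=> /den_neq0 h /den_neq0 h'; rewrite /quo /lin /den in h h' *; field.
by rewrite h h'.
Qed.

Let quo_lip a b a' b' : inbox a b -> inbox a' b' ->
  `|quo a' b' - quo a b| <= 4 * Ql * (`|a' - a| + `|b' - b|).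
Proof.
move=> ab ab'; rewrite quo_diff//.
have := normMinv (lin a b (a' - a) (b' - b) / den a) ab'.
have := normMinv (lin a b (a' - a) (b' - b)) ab.
have := lin_le (a' - a) (b' - b) ab; lra.
Qed.

Let quo_rem_le a b a' b' : inbox a b -> inbox a' b' ->
  `|quo a' b' - quo a b - lin a b (a' - a) (b' - b) / den a ^+ 2| <=
  8 * Ql * (`|a' - a| + `|b' - b|) ^+ 2.
Proof.
move=> ab ab'; rewrite quo_rem//.
set l := lin _ _ _ _; set s := `|a' - a| + `|b' - b|.
have h1 : `|l / den a / den a / den a'| <= 8 * Ql * s.
  have := normMinv (l / den a / den a) ab'.
  have := normMinv (l / den a) ab.
  have := normMinv l ab.
  have := lin_le (a' - a) (b' - b) ab; rewrite -/l -/s; lra.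
have h2 : `|k * (a' - a)| <= s.
  rewrite normrM (gtr0_norm k0) /s.
  have := normr_ge0 (b' - b); have := ler_wpM2r (normr_ge0 (a' - a)) (ltW k1); lra.
rewrite normrM [leRHS](_ : _ = s * (8 * Ql * s)); last by ring.
by apply: ler_pM.
Qed.

Let Ql0 : 0 <= Ql. Proof. by rewrite /Ql; have := K0; lra. Qed.
Let Qm0 : 0 <= Qm. Proof. by rewrite /Qm; have := K0; lra. Qed.

Lemma Fc_lip : exists2 L, 0 <= L & forall i a b a' b', inbox a b -> inbox a' b' ->
  `|Fc alpha k i a' b' - Fc alpha k i a b| <= L * (`|a' - a| + `|b' - b|).
Proof.
pose L := 2 + Qm + 4 * Ql * (K + 2).
have LL : 0 <= 4 * Ql * K by apply: mulr_ge0; [exact: mulr_ge0|exact: ltW].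
exists L; first by rewrite /L; have := Qm0; have := Ql0; lra.
move=> i a b a' b' ab ab'.
have q1 := quo_lip ab ab'; have q2 := quo_le ab'; have q3 := w_le ab; have q4 := b_le ab.
set s := `|a' - a| + `|b' - b| in q1 *.
have s0 : 0 <= s by rewrite addr_ge0.
have E1 : `|a' - a| <= s by rewrite lerDl.
have E2 : `|b' - b| <= s by rewrite lerDr.
case: i.
- have -> : Fc alpha k true a' b' - Fc alpha k true a b =
     (a' - a) * (1 - alpha - quo a' b') + (K - a) * (quo a' b' - quo a b).
    by rewrite /Fc /F /quo /den /denom /K /=; ring.
  have h1 : `|(a' - a) * (1 - alpha - quo a' b')| <= s * (1 + Qm).
    rewrite normrM; apply: ler_pM => //; apply: (le_trans (ler_normB _ _)); apply: lerD => //.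
    by rewrite ger0_norm ?subr_ge0 ?ltW//; have := al0; lra.
  have h2 : `|(K - a) * (quo a' b' - quo a b)| <= (K + 1) * (4 * Ql * s).
    by rewrite normrM; apply: ler_pM.
  apply: (le_trans (ler_normD _ _)); rewrite /L.
  have := mulr_ge0 (mulr_ge0 (ler0n _ 4) Ql0) s0; lra.
- have -> : Fc alpha k false a' b' - Fc alpha k false a b =
     (b' - b) * (1 - quo a' b') - b * (quo a' b' - quo a b).
    by rewrite /Fc /F /quo /den /denom /K /=; ring.
  have h1 : `|(b' - b) * (1 - quo a' b')| <= s * (1 + Qm).
    by rewrite normrM; apply: ler_pM => //; apply: (le_trans (ler_normB _ _)); rewrite normr1 lerD2l.
  have h2 : `|b * (quo a' b' - quo a b)| <= 2 * (4 * Ql * s).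
    by rewrite normrM; apply: ler_pM.
  apply: (le_trans (ler_normB _ _)); rewrite /L.
  have := mulr_ge0 LL s0; lra.
Qed.

(** Each component of F is an affine function times one minus [quo], up to constants. Its remainder
    is thus a product of two increments plus an affine factor times the remainder of [quo]. *)
Lemma Fc_taylor : exists2 C, 0 <= C & forall i a b a' b', inbox a b -> inbox a' b' ->
  `|Fc alpha k i a' b' - Fc alpha k i a b -
    (Fa alpha k i true a b * (a' - a) + Fa alpha k i false a b * (b' - b))|
  <= C * (`|a' - a| + `|b' - b|) ^+ 2.
Proof.
pose L := 4 * Ql + 8 * Ql * (K + 2).
have LL : 0 <= Ql * K by apply: mulr_ge0; [|exact: ltW].
exists L; first by rewrite /L; have := Ql0; lra.
move=> i a b a' b' ab ab'.
have q1 := quo_lip ab ab'; have q2 := quo_rem_le ab ab'; have q3 := w_le ab; have q4 := b_le ab.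
have d0 := den_neq0 ab; have d0' := den_neq0 ab'.
set s := `|a' - a| + `|b' - b| in q1 q2 *.
have s0 : 0 <= s by rewrite addr_ge0.
have s2 : 0 <= Ql * s ^+ 2 by rewrite mulr_ge0// sqr_ge0.
have s3 : 0 <= Ql * K * s ^+ 2 by rewrite mulr_ge0// sqr_ge0.
have E1 : `|a' - a| <= s by rewrite lerDl.
have E2 : `|b' - b| <= s by rewrite lerDr.
set rem := (X in `|X| <= 8 * _ * _) in q2.
case: i.
- have -> : Fc alpha k true a' b' - Fc alpha k true a b -
    (Fa alpha k true true a b * (a' - a) + Fa alpha k true false a b * (b' - b)) =
    - ((a' - a) * (quo a' b' - quo a b)) + (K - a) * rem.
    by rewrite /rem /lin /Fc /F /Fa /quo /den /denom /K /= in d0 d0' *; field; rewrite d0 d0'.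
  have h1 : `|(a' - a) * (quo a' b' - quo a b)| <= s * (4 * Ql * s).
    by rewrite normrM; apply: ler_pM.
  have h2 : `|(K - a) * rem| <= (K + 1) * (8 * Ql * s ^+ 2).
    by rewrite normrM; apply: ler_pM.
  apply: (le_trans (ler_normD _ _)); rewrite normrN /L; lra.
- have -> : Fc alpha k false a' b' - Fc alpha k false a b -
    (Fa alpha k false true a b * (a' - a) + Fa alpha k false false a b * (b' - b)) =
    - ((b' - b) * (quo a' b' - quo a b)) - b * rem.
    by rewrite /rem /lin /Fc /F /Fa /quo /den /denom /K /= in d0 d0' *; field; rewrite d0 d0'.
  have h1 : `|(b' - b) * (quo a' b' - quo a b)| <= s * (4 * Ql * s).
    by rewrite normrM; apply: ler_pM.
  have h2 : `|b * rem| <= 2 * (8 * Ql * s ^+ 2).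
    by rewrite normrM; apply: ler_pM.
  apply: (le_trans (ler_normB _ _)); rewrite normrN /L; lra.
Qed.

Lemma Fa_box_bound : exists2 C, 0 <= C & forall i j a b, inbox a b -> `|Fa alpha k i j a b| <= C.
Proof.
exists (1 + Qm + 12 * (K + 2)); first by have := Qm0; have := K0; lra.
move=> i j a b ab.
have q2 := quo_le ab; have q3 := w_le ab; have q4 := b_le ab; have q5 := kb_le ab.
have e1 X Y : `|X| <= Y -> `|X * (1 - k * b) / den a ^+ 2| <= 12 * Y.
  move=> XY; rewrite expr2 invfM mulrA.
  have := normMinv (X * (1 - k * b) / den a) ab.
  have := normMinv (X * (1 - k * b)) ab.
  have : `|X * (1 - k * b)| <= Y * 3 by rewrite normrM; apply: ler_pM.
  lra.
have a1 : `|1 - alpha| <= 1 by rewrite ger0_norm ?subr_ge0 ?ltW//; have := al0; lra.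
have KK := K0; have QQ := Qm0.
case: i; case: j; rewrite /Fa -/K -/(den a) -/(quo a b).
- apply: (le_trans (ler_normB _ _)); have := e1 _ _ q3.
  have := ler_normB (1 - alpha) (quo a b); lra.
- have := normMinv (K - a) ab; lra.
- have := e1 _ _ q4; lra.
- apply: (le_trans (ler_normB _ _)); have := normMinv b ab.
  have := ler_normB 1 (quo a b); rewrite normr1; lra.
Qed.

End box.

(** * The truncated nonlinearity of the perturbation equation *)

Section truncated.
Context {R : realType}.
Variables (alpha k c : R) (U : R -> R * R).
Hypotheses (ha : 0 < alpha < 1) (hk : 0 < k < 1).
Hypothesis hw : traveling_wave alpha k c U.

Local Notation u := (wv U true).
Local Notation v := (wv U false).

Lemma wave_box x y z : `|y| <= 2^-1 -> `|z| <= 2^-1 -> inbox alpha k (u x + y) (v x + z).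
Proof.
rewrite !ler_norml => /andP[y1 y2] /andP[z1 z2].
have := wv_gt0 hw true x; have := wv_lt hw true x.
have := wv_gt0 hw false x; have := wv_lt hw false x => q1 q2 q3 q4.
by rewrite /inbox; split; apply/andP; split; lra.
Qed.

Lemma wave_box0 x : inbox alpha k (u x) (v x).
Proof.
by have := @wave_box x 0 0; rewrite normr0 !addr0; apply; rewrite invr_ge0.
Qed.

(** N is the increment of F from the wave, evaluated at the truncated perturbation. With h <= 1/4
    the truncation has size at most 1/2, so the argument stays in [inbox], where F is smooth and
    Lipschitz. [a0] is the explicit x-dependence through the wave, [a1] and [a2] are the partial
    derivatives in the perturbation. *)
Lemma truncated_nonlinearity h : 0 < h <= 4^-1 ->
  exists (N a0 a1 a2 : bool -> R -> R -> R -> R) (L0 Ca : R),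
  [/\ [/\ 0 <= L0, forall i, cont3 (N i),
       forall i x w1 w2 v1 v2, `|N i x w1 w2 - N i x v1 v2| <= L0 * (`|w1 - v1| + `|w2 - v2|) &
       forall i x, N i x 0 0 = 0],
      [/\ forall i, cont3 (a0 i), forall i, cont3 (a1 i) & forall i, cont3 (a2 i)],
      [/\ forall i x y z, `|a0 i x y z| <= Ca, forall i x y z, `|a1 i x y z| <= Ca &
          forall i x y z, `|a2 i x y z| <= Ca],
      forall i (f g : R -> R) (x p q : R), is_derive x 1 f p -> is_derive x 1 g q ->
        is_derive x 1 (fun y => N i y (f y) (g y))
          (a0 i x (f x) (g x) + a1 i x (f x) (g x) * p + a2 i x (f x) (g x) * q) &
      forall i x w1 w2, `|w1| <= h -> `|w2| <= h ->
        N i x w1 w2 = Fc alpha k i (u x + w1) (v x + w2) - Fc alpha k i (u x) (v x)].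
Proof.
move=> /andP[h0 h4].
have [tau [dtau [cdt Dt dt1 tid tle]]] := truncation_exists h0.
have ct : continuous tau by exact: is_derive_continuous Dt.
have tle2 x : `|tau x| <= 2^-1 by apply: (le_trans (tle x)); lra.
have box x w1 w2 : inbox alpha k (u x + tau w1) (v x + tau w2) by exact: wave_box.
have den x w1 (w2 : R) : 1 + k * (Kstar alpha k - (u x + tau w1)) != 0.
  by have h5 := inbox_den hk (box x w1 w2); rewrite gt_eqF//; apply: lt_le_trans h5; rewrite invr_gt0.
have den0 x : 1 + k * (Kstar alpha k - u x) != 0.
  by have h5 := inbox_den hk (wave_box0 x); rewrite gt_eqF//; apply: lt_le_trans h5; rewrite invr_gt0.
have [L L_ge0 HL] := Fc_lip ha hk.
have [B B0 HB] := Fa_box_bound ha hk.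
have [Pm HP] := wvd_bounded ha hk hw.
have Pm0 : 0 <= Pm by apply: le_trans (HP true 0); exact: wvd_ge0 hw _ _.
have dP i x : `|wvd U i x| <= Pm by rewrite ger0_norm ?HP//; exact: wvd_ge0 hw _ _.
have cu i : continuous (wv U i) by exact: is_derive_continuous (wv_d hw i).
have cd i : continuous (wvd U i) by exact: is_derive_continuous (wvd_d hw i).
pose N i x w1 w2 := Fc alpha k i (u x + tau w1) (v x + tau w2) - Fc alpha k i (u x) (v x).
pose D i j x w1 w2 := Fa alpha k i j (u x + tau w1) (v x + tau w2).
pose a0 i x w1 w2 := (D i true x w1 w2 - Fa alpha k i true (u x) (v x)) * wvd U true x +
  (D i false x w1 w2 - Fa alpha k i false (u x) (v x)) * wvd U false x.
pose a1 i x w1 w2 := D i true x w1 w2 * dtau w1.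
pose a2 i x w1 w2 := D i false x w1 w2 * dtau w2.
have c1 (f : R -> R) (p : R * R * R) : continuous f -> f q.1.1 @[q --> p] --> f p.1.1.
  move=> cf; apply: (cvg_fun (h := f)); first exact: cf.
  by apply: (@cvg_comp _ _ _ fst fst _ (nbhs p.1)); [exact: cvg_fst|case: p.1 => a b; exact: cvg_fst].
have c2 (f : R -> R) (p : R * R * R) : continuous f -> f q.1.2 @[q --> p] --> f p.1.2.
  move=> cf; apply: (cvg_fun (h := f)); first exact: cf.
  by apply: (@cvg_comp _ _ _ fst snd _ (nbhs p.1)); [exact: cvg_fst|case: p.1 => a b; exact: cvg_snd].
have c3 (f : R -> R) (p : R * R * R) : continuous f -> f q.2 @[q --> p] --> f p.2.
  by move=> cf; apply: (cvg_fun (h := f)); [exact: cf|exact: cvg_snd].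
have cD i j : cont3 (D i j).
  move=> x y z; apply: cvg_Fa; first exact: den.
    by apply: cvgD; [exact: (@c1 _ (x, y, z))|exact: (@c2 _ (x, y, z))].
  by apply: cvgD; [exact: (@c1 _ (x, y, z))|exact: (@c3 _ (x, y, z))].
have cA i j x y z : Fa alpha k i j (u p.1.1) (v p.1.1) @[p --> ((x, y, z) : R * R * R)] -->
    Fa alpha k i j (u x) (v x).
  by apply: cvg_Fa; [exact: den0|exact: (@c1 _ (x, y, z))|exact: (@c1 _ (x, y, z))].
exists N, a0, a1, a2, L, (4 * (B * Pm) + B).
have BP : 0 <= B * Pm by exact: mulr_ge0.
have DB i j x y z : `|D i j x y z| <= B by exact: HB.
split.
- split => //.
  + move=> i x y z; apply: cvgB.
      apply: cvg_Fc; first exact: den.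
        by apply: cvgD; [exact: (@c1 _ (x, y, z))|exact: (@c2 _ (x, y, z))].
      by apply: cvgD; [exact: (@c1 _ (x, y, z))|exact: (@c3 _ (x, y, z))].
    by apply: cvg_Fc; [exact: den0|exact: (@c1 _ (x, y, z))|exact: (@c1 _ (x, y, z))].
  + move=> i x w1 w2 v1 v2; rewrite /N.
    rewrite (_ : _ - _ - _ = Fc alpha k i (u x + tau w1) (v x + tau w2) -
      Fc alpha k i (u x + tau v1) (v x + tau v2)); last by ring.
    apply: (le_trans (HL _ _ _ _ _ (box x v1 v2) (box x w1 w2))).
    apply: ler_wpM2l => //; rewrite !(opprD, addrACA _ _ (- _)) !subrr !add0r.
    have Lt a b : `|tau a - tau b| <= `|a - b|.
      by have := is_derive_lipschitz Dt dt1 b a; rewrite mul1r.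
    exact: lerD.
  + move=> i x; rewrite /N tid ?normr0 ?(ltW h0)// !addr0 subrr //.
- split.
  + move=> i x y z; apply: cvgD; apply: cvgM.
    * by apply: cvgB; [exact: cD|exact: cA].
    * exact: (@c1 _ (x, y, z)).
    * by apply: cvgB; [exact: cD|exact: cA].
    * exact: (@c1 _ (x, y, z)).
  + by move=> i x y z; apply: cvgM; [exact: cD|exact: (@c2 _ (x, y, z))].
  + by move=> i x y z; apply: cvgM; [exact: cD|exact: (@c3 _ (x, y, z))].
- have H1 X Y : `|X| <= B -> `|Y| <= 1 -> `|X * Y| <= 4 * (B * Pm) + B.
    move=> XB Y1; rewrite normrM; have := ler_pM (normr_ge0 X) (normr_ge0 Y) XB Y1; lra.
  split.
  + move=> i x y z.
    have H X Y Z : `|X| <= B -> `|Y| <= B -> `|Z| <= Pm -> `|(X - Y) * Z| <= 2 * (B * Pm).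
      move=> XB YB ZP; rewrite normrM mulrA; apply: ler_pM => //.
      by apply: (le_trans (ler_normB _ _)); lra.
    apply: (le_trans (ler_normD _ _)).
    have := H _ _ _ (DB i true x y z) (HB i true _ _ (wave_box0 x)) (dP true x).
    have := H _ _ _ (DB i false x y z) (HB i false _ _ (wave_box0 x)) (dP false x).
    lra.
  + by move=> i x y z; apply: H1.
  + by move=> i x y z; apply: H1.
- move=> i f g x p q Df Dg.
  have Dtf (w : R -> R) (d : R) : is_derive x 1 w d -> is_derive x 1 (fun y => tau (w y)) (dtau (w x) * d).
    by move=> Dw; have := @is_derive1_comp _ tau w _ _ _ (Dt (w x)) Dw.
  have Du := wv_d hw true x; have Dv := wv_d hw false x.
  have Dtf1 := Dtf _ _ Df; have Dtg1 := Dtf _ _ Dg.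
  have E1 : is_derive x 1 (fun y => u y + tau (f y)) (wvd U true x + dtau (f x) * p).
    exact: is_deriveD.
  have E2 : is_derive x 1 (fun y => v y + tau (g y)) (wvd U false x + dtau (g x) * q).
    exact: is_deriveD.
  have F1 := is_derive_Fc i E1 E2 (den x (f x) (g x)).
  have F2 := is_derive_Fc i Du Dv (den0 x).
  rewrite /N; apply: is_derive_eq; rewrite /a0 /a1 /a2 /D; ring.
- by move=> i x w1 w2 h1 h2; rewrite /N !tid.
Qed.

End truncated.

(** * The weighted space *)

Section tails.
Context {R : realType}.

Definition tail (f : R -> R) := forall e, 0 < e -> exists X, forall x, X <= `|x| -> `|f x| <= e.

Lemma tail_cvg f : tail f -> f x @[x --> -oo] --> (0 : R) /\ f x @[x --> +oo] --> (0 : R).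
Proof.
move=> H; split; apply/cvgr0Pnorm_le => e e0; have [X HX] := H e e0.
  exists (- `|X|); split; first exact: num_real.
  move=> x xX; apply: HX; rewrite -normrN; apply: le_trans (ler_norm _).
  by have := ler_norm X; lra.
exists `|X|; split; first exact: num_real.
by move=> x xX; apply: HX; apply: le_trans (ler_norm _); have := ler_norm X; lra.
Qed.

Lemma cvg_tail f : f x @[x --> -oo] --> (0 : R) -> f x @[x --> +oo] --> (0 : R) -> tail f.
Proof.
move=> /cvgr0Pnorm_le H1 /cvgr0Pnorm_le H2 e e0.
have [X1 HX1] := near_Noo (H1 e e0); have [X2 HX2] := near_oo (H2 e e0).
exists (`|X1| + `|X2|) => x xX.
have [x0|x0] := leP 0 x.
  by apply: HX2; rewrite (ger0_norm x0) in xX; have := ler_norm X2; have := normr_ge0 X1; lra.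
apply: HX1; rewrite (ltr0_norm x0) in xX.
have := ler_norm (- X1); rewrite normrN; have := normr_ge0 X2; lra.
Qed.

Lemma continuous_tail_bounded f : continuous f -> tail f -> exists B, forall x, `|f x| <= B.
Proof.
move=> cf /(_ 1 ltr01)[X HX].
have cn : {within `[- `|X|, `|X|], continuous (fun x => `|f x|)}.
  by apply: continuous_subspaceT => x; apply: cvg_norm; exact: cf.
have XX : - `|X| <= `|X| by have := normr_ge0 X; lra.
have [z _ Hz] := EVT_max XX cn.
exists (1 + `|f z|) => x.
have [xX|xX] := leP X `|x|; first by apply: (le_trans (HX x xX)); rewrite lerDl.
apply: (@le_trans _ _ `|f z|); last by rewrite lerDr.
by apply: Hz; rewrite in_itv/= -ler_norml; apply: (le_trans (ltW xX)); exact: ler_norm.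
Qed.

(* The envelope is the sup-convolution of g with exp (- L |x|). *)
Lemma log_lipschitz_envelope (g rho : R -> R) (B L L' : R) :
  (forall x, 0 <= g x) -> (forall x, 1 <= rho x) -> 0 <= L' < L ->
  (forall x y, rho x <= rho y * expR (L' * `|x - y|)) ->
  (forall x, rho x * g x <= B) -> tail (fun x => rho x * g x) ->
  exists m : R -> R, [/\ forall x, g x <= m x, forall x, m x <= B,
     forall x y, m y <= m x * expR (L * `|x - y|) & tail (fun x => rho x * m x)].
Proof.
move=> g0 rho1 /andP[L'0 LL] rlog gB gt.
have L0 : 0 < L by apply: le_lt_trans LL.
have rho0 x : 0 < rho x by apply: lt_le_trans (rho1 x).
have gB' x : g x <= B by apply: le_trans (gB x); apply: ler_peMl.
have B0 : 0 <= B by apply: le_trans (gB' 0).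
have e1 x : expR (- (L * `|x|)) <= 1.
  by rewrite -[leRHS]expR0 ler_expR oppr_le0 mulr_ge0// ltW.
pose A x := [set g y * expR (- (L * `|x - y|)) | y in [set: R]].
have Aub x : ubound (A x) B.
  by move=> _ [y _ <-]; apply: le_trans (gB' y); rewrite ler_piMr.
have hA x : has_sup (A x) by split; [exists (g x * expR (- (L * `|x - x|))); exists x|exists B].
pose m x := sup (A x).
have le_m x y : g y * expR (- (L * `|x - y|)) <= m x.
  by apply: sup_upper_bound => //; exists y.
have m_le x C : (forall y, g y * expR (- (L * `|x - y|)) <= C) -> m x <= C.
  by move=> H; apply: ge_sup; [exact: (hA x).1|move=> _ [y _ <-]].
have m0 x : 0 <= m x by apply: le_trans (le_m x x); rewrite mulr_ge0// expR_ge0.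
exists m; split.
- by move=> x; have := le_m x x; rewrite subrr normr0 mulr0 oppr0 expR0 mulr1.
- by move=> x; apply: m_le => y; apply: Aub; exists y.
- move=> x y; apply: m_le => z.
  apply: (@le_trans _ _ (g z * expR (- (L * `|x - z|)) * expR (L * `|x - y|))); last first.
    by apply: ler_wpM2r; rewrite ?expR_ge0.
  rewrite -mulrA -expRD; apply: ler_wpM2l => //; rewrite ler_expR -mulrN -mulrN -mulrDr.
  apply: ler_wpM2l; first exact: ltW.
  by have := ler_distD y x z; lra.
- move=> e e0; have [Y HY] := gt e e0.
  pose d := L - L'; have d0 : 0 < d by rewrite subr_gt0.
  (* Beyond this radius a point y either satisfies |y| >= Y, where [rho] g is at most e, or is so
     far from x that the surplus rate d = L - L' supplies the missing factor e / B. *)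
  exists (`|Y| + (B / e) / d) => x xX.
  rewrite ger0_norm ?mulr_ge0 ?(ltW (rho0 x))// mulrC -ler_pdivlMr//.
  apply: m_le => y; rewrite ler_pdivlMr//.
  have h1 : g y * expR (- (L * `|x - y|)) * rho x <= rho y * g y * expR (- (d * `|x - y|)).
    have := ler_wpM2l (mulr_ge0 (g0 y) (expR_ge0 (- (L * `|x - y|)))) (rlog x y).
    move/le_trans; apply; rewrite [leLHS](_ : _ = rho y * g y * (expR (- (L * `|x - y|)) * expR (L' * `|x - y|))); last by ring.
    by rewrite -expRD (_ : - (L * `|x - y|) + L' * `|x - y| = - (d * `|x - y|))// /d; ring.
  apply: (le_trans h1).
  have rg0 : 0 <= rho y * g y by rewrite mulr_ge0// ltW.
  have [yY|yY] := leP Y `|y|.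
    have := HY y yY; rewrite ger0_norm// => h2.
    apply: le_trans h2; apply: ler_piMr => //.
    by rewrite -[leRHS]expR0 ler_expR oppr_le0 mulr_ge0// ltW.
  have h2 : B / e <= d * `|x - y|.
    have := ler_distD 0 x y; rewrite !subr0 sub0r normrN => h3.
    have h4 : (B / e) / d <= `|x - y|.
      by have := ler_norm Y; have := lerB_dist x y; lra.
    by move: h4; rewrite ler_pdivrMr// (mulrC _ d).
  have h3 : B / e <= expR (d * `|x - y|).
    by apply: le_trans (expR_ge1Dx _); lra.
  rewrite expRN ler_pdivrMr ?expR_gt0//.
  apply: (le_trans (gB y)); rewrite ler_pdivrMr// in h3; lra.
Qed.

Lemma unif_in_time (W : R -> R -> R) (rho : R -> R) (t0 e : R) :
  continuous (fun p : R * R => W p.1 p.2) -> continuous rho -> (forall x, 0 < rho x) ->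
  0 < e ->
  (exists X, forall t x, `|t - t0| < 1 -> X <= `|x| -> rho x * `|W t x| <= e / 2) ->
  exists2 d, 0 < d & forall t x, `|t - t0| < d -> rho x * `|W t x - W t0 x| <= e.
Proof.
move=> cW crho rho0 e0 [X HX].
have XX : - `|X| <= `|X| by have := normr_ge0 X; lra.
have [z _ Hz] := EVT_max XX (continuous_subspaceT crho).
have r0 := rho0 z.
pose e' := e / rho z; have e'0 : 0 < e' by rewrite divr_gt0.
have cK : compact `[- `|X|, `|X|]%classic by exact: segment_compact.
have NC := (compact_near_coveringP _).1 cK.
have key (x : R) : `[- `|X|, `|X|]%classic x ->
    \forall x' \near x & t \near nbhs t0, `|W t x' - W t0 x'| <= e'.
  move=> _.
  have C : W p.2 p.1 - W t0 p.1 @[p --> ((x, t0) : R * R)] --> (0 : R).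
    rewrite -[X in _ --> X](subrr (W t0 x)); apply: cvgB.
      by apply: (@jcont_cvg _ _ _ _ W snd fst t0 x (cW (t0, x))); [exact: cvg_snd|exact: cvg_fst].
    by apply: (@jcont_cvg _ _ _ _ W (fun=> t0) fst t0 x (cW (t0, x))); [exact: cvg_cst|exact: cvg_fst].
  by move/cvgr0Pnorm_le: C => /(_ _ e'0).
have H : \forall t \near t0, `[- `|X|, `|X|]%classic `<=` (fun x => `|W t x - W t0 x| <= e').
  exact: (NC R (nbhs t0) (fun t x => `|W t x - W t0 x| <= e') _ key).
have /nbhs_ballP[d /= d0 Hd] := H.
exists (Num.min d 1); first by rewrite lt_min d0 ltr01.
move=> t x; rewrite lt_min => /andP[td t1].
have [xX|xX] := leP X `|x|.
  have h0 : `|t0 - t0| < 1 by rewrite subrr normr0.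
  have := HX t x t1 xX; have := HX t0 x h0 xX.
  have := ler_wpM2l (ltW (rho0 x)) (ler_normB (W t x) (W t0 x)); lra.
have xI : `[- `|X|, `|X|]%classic x.
  by rewrite /= in_itv/= -ler_norml; apply: (le_trans (ltW xX)); exact: ler_norm.
have h1 : `|W t x - W t0 x| <= e' by apply: Hd => //; rewrite /ball /= distrC.
have h2 : rho x <= rho z by apply: Hz; rewrite in_itv.
have -> : e = rho z * e' by rewrite /e'; field; rewrite gt_eqF.
by apply: ler_pM => //; exact: ltW.
Qed.

End tails.

Section weight.
Context {R : realType}.
Variables s1 s2 : R.
Hypotheses (s1_ge0 : 0 <= s1) (s2_ge0 : 0 <= s2).

Lemma weight_ge1 x : 1 <= weight s1 s2 x.
Proof.
rewrite /weight; have [x0|x0] := leP 0 x.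
  have : 1 <= expR (s1 * x) by rewrite -[leLHS]expR0 ler_expR mulr_ge0.
  by have := expR_ge0 (- (s2 * x)); lra.
have : 1 <= expR (- (s2 * x)) by rewrite -[leLHS]expR0 ler_expR -mulrN mulr_ge0// oppr_ge0 ltW.
by have := expR_ge0 (s1 * x); lra.
Qed.

Lemma weight_gt0 x : 0 < weight s1 s2 x. Proof. exact: lt_le_trans (weight_ge1 x). Qed.

Lemma weight_cont : continuous (weight s1 s2).
Proof.
move=> x; apply: cvgD; apply: (cvg_fun (h := expR)); try exact: continuous_expR.
  by apply: cvgMr; exact: cvg_id.
by apply: cvgN; apply: cvgMr; exact: cvg_id.
Qed.

Lemma weight_log x y : weight s1 s2 x <= weight s1 s2 y * expR (Num.max s1 s2 * `|x - y|).
Proof.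
rewrite /weight mulrDl; apply: lerD; rewrite -expRD ler_expR.
  have h1 : s1 * (x - y) <= s1 * `|x - y| by apply: ler_wpM2l => //; exact: ler_norm.
  have h2 : s1 * `|x - y| <= Num.max s1 s2 * `|x - y|.
    by apply: ler_wpM2r => //; rewrite le_max lexx.
  lra.
have h1 : s2 * - (x - y) <= s2 * `|x - y| by apply: ler_wpM2l => //; rewrite -normrN; exact: ler_norm.
have h2 : s2 * `|x - y| <= Num.max s1 s2 * `|x - y|.
  by apply: ler_wpM2r => //; rewrite le_max lexx orbT.
lra.
Qed.

Lemma norm_weight (f : R -> R * R) x : `|weight s1 s2 x *: f x| = weight s1 s2 x * `|f x|.
Proof. by rewrite normrZ (gtr0_norm (weight_gt0 x)). Qed.

Lemma CsigmaP (f : R -> R * R) : Csigma s1 s2 f <->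
  continuous f /\ tail (fun x => weight s1 s2 x * `|f x|).
Proof.
split=> [[cf fl fr]|[cf tf]].
  split; last by apply: cvg_tail; under eq_fun do rewrite -norm_weight.
  move=> x; have w0 : weight s1 s2 x != 0 by rewrite gt_eqF// weight_gt0.
  have E : f = (fun x => (weight s1 s2 x)^-1 *: (weight s1 s2 x *: f x)).
    by apply/funext => y; rewrite scalerA mulVf ?scale1r// gt_eqF// weight_gt0.
  rewrite E; apply: cvgZ; last exact: cf.
  by apply: cvgV => //; exact: weight_cont.
have [h1 h2] := tail_cvg tf.
split; [|by under eq_fun do rewrite norm_weight|by under eq_fun do rewrite norm_weight].
by move=> x; apply: cvgZ; [exact: weight_cont|exact: cf].
Qed.

Lemma Cnorm_le (f : R -> R * R) B : (forall x, weight s1 s2 x * `|f x| <= B) -> Cnorm s1 s2 f <= B.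
Proof.
move=> H; apply: ge_sup; first by exists (`|weight s1 s2 0 *: f 0|); exists 0.
by move=> _ [x _ <-]; rewrite norm_weight.
Qed.

Lemma Cnorm_ge (f : R -> R * R) x : Csigma s1 s2 f -> weight s1 s2 x * `|f x| <= Cnorm s1 s2 f.
Proof.
move=> /CsigmaP[cf tf]; rewrite -norm_weight; apply: ub_le_sup; last by exists x.
have cw : continuous (fun x => weight s1 s2 x * `|f x|).
  by move=> y; apply: cvgM; [exact: weight_cont|apply: cvg_norm; exact: cf].
have [B HB] := continuous_tail_bounded cw tf.
exists B => _ [y _ <-]; rewrite norm_weight.
exact: le_trans (ler_norm _) (HB y).
Qed.

Lemma Cnorm_ge0 (f : R -> R * R) : Csigma s1 s2 f -> 0 <= Cnorm s1 s2 f.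
Proof.
move=> H; apply: le_trans (Cnorm_ge 0 H).
by rewrite mulr_ge0// ltW// weight_gt0.
Qed.

Lemma CsigmaB (f g : R -> R * R) : Csigma s1 s2 f -> Csigma s1 s2 g -> Csigma s1 s2 (f \- g).
Proof.
move=> /CsigmaP[cf tf] /CsigmaP[cg tg]; apply/CsigmaP; split.
  by move=> x; apply: cvgB; [exact: cf|exact: cg].
move=> e e0; have e2 : 0 < e / 2 by rewrite divr_gt0.
have [X HX] := tf _ e2; have [Y HY] := tg _ e2.
exists (Num.max X Y) => x; rewrite ge_max => /andP[xX xY].
have w0 := weight_gt0 x.
have nn z : 0 <= weight s1 s2 x * `|z : R * R| by rewrite mulr_ge0// ltW.
have := HX x xX; have := HY x xY; rewrite !(ger0_norm (nn _)) => h1 h2.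
have h3 := ler_wpM2l (ltW w0) (ler_normB (f x) (g x)).
rewrite /=; lra.
Qed.

End weight.

(** * Existence and decay of perturbations *)

Section components.
Context {R : realType}.

Definition comp (i : bool) (z : R * R) : R := if i then z.1 else z.2.

Lemma prod_normP (z : R * R) : `|z| = Num.max `|z.1| `|z.2|.
Proof. by []. Qed.

Lemma comp_le i (z : R * R) : `|comp i z| <= `|z|.
Proof. by rewrite prod_normP; case: i; rewrite /comp le_max lexx ?orbT. Qed.

Lemma norm_le_comp (z : R * R) C : (forall i, `|comp i z| <= C) -> `|z| <= C.
Proof. by move=> H; rewrite prod_normP ge_max (H true) (H false). Qed.

Lemma comp_inj (z w : R * R) : (forall i, comp i z = comp i w) -> z = w.
Proof. by case: z w => [z1 z2] [w1 w2] H; congr pair; [exact: (H true)|exact: (H false)]. Qed.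

Lemma cvg_comp_pair (T : Type) (F : set_system T) {FF : Filter F} (f : T -> R * R) (z : R * R) i :
  f @ F --> z -> comp i (f x) @[x --> F] --> comp i z.
Proof.
move=> H; case: z H => a b H; case: i.
- exact: (cvg_comp _ _ H (@cvg_fst _ _ (nbhs a) (nbhs b) _)).
- exact: (cvg_comp _ _ H (@cvg_snd _ _ (nbhs a) (nbhs b) _)).
Qed.

End components.

Section existence.
Context {R : realType}.
Variables (c s1 s2 L0 Ca : R) (N a0 a1 a2 : bool -> R -> R -> R -> R).
Hypotheses (s1_ge0 : 0 <= s1) (s2_ge0 : 0 <= s2).
Hypotheses (L0_ge0 : 0 <= L0) (N_cont : forall i, cont3 (N i))
  (N_lip : forall i x w1 w2 v1 v2, `|N i x w1 w2 - N i x v1 v2| <= L0 * (`|w1 - v1| + `|w2 - v2|))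
  (N_0 : forall i x, N i x 0 0 = 0)
  (a0_cont : forall i, cont3 (a0 i)) (a1_cont : forall i, cont3 (a1 i))
  (a2_cont : forall i, cont3 (a2 i))
  (a0_le : forall i x y z, `|a0 i x y z| <= Ca) (a1_le : forall i x y z, `|a1 i x y z| <= Ca)
  (a2_le : forall i x y z, `|a2 i x y z| <= Ca)
  (N_der : forall i (f g : R -> R) (x p q : R), is_derive x 1 f p -> is_derive x 1 g q ->
        is_derive x 1 (fun y => N i y (f y) (g y))
          (a0 i x (f x) (g x) + a1 i x (f x) (g x) * p + a2 i x (f x) (g x) * q)).

(** The Picard solution is bounded by a time factor times the envelope of the datum. Since this
    envelope vanishes against the weight, the solution does so uniformly on bounded time intervals,
    as the comparison argument requires. *)
Lemma perturbation_exists (f : R -> R * R) : Csigma s1 s2 f ->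
  exists W P Q : bool -> R -> R -> R,
  [/\ forall i, continuous (fun p : R * R => W i p.1 p.2), forall i x, W i 0 x = comp i (f x),
      (forall i, jcont (P i)) /\ (forall i, jcont (Q i)),
      forall T e, 0 < e -> exists X, forall i t x, t <= T -> X <= `|x| -> weight s1 s2 x * `|W i t x| <= e &
      forall i (t x : R), 0 < t ->
       [/\ is_derive x 1 (W i t) (P i t x), is_derive x 1 (P i t) (Q i t x) &
           is_derive t 1 (fun t => W i t x)
             (Q i t x - c * P i t x + N i x (W true t x) (W false t x))]].
Proof.
move=> hf; have [cf tf] := (CsigmaP s1_ge0 s2_ge0 f).1 hf.
(* The weight has logarithmic slope at most the maximum of [s1] and [s2]; the envelope needs a
   strictly larger one to keep the decay. *)
pose L := Num.max s1 s2 + 1.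
have mx0 : 0 <= Num.max s1 s2 by rewrite le_max s1_ge0.
have LL : 0 <= Num.max s1 s2 < L by rewrite mx0/= /L ltrDl.
have L_ge0 : 0 <= L by rewrite /L addr_ge0.
have [m [fm mB mlog mt]] := log_lipschitz_envelope (fun x => normr_ge0 (f x))
  (weight_ge1 s1_ge0 s2_ge0) LL (weight_log s1_ge0 s2_ge0)
  (fun x => Cnorm_ge s1_ge0 s2_ge0 x hf) tf.
have [K1 K10 HK1] := @hs_exp_bound R.
have [K2 K20 HK2] := @duh_exp_bound R.
have pc i : continuous (fun x => comp i (f x)) by move=> x; apply: cvg_comp_pair; exact: cf.
have pm i x : `|comp i (f x)| <= m x by apply: le_trans (fm x); exact: comp_le.
have [W [P [Q [[K0' Wc Wb] W0 Pc Qc HW]]]] := pic_classical c K10 K20 HK1 HK2 L0_ge0 L_ge0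
  N_cont N_lip N_0 pc pm mB mlog a0_cont a1_cont a2_cont a0_le a1_le a2_le N_der.
exists W, P, Q; split => // T e e0.
set G := L * `|c| + 2 * L ^+ 2 + 4 * K2 * L0 + 1 in Wb.
pose D := 4 * K1 * expR (`|G| * tpos T) + 1.
have D0 : 0 < D by rewrite ltr_wpDl// mulr_ge0// expR_ge0.
have eD : 0 < e / D by rewrite divr_gt0.
have [X HX] := mt _ eD.
exists X => i t x tT xX.
have w0 := weight_gt0 s1_ge0 s2_ge0 x.
have m0 : 0 <= m x by apply: le_trans (normr_ge0 _) (pm true x).
have h1 : `|W i t x| <= D * m x.
  apply: (le_trans (Wb i t x)); apply: ler_wpM2r => //.
  rewrite /D -[leLHS]addr0; apply: lerD => //; apply: ler_wpM2l => //.
  rewrite ler_expR; apply: (@le_trans _ _ (`|G| * tpos t)).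
    by apply: ler_wpM2r; [exact: tpos_ge0|exact: ler_norm].
  by apply: ler_wpM2l => //; rewrite /tpos le_max2.
have h2 := HX x xX; rewrite ger0_norm ?mulr_ge0 ?(ltW w0)// in h2.
rewrite ler_pdivlMr// in h2.
have := ler_wpM2l (ltW w0) h1; lra.
Qed.

End existence.

Section decay.
Context {R : realType}.
Variables (alpha k c s1 s2 : R) (U : R -> R * R).
Hypotheses (ha : 0 < alpha < 1) (hk : 0 < k < 1).
Hypothesis hw : traveling_wave alpha k c U.
Hypotheses (s1_ge0 : 0 <= s1) (s2_ge0 : 0 <= s2).
Variables (Ph : bool -> R -> R) (b k1 k2 h C : R).
Hypotheses (b0 : 0 < b) (k10 : 0 < k1) (k20 : 0 < k2) (h0 : 0 < h <= 4^-1) (C0 : 0 <= C).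
Hypotheses (cPh : forall i, continuous (Ph i)) (Ph0 : forall i x, 0 < Ph i x)
  (rPh : forall i x, k1 <= weight s1 s2 x * Ph i x <= k2)
  (tPh : forall i x, touch c (Ph i) x (- b * Ph i x - Dgw alpha k U i x * Ph i x - Ofw alpha k U i x * Ph (~~ i) x)).
Hypothesis taylor : forall i a b a' b', inbox alpha k a b -> inbox alpha k a' b' ->
  `|Fc alpha k i a' b' - Fc alpha k i a b -
    (Fa alpha k i true a b * (a' - a) + Fa alpha k i false a b * (b' - b))|
  <= C * (`|a' - a| + `|b' - b|) ^+ 2.

Local Notation u := (wv U true).
Local Notation v := (wv U false).

Lemma Ph_le i x : Ph i x <= k2.
Proof.
have /andP[_ h1] := rPh i x; apply: le_trans h1; apply: ler_peMl; first exact: ltW.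
exact: weight_ge1.
Qed.

Lemma Ph_ratio i j x : Ph j x <= k2 / k1 * Ph i x.
Proof.
have w0 := weight_gt0 s1_ge0 s2_ge0 x.
have /andP[h1 _] := rPh i x; have /andP[_ h2] := rPh j x.
rewrite -(ler_pM2l w0); apply: (le_trans h2).
have -> : weight s1 s2 x * (k2 / k1 * Ph i x) = k2 / k1 * (weight s1 s2 x * Ph i x) by ring.
have -> : k2 = k2 / k1 * k1 by field; rewrite gt_eqF.
by rewrite -{2}(_ : k2 = k2 / k1 * k1); [apply: ler_wpM2l => //; rewrite divr_ge0// ltW|field; rewrite gt_eqF].
Qed.

Variable eta : R.
Hypotheses (eta0 : 0 < eta) (eta_h : eta * k2 <= h)
  (eta_b : C * eta * (2 * k2 / k1) ^+ 2 * k2 < b / 2).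
Variables (N : bool -> R -> R -> R -> R) (W P Q : bool -> R -> R -> R).
Hypothesis NE : forall i x w1 w2, `|w1| <= h -> `|w2| <= h ->
        N i x w1 w2 = Fc alpha k i (u x + w1) (v x + w2) - Fc alpha k i (u x) (v x).
Hypotheses (W_cont : forall i, continuous (fun p : R * R => W i p.1 p.2))
  (W_tail : forall T e, 0 < e -> exists X, forall i t x, t <= T -> X <= `|x| -> weight s1 s2 x * `|W i t x| <= e)
  (W_d : forall i (t x : R), 0 < t ->
       [/\ is_derive x 1 (W i t) (P i t x), is_derive x 1 (P i t) (Q i t x) &
           is_derive t 1 (fun t => W i t x)
             (Q i t x - c * P i t x + N i x (W true t x) (W false t x))]).
Variable ell0 : R.
Hypotheses (ell00 : 0 <= ell0) (ell0_lt : ell0 < eta) (W_init : forall i x, `|W i 0 x| <= ell0 * Ph i x).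

Lemma W_unif_time t0 e : 0 < e -> exists2 d, 0 < d &
  forall i t x, `|t - t0| < d -> weight s1 s2 x * `|W i t x - W i t0 x| <= e.
Proof.
move=> e0; have e2 : 0 < e / 2 by rewrite divr_gt0.
have [X HX] := W_tail (t0 + 1) e2.
have key i := @unif_in_time R (W i) (weight s1 s2) t0 e (@W_cont i) (@weight_cont R s1 s2)
  (weight_gt0 s1_ge0 s2_ge0) e0.
have ex i : exists X, forall t x, `|t - t0| < 1 -> X <= `|x| -> weight s1 s2 x * `|W i t x| <= e / 2.
  exists X => t x; rewrite ltr_norml => /andP[_ t1] xX; apply: HX => //; lra.
have [d1 d10 H1] := key true (ex true); have [d2 d20 H2] := key false (ex false).
exists (Num.min d1 d2); first by rewrite lt_min d10.
by move=> i t x; rewrite lt_min => /andP[h1 h2]; case: i; [exact: H1|exact: H2].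
Qed.

Lemma W_tail_at i t : tail (fun x => weight s1 s2 x * `|W i t x|).
Proof.
move=> e e0; have [X HX] := W_tail t e0.
exists X => x xX; rewrite ger0_norm; first exact: HX.
by rewrite mulr_ge0// ltW// weight_gt0.
Qed.

Lemma W_section i t : continuous (W i t).
Proof.
move=> x; exact: (@jcont_cvg R _ (nbhs x) _ (W i) (fun=> t) id t x (@W_cont i (t, x)) (cvg_cst t) cvg_id).
Qed.

(** At a contact point the linear part is at most th (Dg Ph + Of Ph~), by cooperativity, and cancels
    against the supersolution up to -b th Ph. The remainder is at most C (2 k2 / k1)^2 (th Ph)^2; as
    th Ph <= eta k2, [eta_b] makes it smaller than half of the gain. *)
Lemma decay_touch i t x th s : 0 < th <= eta -> (forall j, `|W j t x| <= th * Ph j x) ->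
  s = 1 \/ s = -1 -> s * W i t x = th * Ph i x ->
  s * N i x (W true t x) (W false t x) +
    th * (- b * Ph i x - Dgw alpha k U i x * Ph i x - Ofw alpha k U i x * Ph (~~ i) x)
  < - (b / 2) * th * Ph i x.
Proof.
move=> /andP[th0 the] Wle s1' sW.
have Wh j : `|W j t x| <= h.
  apply: (le_trans (Wle j)); apply: le_trans eta_h.
  by apply: ler_pM => //; [exact: ltW|exact: ltW|exact: Ph_le].
have h2 : h <= 2^-1 by case/andP: h0; lra.
have B0 := wave_box0 hw x.
have B1 : inbox alpha k (u x + W true t x) (v x + W false t x).
  by apply: (wave_box hw); apply: le_trans h2.
have T := taylor i B0 B1.
rewrite NE//; set D := Fc _ _ _ _ _ - Fc _ _ _ _ _ in T *.
rewrite !(addrC _ (W _ t x)) !addrK in T.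
set lin := (X in `|D - X|) in T.
have Elin : s * lin = Dgw alpha k U i x * (s * W i t x) + Ofw alpha k U i x * (s * W (~~ i) t x).
  by rewrite /lin /Dgw /Ofw; case: i {Wle sW T lin D} => /=; ring.
have sn : `|s| = 1 by case: s1' => ->; rewrite ?normrN normr1.
have h3 : s * D <= s * lin + `|D - lin|.
  have : s * (D - lin) <= `|D - lin| by apply: (le_trans (ler_norm _)); rewrite normrM sn mul1r.
  lra.
have h4 : s * W (~~ i) t x <= th * Ph (~~ i) x.
  by apply: (le_trans (ler_norm _)); rewrite normrM sn mul1r.
have h5 := ler_wpM2l (Ofw_ge0 hk hw i x) h4.
have h6 : `|W true t x| + `|W false t x| <= th * (2 * k2 / k1 * Ph i x).
  have h7 := ler_wpM2l (ltW th0) (Ph_ratio i true x).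
  have h8 := ler_wpM2l (ltW th0) (Ph_ratio i false x).
  have := Wle true; have := Wle false; lra.
have h9 : C * (`|W true t x| + `|W false t x|) ^+ 2 < b / 2 * (th * Ph i x).
  apply: (@le_lt_trans _ _ (C * eta * (2 * k2 / k1) ^+ 2 * k2 * (th * Ph i x))); last first.
    by rewrite ltr_pM2r// mulr_gt0.
  apply: (@le_trans _ _ (C * (th * (2 * k2 / k1 * Ph i x)) ^+ 2)).
    by apply: ler_wpM2l => //; apply: lerXn2r; rewrite ?nnegrE ?addr_ge0//; apply: le_trans h6; rewrite addr_ge0.
  have q0 : 0 <= C * (2 * k2 / k1) ^+ 2 * (th * Ph i x).
    by apply: mulr_ge0; rewrite mulr_ge0 ?sqr_ge0// ltW.
  have q1 : th * Ph i x <= eta * k2.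
    by apply: ler_pM => //; [exact: ltW|exact: ltW|exact: Ph_le].
  have := ler_wpM2l q0 q1; lra.
rewrite Elin sW in h3; lra.
Qed.

(** The comparison level starts at eta and decreases with rate b / 2, so it never leaves the range
    in which [decay_touch] applies. *)
Lemma perturbation_decay i t x : 0 <= t -> `|W i t x| <= eta * expR (- (b / 2) * t) * Ph i x.
Proof.
move=> t0.
have pos (s : R) : 0 < s <= t -> 0 < s by case/andP.
have rP j y : k1 <= weight s1 s2 y * Ph j y by have /andP[] := rPh j y.
refine (@max_principle R c k1 eta eta ell0 (- (b / 2)) t (weight s1 s2) Ph
  (fun i x => - b * Ph i x - Dgw alpha k U i x * Ph i x - Ofw alpha k U i x * Ph (~~ i) x)
  W (fun i t x => Q i t x - c * P i t x + N i x (W true t x) (W false t x)) P Q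
  (fun i t x => N i x (W true t x) (W false t x))
  k10 cPh Ph0 (weight_gt0 s1_ge0 s2_ge0) rP tPh _ _ _ _ _ _ _ _ _ _ _ _ _ t i x _).
- by move=> j s y /pos s0; have [] := W_d j y s0.
- by move=> j s y /pos s0; have [] := W_d j y s0.
- by move=> j s y /pos s0; have [] := W_d j y s0.
- by [].
- by move=> j s _; exact: W_section.
- by move=> j s _; have [] := tail_cvg (@W_tail_at j s).
- by move=> j s _; have [] := tail_cvg (@W_tail_at j s).
- move=> s e _ e0; have [d d0 Hd] := W_unif_time s e0.
  by exists d => // j s' y _; exact: Hd.
- by move=> j s y th sg _ the Wle sg1 sW; exact: decay_touch.
- exact: ell0_lt.
- exact: ell00.
- exact: W_init.
- move=> s /andP[s0 _]; rewrite -[leRHS]mulr1; apply: ler_wpM2l; first exact: ltW.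
  by rewrite -[leRHS]expR0 ler_expR mulNr oppr_le0 mulr_ge0// ltW// divr_gt0.
- by rewrite t0 lexx.
Qed.

End decay.

(** * The nonlinear Cauchy problem *)

Section joint.
Context {R : realType}.

Lemma comp_F alpha k i (z : R * R) : comp i (F alpha k z) = Fc alpha k i z.1 z.2.
Proof. by rewrite /Fc -surjective_pairing. Qed.

Lemma jcontD (f g : R -> R -> R) : jcont f -> jcont g -> jcont (fun t x => f t x + g t x).
Proof. by move=> cf cg s y s0; apply: cvgD; [exact: cf|exact: cg]. Qed.

Lemma jcontZ (a : R) (f : R -> R -> R) : jcont f -> jcont (fun t x => a * f t x).
Proof. by move=> cf s y s0; apply: cvgMr; exact: cf. Qed.

Lemma jcont_x (f : R -> R) : continuous f -> jcont (fun _ x => f x).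
Proof. by move=> cf s y s0; apply: (cvg_fun (h := f)); [exact: cf|exact: cvg_snd]. Qed.

Lemma jointly_continuous_of_jcont (T : \bar R) (f : R -> R -> R * R) (g : bool -> R -> R -> R) :
  (forall x t, 0 < t -> f x t = (g true t x, g false t x)) -> (forall i, jcont (g i)) ->
  jointly_continuous T f.
Proof.
move=> fg cg x t t0 _.
have cgi i : g i q.2 q.1 @[q --> ((x, t) : R * R)] --> g i t x.
  by apply: (@jcont_cvg R _ (nbhs ((x, t) : R * R)) _ (g i) snd fst t x (cg i t x t0)); [exact: cvg_snd|exact: cvg_fst].
suff : f q.1 q.2 @[q --> ((x, t) : R * R)] --> f x t by [].
rewrite (fg x t t0); apply: cvg_trans (cvg_pair (cgi true) (cgi false)); apply: near_eq_cvg.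
have H : \forall q \near ((x, t) : R * R), 0 < q.2.
  by apply: (@cvgr_gt _ _ (nbhs ((x, t) : R * R)) _ snd t); [exact: cvg_snd|].
by apply: filterS H => q q0; rewrite fg.
Qed.

Lemma is_derive_comp i (f : R -> R * R) (x : R) d : is_derive x 1 f d ->
  is_derive x 1 (fun y => comp i (f y)) (comp i d).
Proof. by move/is_derive_pair => [h1 h2]; case: i. Qed.

Lemma derivable_is_derive (f : R -> R * R) (x : R) : derivable f x 1 -> is_derive x 1 f (derive1 f x).
Proof. by move=> H; rewrite derive1E; split. Qed.

End joint.

Section solution.
Context {R : realType}.
Variables (alpha k c s1 s2 h : R) (Us : R -> R * R).
Hypotheses (ha : 0 < alpha < 1) (hk : 0 < k < 1).
Hypothesis hw : traveling_wave alpha k c Us.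
Hypotheses (s1_ge0 : 0 <= s1) (s2_ge0 : 0 <= s2) (h0 : 0 < h <= 4^-1).
Variables (N : bool -> R -> R -> R -> R) (W P Q : bool -> R -> R -> R) (Ubar : R -> R * R).

Local Notation u := (wv Us true).
Local Notation v := (wv Us false).

Hypotheses (N_cont : forall i, cont3 (N i))
  (NE : forall i x w1 w2, `|w1| <= h -> `|w2| <= h ->
        N i x w1 w2 = Fc alpha k i (u x + w1) (v x + w2) - Fc alpha k i (u x) (v x)).
Hypotheses (W_cont : forall i, continuous (fun p : R * R => W i p.1 p.2))
  (W_0 : forall i x, W i 0 x = comp i ((Ubar \- Us) x))
  (P_cont : forall i, jcont (P i)) (Q_cont : forall i, jcont (Q i))
  (W_tail : forall T e, 0 < e -> exists X, forall i t x, t <= T -> X <= `|x| -> weight s1 s2 x * `|W i t x| <= e)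
  (W_d : forall i (t x : R), 0 < t ->
       [/\ is_derive x 1 (W i t) (P i t x), is_derive x 1 (P i t) (Q i t x) &
           is_derive t 1 (fun t => W i t x)
             (Q i t x - c * P i t x + N i x (W true t x) (W false t x))])
  (W_h : forall i t x, 0 <= t -> `|W i t x| <= h).

Definition Usol (x t : R) : R * R := (u x + W true t x, v x + W false t x).

Let comp_Usol i x t : comp i (Usol x t) = wv Us i x + W i t x.
Proof. by case: i. Qed.

Let dW i t x := Q i t x - c * P i t x + N i x (W true t x) (W false t x).

Lemma Usol_d_t x (t : R) : 0 < t -> is_derive t 1 (Usol x) (dW true t x, dW false t x).
Proof.
move=> t0; apply/is_derive_pair; split => /=.
  have [_ _ D] := W_d true x t0.
  by have := is_deriveD (is_derive_cst (u x) t 1) D; rewrite add0r.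
have [_ _ D] := W_d false x t0.
by have := is_deriveD (is_derive_cst (v x) t 1) D; rewrite add0r.
Qed.

Lemma Usol_d_x (x : R) t : 0 < t ->
  is_derive x 1 (Usol^~ t) (wvd Us true x + P true t x, wvd Us false x + P false t x).
Proof.
move=> t0; apply/is_derive_pair; split => /=.
  by have [D _ _] := W_d true x t0; exact: is_deriveD (wv_d hw true x) D.
by have [D _ _] := W_d false x t0; exact: is_deriveD (wv_d hw false x) D.
Qed.

Lemma d_xi_Usol x t : 0 < t ->
  d_xi Usol x t = (wvd Us true x + P true t x, wvd Us false x + P false t x).
Proof. by move=> t0; have D := Usol_d_x x t0; rewrite /d_xi derive1E derive_val. Qed.

Let wdd i x := c * wvd Us i x - Fc alpha k i (u x) (v x).

Lemma Usol_d_xx (x : R) t : 0 < t ->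
  is_derive x 1 ((d_xi Usol)^~ t) (wdd true x + Q true t x, wdd false x + Q false t x).
Proof.
move=> t0.
have -> : (d_xi Usol)^~ t = (fun x => (wvd Us true x + P true t x, wvd Us false x + P false t x)).
  by apply/funext => y; exact: d_xi_Usol.
apply/is_derive_pair; split => /=.
  by have [_ D _] := W_d true x t0; exact: is_deriveD (wvd_d hw true x) D.
by have [_ D _] := W_d false x t0; exact: is_deriveD (wvd_d hw false x) D.
Qed.

Lemma W_box x t : 0 <= t -> inbox alpha k (u x + W true t x) (v x + W false t x).
Proof.
move=> t0; have h2 : h <= 2^-1 by case/andP: h0; lra.
by apply: (wave_box hw); apply: le_trans h2; exact: W_h.
Qed.

Lemma Usol_Csigma t : Csigma s1 s2 (Usol^~ t \- Us).
Proof.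
apply/CsigmaP => //.
have E x : (Usol^~ t \- Us) x = (W true t x, W false t x).
  apply: comp_inj => i; have -> : comp i ((Usol^~ t \- Us) x) = comp i (Usol x t) - comp i (Us x) by case: i.
  by rewrite comp_Usol /wv; case: i => /=; ring.
split.
  rewrite (_ : _ \- _ = fun x => (W true t x, W false t x)); last exact/funext.
  have cs i : continuous (W i t) by exact: W_section.
  by move=> x; exact: (cvg_pair (@cs true x) (@cs false x)).
move=> e e0; have [X HX] := W_tail t e0; exists X => x xX.
have w0 := weight_gt0 s1_ge0 s2_ge0 x.
rewrite ger0_norm ?mulr_ge0 ?(ltW w0)// mulrC -ler_pdivlMr// E.
by apply: norm_le_comp => i; rewrite ler_pdivlMr// mulrC; case: i; exact: HX.
Qed.

Lemma Usol_solution : solution alpha k c s1 s2 Us +oo%E Ubar Usol.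
Proof.
have cwd i : continuous (wvd Us i) by exact: is_derive_continuous (wvd_d hw i).
have cwv i : continuous (wv Us i) by exact: is_derive_continuous (wv_d hw i).
have cW i : jcont (W i) by move=> s y _; exact: (@W_cont i (s, y)).
have cF i : continuous (fun x => Fc alpha k i (u x) (v x)).
  move=> x; apply: cvg_Fc; [|exact: cwv|exact: cwv].
  have h5 := inbox_den hk (wave_box0 hw x).
  by rewrite gt_eqF//; apply: lt_le_trans h5; rewrite invr_gt0.
split.
- move=> x; apply: comp_inj => i; rewrite comp_Usol W_0.
  by rewrite /wv /comp; case: i => /=; ring.
- by move=> t _ _; exact: Usol_Csigma.
- move=> t0 t00 _; apply: cvg_within_filter; apply/cvgr0Pnorm_le => e e0.
  have [d d0 Hd] := W_unif_time s1_ge0 s2_ge0 W_cont W_tail t0 e0.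
  apply/nbhs_ballP; exists d => //= t; rewrite /ball /= distrC => td.
  (* Membership of the difference in the weighted space is needed for [Cnorm] to be a genuine
     supremum. *)
  have E : Usol^~ t \- Usol^~ t0 = (Usol^~ t \- Us) \- (Usol^~ t0 \- Us).
    by apply/funext => x /=; rewrite opprB addrA subrK.
  have CS : Csigma s1 s2 (Usol^~ t \- Usol^~ t0).
    by rewrite E; apply: CsigmaB => //; exact: Usol_Csigma.
  rewrite ger0_norm; last exact: Cnorm_ge0.
  apply: Cnorm_le => // x; have w0 := weight_gt0 s1_ge0 s2_ge0 x.
  rewrite mulrC -ler_pdivlMr//; apply: norm_le_comp => i; rewrite ler_pdivlMr// mulrC.
  have -> : comp i ((Usol^~ t \- Usol^~ t0) x) = comp i (Usol x t) - comp i (Usol x t0) by case: i.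
  rewrite !comp_Usol (_ : _ - _ = W i t x - W i t0 x); last by ring.
  exact: Hd.
- move=> x t t0 _; have h5 := inbox_den hk (W_box x t0).
  by rewrite gt_eqF//; apply: lt_le_trans h5; rewrite invr_gt0.
- by move=> x t t0 _; have [] := Usol_d_t x t0.
- by move=> x t t0 _; have [] := Usol_d_x x t0.
- by move=> x t t0 _; have [] := Usol_d_xx x t0.
- apply: (@jointly_continuous_of_jcont _ _ _ dW).
    by move=> x t t0; have D := Usol_d_t x t0; rewrite /d_t derive1E derive_val.
  move=> i; apply: jcontD; first apply: jcontD => //.
    rewrite (_ : (fun t x => - (c * P i t x)) = (fun t x => - c * P i t x)); first exact: jcontZ.
    by apply/funext => t; apply/funext => x; rewrite mulNr.
  move=> s y s0; apply: (@cont3_cvg _ (N i) _ (nbhs ((s, y) : R * R)) _ snd (fun p => W true p.1 p.2)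
    (fun p => W false p.1 p.2) y (W true s y) (W false s y) (@N_cont i));
    [exact: cvg_snd|exact: (@W_cont true (s, y))|exact: (@W_cont false (s, y))].
- apply: (@jointly_continuous_of_jcont _ _ _ (fun i t x => wvd Us i x + P i t x)).
    by move=> x t t0; exact: d_xi_Usol.
  by move=> i; apply: jcontD => //; exact: jcont_x.
- apply: (@jointly_continuous_of_jcont _ _ _ (fun i t x => wdd i x + Q i t x)).
    by move=> x t t0; have D := Usol_d_xx x t0; rewrite {1}/d_xi derive1E derive_val.
  move=> i; apply: jcontD => //; apply: jcont_x => x.
  by apply: cvgB; [apply: cvgMr; exact: cwd|exact: cF].
- move=> x t t0 _.
  have D1 := Usol_d_t x t0; have D2 := Usol_d_xx x t0.
  rewrite d_xi_Usol// /d_t derive1E derive_val {1}/d_xi derive1E derive_val.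
  apply: comp_inj => i.
  have -> : comp i (dW true t x, dW false t x) = dW i t x by case: i.
  have -> (a b d : R * R) : comp i (a - c *: b + d) = comp i a - c * comp i b + comp i d by case: i.
  rewrite comp_F /= /dW NE ?W_h ?(ltW t0)//.
  by rewrite /wdd; case: i => /=; ring.
Qed.

End solution.

(** * Uniqueness in the weighted phase space *)

Section uniqueness.
Context {R : realType}.
Variables (alpha k c s1 s2 : R) (Us Ubar : R -> R * R).
Hypotheses (ha : 0 < alpha < 1) (hk : 0 < k < 1).
Hypothesis hw : traveling_wave alpha k c Us.
Hypotheses (s1_ge0 : 0 <= s1) (s2_ge0 : 0 <= s2).
Variables (Ph : bool -> R -> R) (b k1 k2 L : R).
Hypotheses (b0 : 0 < b) (k10 : 0 < k1) (k20 : 0 < k2) (L_ge0 : 0 <= L).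
Hypotheses (cPh : forall i, continuous (Ph i)) (Ph0 : forall i x, 0 < Ph i x)
  (rPh : forall i x, k1 <= weight s1 s2 x * Ph i x <= k2)
  (tPh : forall i x, touch c (Ph i) x (- b * Ph i x - Dgw alpha k Us i x * Ph i x - Ofw alpha k Us i x * Ph (~~ i) x)).
Hypothesis lip : forall i a b a' b', inbox alpha k a b -> inbox alpha k a' b' ->
  `|Fc alpha k i a' b' - Fc alpha k i a b| <= L * (`|a' - a| + `|b' - b|).

Lemma solution_unif T V t0 e : solution alpha k c s1 s2 Us T Ubar V ->
  0 <= t0 -> (t0%:E < T)%E -> 0 < e -> exists2 d, 0 < d & forall i t x, 0 <= t -> (t%:E < T)%E ->
    `|t - t0| < d -> weight s1 s2 x * `|comp i (V x t) - comp i (V x t0)| <= e.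
Proof.
move=> sV t00 t0T e0.
have /cvgr0Pnorm_le/(_ _ e0)/nbhs_ballP[d /= d0 Hd] := sol_continuous sV t00 t0T.
exists d => // i t x t0' tT td.
have CS : Csigma s1 s2 (V^~ t \- V^~ t0).
  rewrite (_ : _ \- _ = (V^~ t \- Us) \- (V^~ t0 \- Us)).
    by apply: CsigmaB => //; exact: (sol_space sV).
  by apply/funext => y /=; rewrite opprB addrA subrK.
have h1 := Hd t; rewrite /ball /= distrC in h1.
have h2 := h1 td (conj t0' tT); rewrite ger0_norm ?Cnorm_ge0// in h2.
have h3 := Cnorm_ge s1_ge0 s2_ge0 x CS.
apply: le_trans h2; apply: le_trans h3; apply: ler_wpM2l.
  by apply: ltW; exact: weight_gt0.
have -> : comp i (V x t) - comp i (V x t0) = comp i ((V^~ t \- V^~ t0) x) by case: i.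
exact: comp_le.
Qed.

(** Nothing is assumed on the size of V. The difference starts at 0 and is compared with ell e^(kap
    t) [Ph]; while it stays below this level V is close to the wave, so the local Lipschitz bound is
    available. Letting ell tend to 0 gives equality. *)
Lemma solution_unique T (U V : R -> R -> R * R) :
  solution alpha k c s1 s2 Us +oo%E Ubar U -> solution alpha k c s1 s2 Us T Ubar V ->
  (forall i x t, 0 <= t -> `|comp i (U x t) - wv Us i x| <= 4^-1) ->
  forall x t, 0 <= t -> (t%:E < T)%E -> V x t = U x t.
Proof.
move=> sU sV Uh x1 t1 t10 t1T.
pose W i t x := comp i (V x t) - comp i (U x t).
have ltT t : t <= t1 -> (t%:E < T)%E by move=> tt; apply: le_lt_trans t1T; rewrite lee_fin.
have lty (t : R) : (t%:E < +oo)%E by rewrite ltry.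
pose La := 2 * Kstar alpha k + 4.
have La0 : 0 <= La by have := K_gt0 ha hk; rewrite /La; lra.
(* The first summand absorbs the Lipschitz bound, with [k2] / [k1] comparing the two components of
   [Ph]; [La] absorbs the diagonal coefficient in the touching inequality, and 1 makes it strict. *)
pose kap := L * (2 * k2 / k1) + La + 1.
have kk0 : 0 < 2 * k2 / k1 by rewrite divr_gt0// mulr_gt0.
have kap0 : 0 < kap by rewrite /kap ltr_wpDl// addr_ge0// mulr_ge0// ltW.
(* As [Ph] is at most [k2], the difference stays below 1/4; U is within 1/4 of the wave, so V is
   within 1/2 and both lie in [inbox]. *)
pose eta := (4 * k2)^-1.
have eta0 : 0 < eta by rewrite invr_gt0 mulr_gt0.
have CS t : 0 <= t <= t1 -> Csigma s1 s2 (V^~ t \- U^~ t).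
  move=> /andP[t0 tt]; rewrite (_ : _ \- _ = (V^~ t \- Us) \- (U^~ t \- Us)).
    by apply: CsigmaB => //; [exact: (sol_space sV t0 (ltT t tt))|exact: (sol_space sU t0 (lty t))].
  by apply/funext => y /=; rewrite opprB addrA subrK.
have WE i t x : W i t x = comp i ((V^~ t \- U^~ t) x) by rewrite /W; case: i.
have Wt i t : 0 <= t <= t1 -> tail (fun x => weight s1 s2 x * `|W i t x|).
  move=> /CS /(CsigmaP s1_ge0 s2_ge0)[_ tf] e e0; have [X HX] := tf e e0; exists X => x xX.
  have w0 := weight_gt0 s1_ge0 s2_ge0 x.
  have nn (V' : normedModType R) (z : V') : 0 <= weight s1 s2 x * `|z| by rewrite mulr_ge0// ltW.
  apply: le_trans (HX x xX); rewrite (ger0_norm (nn _ _)) (ger0_norm (nn _ _)).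
  by apply: ler_wpM2l; [exact: ltW|rewrite WE; exact: comp_le].
have key ell : 0 < ell -> ell * expR (kap * t1) <= eta ->
    forall i x, `|W i t1 x| <= ell * expR (kap * t1) * Ph i x.
  move=> ell0 elle i x.
  have rP j y : k1 <= weight s1 s2 y * Ph j y by have /andP[] := rPh j y.
  refine (@max_principle R c k1 eta ell 0 kap t1 (weight s1 s2) Ph
    (fun i x => - b * Ph i x - Dgw alpha k Us i x * Ph i x - Ofw alpha k Us i x * Ph (~~ i) x)
    W (fun i t x => comp i (d_t V x t) - comp i (d_t U x t))
    (fun i t x => comp i (d_xi V x t) - comp i (d_xi U x t))
    (fun i t x => comp i (d_xi (d_xi V) x t) - comp i (d_xi (d_xi U) x t))
    (fun i t x => comp i (F alpha k (V x t)) - comp i (F alpha k (U x t)))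
    k10 cPh Ph0 (weight_gt0 s1_ge0 s2_ge0) rP tPh _ _ _ _ _ _ _ _ _ _ _ _ _ t1 i x _).
  - move=> j t y /andP[t0 tt].
    have D1 := is_derive_comp j (derivable_is_derive (sol_derivable_t sV (xi:=y) t0 (ltT t tt))).
    have D2 := is_derive_comp j (derivable_is_derive (sol_derivable_t sU (xi:=y) t0 (lty t))).
    exact: is_deriveB D1 D2.
  - move=> j t y /andP[t0 tt].
    have D1 := is_derive_comp j (derivable_is_derive (sol_derivable_xi sV (xi:=y) t0 (ltT t tt))).
    have D2 := is_derive_comp j (derivable_is_derive (sol_derivable_xi sU (xi:=y) t0 (lty t))).
    exact: is_deriveB D1 D2.
  - move=> j t y /andP[t0 tt].
    have D1 := is_derive_comp j (derivable_is_derive (sol_derivable_xixi sV (xi:=y) t0 (ltT t tt))).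
    have D2 := is_derive_comp j (derivable_is_derive (sol_derivable_xixi sU (xi:=y) t0 (lty t))).
    exact: is_deriveB D1 D2.
  - move=> j t y /andP[t0 tt].
    rewrite (sol_pde sV y t0 (ltT t tt)) (sol_pde sU y t0 (lty t)).
    have E (p q r : R * R) : comp j (p - c *: q + r) = comp j p - c * comp j q + comp j r by case: j.
    have Ed (p q r p' q' r' : R) : (p - c * q + r) - (p' - c * q' + r') = (p - p') - c * (q - q') + (r - r') by ring.
    by rewrite !E; exact: Ed.
  - move=> j t tt; have [cf _] := (CsigmaP s1_ge0 s2_ge0 _).1 (CS t tt).
    rewrite (_ : W j t = fun x => comp j ((V^~ t \- U^~ t) x)); last by apply/funext => y; exact: WE.
    by move=> y; apply: cvg_comp_pair; exact: cf.
  - by move=> j t tt; have [] := tail_cvg (Wt j t tt).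
  - by move=> j t tt; have [] := tail_cvg (Wt j t tt).
  - move=> t0 e /andP[t00 tt] e0; have e2 : 0 < e / 2 by rewrite divr_gt0.
    have [d1 d10 H1] := solution_unif sV t00 (ltT t0 tt) e2.
    have [d2 d20 H2] := solution_unif sU t00 (lty t0) e2.
    exists (Num.min d1 d2); first by rewrite lt_min d10.
    move=> j t y /andP[t0' tt'] ; rewrite lt_min => /andP[td1 td2].
    have q1 := H1 j t y t0' (ltT t tt') td1; have q2 := H2 j t y t0' (lty t) td2.
    have w0 := weight_gt0 s1_ge0 s2_ge0 y.
    rewrite (_ : W j t y - W j t0 y = (comp j (V y t) - comp j (V y t0)) - (comp j (U y t) - comp j (U y t0))); last by rewrite /W; ring.
    have := ler_wpM2l (ltW w0) (ler_normB (comp j (V y t) - comp j (V y t0)) (comp j (U y t) - comp j (U y t0))).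
    lra.
  - move=> j t y th s /andP[t0 tt] /andP[th0 the] Wle s1' sW.
    have Pk := Ph_le s1_ge0 s2_ge0 Ph0 rPh.
    have Wq i' : `|W i' t y| <= 4^-1.
      apply: (le_trans (Wle i')); rewrite (_ : 4^-1 = eta * k2); last by rewrite /eta; field; rewrite gt_eqF.
      by apply: ler_pM => //; [exact: ltW|exact: ltW].
    have Uq i' : `|comp i' (U y t) - wv Us i' y| <= 2^-1.
      by apply: (le_trans (Uh i' y t (ltW t0))); lra.
    have Vq i' : `|comp i' (V y t) - wv Us i' y| <= 2^-1.
      rewrite (_ : _ - _ = W i' t y + (comp i' (U y t) - wv Us i' y)); last by rewrite /W; ring.
      apply: (le_trans (ler_normD _ _)); have := Wq i'; have := Uh i' y t (ltW t0); lra.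
    have bU : inbox alpha k (U y t).1 (U y t).2.
      by have := wave_box hw y (Uq true) (Uq false); rewrite !(addrC _ (comp _ _ - _)) !subrK.
    have bV : inbox alpha k (V y t).1 (V y t).2.
      by have := wave_box hw y (Vq true) (Vq false); rewrite !(addrC _ (comp _ _ - _)) !subrK.
    have Lf := lip j bU bV.
    rewrite -!comp_F in Lf.
    have w1 : `|(V y t).1 - (U y t).1| <= th * (k2 / k1 * Ph j y).
      apply: (le_trans (Wle true)); apply: ler_wpM2l; first exact: ltW.
      exact: (Ph_ratio s1_ge0 s2_ge0 k10 k20 rPh).
    have w2 : `|(V y t).2 - (U y t).2| <= th * (k2 / k1 * Ph j y).
      apply: (le_trans (Wle false)); apply: ler_wpM2l; first exact: ltW.
      exact: (Ph_ratio s1_ge0 s2_ge0 k10 k20 rPh).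
    have w3 := ler_wpM2l L_ge0 (lerD w1 w2).
    have w4 := le_trans Lf w3.
    set D := comp _ _ - comp _ _ in w4 *.
    have w5 : s * D <= `|D|.
      by apply: (le_trans (ler_norm _)); rewrite normrM; case: s1' => ->; rewrite ?normrN normr1 mul1r.
    have p0 : 0 < th * Ph j y by rewrite mulr_gt0.
    have w6 : - Dgw alpha k Us j y * (th * Ph j y) <= La * (th * Ph j y).
      apply: ler_wpM2r; first exact: ltW.
      by apply: (le_trans (ler_norm _)); rewrite normrN; exact: (Dgw_le ha hk hw).
    have w7 : 0 <= Ofw alpha k Us j y * (th * Ph (~~ j) y).
      by apply: mulr_ge0; [exact: (Ofw_ge0 hk hw)|rewrite mulr_ge0// ltW].
    have w8 : 0 <= b * (th * Ph j y) by rewrite mulr_ge0// ltW.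
    rewrite /kap; lra.
  - exact: ell0.
  - exact: lexx.
  - by move=> j y; rewrite /W (sol_init sV) (sol_init sU) subrr normr0 mul0r.
  - move=> t /andP[t0 tt]; apply: le_trans elle; apply: ler_wpM2l; first exact: ltW.
    by rewrite ler_expR; apply: ler_wpM2l => //; exact: ltW.
  - by rewrite t10 lexx.
apply: comp_inj => i; apply/eqP; rewrite -subr_eq0 -normr_le0 leNgt; apply/negP => Wp.
rewrite -/(W i t1 x1) in Wp.
pose E := expR (kap * t1); have E0 : 0 < E by exact: expR_gt0.
(* The first entry makes the level admissible up to [t1]; the second would bound a nonzero
   difference by half of itself. *)
pose ell := Num.min (eta / E) (`|W i t1 x1| / (2 * E * Ph i x1)).
have D0 : 0 < 2 * E * Ph i x1 by rewrite !mulr_gt0.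
have ell0 : 0 < ell by rewrite lt_min !divr_gt0.
have l1 : ell * E <= eta by rewrite -ler_pdivlMr// ge_min lexx.
have l2 : ell * (2 * E * Ph i x1) <= `|W i t1 x1| by rewrite -ler_pdivlMr// ge_min lexx orbT.
have := key ell ell0 l1 i x1; rewrite -/E; lra.
Qed.

End uniqueness.

Theorem theorem16 (R : realType) (alpha k c sigma1 sigma2 : R)
    (Ustar : R -> R * R)
    (halpha : 0 < alpha < 1) (hk : 0 < k < 1) (hc : 2 * Num.sqrt alpha < c)
    (hwave : traveling_wave alpha k c Ustar)
    (hsigma1 : 0 <= sigma1 < (- c + Num.sqrt (c ^+ 2 + 4 * alpha)) / 2)
    (hsigma2 : (c - Num.sqrt (c ^+ 2 - 4 * alpha)) / 2 < sigma2
                 < (c + Num.sqrt (c ^+ 2 - 4 * alpha)) / 2) :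
  exists delta M b : R, [/\ 0 < delta, 0 < M, 0 < b &
    forall Ubar : R -> R * R,
      continuous Ubar ->
      Csigma sigma1 sigma2 (Ubar \- Ustar) ->
      Cnorm sigma1 sigma2 (Ubar \- Ustar) < delta ->
      exists U : R -> R -> R * R,
        [/\ solution alpha k c sigma1 sigma2 Ustar +oo%E Ubar U,
            (forall (T : \bar R) (V : R -> R -> R * R),
               solution alpha k c sigma1 sigma2 Ustar T Ubar V ->
               forall xi t : R, 0 <= t -> (t%:E < T)%E -> V xi t = U xi t) &
            forall t : R, 0 < t ->
              Cnorm sigma1 sigma2 (U^~ t \- Ustar) <= M * expR (- (b * t))]].
Proof.
have s1_ge0 : 0 <= sigma1 by case/andP: hsigma1.
have s2_ge0 : 0 <= sigma2 by apply: ltW; exact: (s2_gt0 halpha hc hsigma2).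
have [Ph [b [k1 [k2 [[b0 k10 k20] cPh Ph0 rPh tPh]]]]] :=
  wave_supersolution halpha hk hc hwave hsigma1 hsigma2.
have [C C0 HC] := Fc_taylor halpha hk.
have [L L_ge0 HL] := Fc_lip halpha hk.
have h0 : 0 < (4^-1 : R) <= 4^-1 by rewrite lexx andbT invr_gt0.
have [N [a0 [a1 [a2 [L0 [Ca [[L00 Nc Nl N0] [a0c a1c a2c] [a0l a1l a2l] Nd NE]]]]]]] :=
  truncated_nonlinearity halpha hk hwave h0.
(* The coefficient of eta in [eta_b], increased by 1 to be positive. *)
pose D := C * (2 * k2 / k1) ^+ 2 * k2 + 1.
have D0 : 0 < D.
  by rewrite ltr_wpDl//; apply: mulr_ge0; [rewrite mulr_ge0// sqr_ge0|exact: ltW].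
(* The first entry keeps the perturbation in the range where the truncation is the identity; the
   second leaves b / 4 where b / 2 is needed. *)
pose eta := Num.min (4^-1 / k2) (b / 4 / D).
have eta0 : 0 < eta by rewrite lt_min !divr_gt0.
have eta_h : eta * k2 <= 4^-1 by rewrite -ler_pdivlMr// ge_min lexx.
have eta_b : C * eta * (2 * k2 / k1) ^+ 2 * k2 < b / 2.
  have : eta * D <= b / 4 by rewrite -ler_pdivlMr// ge_min lexx orbT.
  rewrite /D; lra.
(* The bounds k1 <= weight * [Ph] <= k2 translate between norm and supersolution: norm below k1 eta
   means starting below eta [Ph], and staying below eta e^(-b t / 2) [Ph] means norm at most eta k2
   e^(-b t / 2). *)
exists (k1 * eta), (eta * k2), (b / 2); split; [exact: mulr_gt0|exact: mulr_gt0|exact: divr_gt0|].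
move=> Ubar _ hU hsmall.
have [W [P [Q [Wc W0 [Pc Qc] Wt Wd]]]] :=
  perturbation_exists c s1_ge0 s2_ge0 L00 Nc Nl N0 a0c a1c a2c a0l a1l a2l Nd hU.
pose ell0 := Cnorm sigma1 sigma2 (Ubar \- Ustar) / k1.
have ell00 : 0 <= ell0 by rewrite divr_ge0 ?(ltW k10)//; exact: Cnorm_ge0.
have ell0_lt : ell0 < eta by rewrite ltr_pdivrMr// mulrC.
have W_init i x : `|W i 0 x| <= ell0 * Ph i x.
  have w0 := weight_gt0 s1_ge0 s2_ge0 x.
  have h1 := Cnorm_ge s1_ge0 s2_ge0 x hU; have /andP[h2 _] := rPh i x.
  rewrite W0; apply: (le_trans (comp_le _ _)).
  rewrite -(ler_pM2l w0); apply: (le_trans h1).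
  rewrite /ell0 mulrCA -mulrA ler_peMr//; first exact: Cnorm_ge0.
  by rewrite mulrC ler_pdivlMr// mul1r.
have dec i t x : 0 <= t -> `|W i t x| <= eta * expR (- (b / 2) * t) * Ph i x.
  exact: (@perturbation_decay R alpha k c sigma1 sigma2 Ustar hk hwave s1_ge0 s2_ge0 Ph b k1 k2 (4^-1) C b0 k10 k20 h0 C0
    cPh Ph0 rPh tPh HC eta eta0 eta_h eta_b N W P Q NE Wc Wt Wd ell0 ell00 ell0_lt W_init i t x).
have W_h i t x : 0 <= t -> `|W i t x| <= 4^-1.
  move=> t0; apply: (le_trans (dec i t x t0)); apply: le_trans eta_h.
  apply: ler_pM; [by rewrite mulr_ge0 ?expR_ge0// ltW|exact: ltW| |exact: (Ph_le s1_ge0 s2_ge0 Ph0 rPh)].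
  apply: ler_piMr; first exact: ltW.
  by rewrite -[leRHS]expR0 ler_expR mulNr oppr_le0 mulr_ge0// ltW// divr_gt0.
have sU : solution alpha k c sigma1 sigma2 Ustar +oo%E Ubar (Usol Ustar W).
  exact: (Usol_solution hk hwave s1_ge0 s2_ge0 h0 Nc NE Wc W0 Pc Qc Wt Wd W_h).
have UE i x t : comp i (Usol Ustar W x t) - wv Ustar i x = W i t x.
  by rewrite /Usol; case: i => /=; rewrite addrC addKr.
exists (Usol Ustar W); split => //.
- move=> T V sV; apply: (solution_unique halpha hk hwave s1_ge0 s2_ge0 b0 k10 k20 L_ge0 cPh Ph0 rPh tPh HL sU sV).
  by move=> i x t t0; rewrite UE; exact: W_h.
- move=> t t0; apply: Cnorm_le => // x; have w0 := weight_gt0 s1_ge0 s2_ge0 x.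
  rewrite mulrC -ler_pdivlMr//; apply: norm_le_comp => i; rewrite ler_pdivlMr// mulrC.
  have -> : comp i ((Usol Ustar W ^~ t \- Ustar) x) = comp i (Usol Ustar W x t) - wv Ustar i x by case: i.
  rewrite UE; have /andP[_ h2] := rPh i x.
  apply: (le_trans (ler_wpM2l (ltW w0) (dec i t x (ltW t0)))).
  have e0 : 0 <= eta * expR (- (b / 2) * t) by rewrite mulr_ge0 ?expR_ge0// ltW.
  have h3 := ler_wpM2l e0 h2.
  by rewrite -(mulNr (b / 2)) mulrCA -[leRHS]mulrA (mulrC k2) [leRHS]mulrA.
Qed.
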